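(* Let $\mathcal{X}_1,\mathcal{X}_2,\mathcal{Y}$ be finite alphabets, let $(X_1,X_2,Y)$ have joint pmf $p(x_1,x_2,y)$ on $\mathcal{X}_1\times\mathcal{X}_2\times\mathcal{Y}$, and let $K\geq1$ be an integer. Let $\mathcal{R}_{\text{CDIB}}^{\text{inner}}(K)$ be the set of tuples $(R_1,R_2,\mu)\in\mathbb{R}^3_{\geq0}$ for which there exist auxiliary random variables $\{V_{1,l},V_{2,l}\}_{l=1}^K$, jointly distributed with $(X_1,X_2,Y)$ and taking values in finite alphabets $\mathcal{V}_{1,l},\mathcal{V}_{2,l}$, such that \begin{align*} R_1&\geq I(X_1;W_{1,K+1}|X_2),\\ R_2&\geq I(X_2;V_{2,K}|W_{2,K})+I(X_2;W_{2,K}|X_1),\\ R_1+R_2&\geq I(X_1X_2;W_{1,K+1}),\\ \mu&\leq I(Y;W_{1,K+1}), \end{align*} and such that for every $l\in[1:K]$ the following are Markov chains: $$V_{1,l} - (X_1,W_{1,l}) - (X_2,Y),\qquad V_{2,l} - (X_2,W_{2,l}) - (X_1,Y).$$ Then $\mathcal{R}_{\text{CDIB}}^{\text{inner}}(K)\subseteq\mathcal{R}_{\text{CDIB}}(K)$. Moreover, in the definition of $\mathcal{R}_{\text{CDIB}}^{\text{inner}}(K)$ the auxiliary random variables can be restricted (without changing the region) to take values in alphabets with \begin{align*} |\mathcal{V}_{1,l}|&\leq|\mathcal{X}_1||\mathcal{W}_{1,l}|+4,\quad l\in[1:K-1],\\ |\mathcal{V}_{2,l}|&\leq|\mathcal{X}_2||\mathcal{W}_{2,l}|+4,\quad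 l\in[1:K-1],\\ |\mathcal{V}_{1,K}|&\leq|\mathcal{X}_1||\mathcal{W}_{1,K}|+3,\\ |\mathcal{V}_{2,K}|&\leq|\mathcal{X}_2||\mathcal{W}_{2,K}|+1, \end{align*} where $|\mathcal{W}_{1,l}|=\prod_{i=1}^{l-1}|\mathcal{V}_{1,i}||\mathcal{V}_{2,i}|$ and $|\mathcal{W}_{2,l}|=|\mathcal{W}_{1,l}||\mathcal{V}_{1,l}|$ for $l\in[1:K]$.
   Context: All logarithms are base 2. $A-B-C$ denotes a Markov chain, i.e. $p(a|b,c)=p(a|b)$. Given random variables $V_{1,l},V_{2,l}$, set $W_{1,l}=\{V_{1,k},V_{2,k}\}_{k=1}^{l-1}$ for $l\in[1:K+1]$ (so $W_{1,1}$ is empty/constant) and $W_{2,l}=\{W_{1,l},V_{1,l}\}$ for $l\in[1:K]$. Let $(X_1^n,X_2^n,Y^n)$ be $n$ i.i.d. copies of $(X_1,X_2,Y)$. A $K$-step $n$-length CDIB code consists of, for $l\in[1:K]$, finite message sets $\mathcal{I}_l=\{1,\dots,|\mathcal{I}_l|\}$, $\mathcal{J}_l=\{1,\dots,|\mathcal{J}_l|\}$ and encoder mappings $$f_l:\mathcal{X}_1^n\times\mathcal{J}_1\times\cdots\times\mathcal{J}_{l-1}\to\mathcal{I}_l,\qquad g_l:\mathcal{X}_2^n\times\mathcal{I}_1\times\cdots\times\mathcal{I}_l\to\mathcal{J}_l .$$ The messages are $I_l=f_l(X_1^n,J_1,\dots,J_{l-1})$ and $J_l=g_l(X_2^n,I_1,\dots,I_l)$,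 with $I^K=(I_1,\dots,I_K)$, $J^K=(J_1,\dots,J_K)$. A triple $(R_1,R_2,\mu)\in\mathbb{R}^3_{\geq0}$ is $K$-achievable if for every $\varepsilon>0$ there is $n_0(\varepsilon)$ such that for all $n>n_0(\varepsilon)$ there is a $K$-step $n$-length CDIB code with $$\tfrac1n\sum_{l=1}^K\log|\mathcal{I}_l|\leq R_1+\varepsilon,\quad \tfrac1n\sum_{l=1}^K\log|\mathcal{J}_l|\leq R_2+\varepsilon,\quad \mu-\varepsilon\leq\tfrac1n I(Y^n;I^KJ^K).$$ $\mathcal{R}_{\text{CDIB}}(K)$ is the set of all $K$-achievable triples. *)

(* Defs.v *)
(* Finite alphabets are finTypes, and probabilities are real-valued functions on
   finite sample spaces.

   Time steps are numbered from 0: index l here is index l + 1 in the usual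
   notation [1 : K].  Families indexed by steps are given on all of nat, but
   only their components with l < K are ever used in a K-step scheme: the
   others can be filled in with singletons and constant maps. *)
From mathcomp Require Import all_boot all_order all_algebra.
From mathcomp Require Import all_classical reals exp.

Set Implicit Arguments.
Unset Strict Implicit.
Unset Printing Implicit Defensive.

Import Order.TTheory GRing.Theory Num.Theory.
Local Open Scope classical_set_scope.
Local Open Scope ring_scope.

Definition log2 (R : realType) (x : R) : R := ln x / ln 2.

Definition is_pmf (R : realType) (T : finType) (p : T -> R) : Prop :=
  (forall t, 0 <= p t) /\ \sum_t p t = 1.

Definition rv2 (O A B : Type) (f : O -> A) (g : O -> B) : O -> A * B :=
  fun w => (f w, g w).

Section Information.
Variables (R : realType) (O : finType) (P : O -> R).

Definition Pr (A : finType) (f : O -> A) (a : A) : R := \sum_(w | f w == a) P w.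

(* P(f = a | g = b), with junk value 0 if P(g = b) = 0. *)
Definition cPr (A B : finType) (f : O -> A) (g : O -> B) (a : A) (b : B) : R :=
  Pr (rv2 f g) (a, b) / Pr g b.

(* The summands with zero weight vanish whatever the value of the logarithm,
   in accordance with the convention 0 log (0/q) = 0. *)
Definition minfo (A B : finType) (f : O -> A) (g : O -> B) : R :=
  \sum_a \sum_b Pr (rv2 f g) (a, b) *
    log2 (Pr (rv2 f g) (a, b) / (Pr f a * Pr g b)).

(* I(f ; g | h) *)
Definition cminfo (A B C : finType) (f : O -> A) (g : O -> B) (h : O -> C) : R :=
  \sum_a \sum_b \sum_c Pr (rv2 (rv2 f g) h) (a, b, c) *
    log2 (cPr (rv2 f g) h (a, b) c / (cPr f h a c * cPr g h b c)).

(* f - g - h : p(a|b,c) = p(a|b) wherever the left-hand side is defined. *)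
Definition markov (A B C : finType) (f : O -> A) (g : O -> B) (h : O -> C) : Prop :=
  forall a b c, Pr (rv2 g h) (b, c) != 0 ->
    cPr f (rv2 g h) a (b, c) = cPr f g a b.

End Information.

(* (t_k)_(k < l) *)
Definition hist (T : nat -> finType) (l : nat) : finType :=
  {dffun forall k : 'I_l, T k}.

Lemma ord_last_eq (l : nat) (k : 'I_l.+1) : ~ (k < l)%N -> l = k.
Proof.
move/negP; rewrite -leqNgt => lk; apply/eqP.
by rewrite eqn_leq lk -ltnS ltn_ord.
Qed.

Definition hist_nil (T : nat -> finType) : hist T 0 :=
  finfun (fun k : 'I_0 => False_rect (T k) (notF (ltn_ord k))).

Definition hist_snoc (T : nat -> finType) (l : nat) (h : hist T l) (x : T l) :
    hist T l.+1 :=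
  finfun (fun k : 'I_l.+1 =>
    match @idP (k < l)%N return T k with
    | ReflectT lt => h (Ordinal lt)
    | ReflectF nlt => eq_rect l (fun i => T i : Type) x k (ord_last_eq nlt)
    end).

Lemma hist_snoc_widen (T : nat -> finType) (l : nat) (h : hist T l) (x : T l)
    (k : 'I_l) : hist_snoc h x (widen_ord (leqnSn l) k) = h k.
Proof.
rewrite ffunE; move: (@idP (widen_ord (leqnSn l) k < l)%N).
move: {2}(widen_ord (leqnSn l) k < l)%N => b; case=> [lt|[]]; last exact: (ltn_ord k).
by case: k lt => k kl lt; rewrite (bool_irrelevance lt kl).
Qed.

Lemma hist_snoc_max (T : nat -> finType) (l : nat) (h : hist T l) (x : T l) :
  hist_snoc h x ord_max = x.
Proof.
rewrite ffunE; move: (@idP ((ord_max : 'I_l.+1) < l)%N).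
move: {2}((ord_max : 'I_l.+1) < l)%N => b; case=> [lt|nlt].
  by exfalso; rewrite /= ltnn in lt.
by rewrite (eq_irrelevance (ord_last_eq nlt) erefl).
Qed.

Section Code.
Variables (X1 X2 : finType) (n : nat).

(* The message sets at step l are 'I_(size_I l) and 'I_(size_J l).  The second
   argument of f_enc l is (J_k)_(k < l), that of g_enc l is (I_k)_(k <= l). *)
Record cdib_code := CdibCode {
  size_I : nat -> nat;
  size_J : nat -> nat;
  f_enc : forall l, {ffun 'I_n -> X1} -> hist (fun k => 'I_(size_J k)) l ->
            'I_(size_I l);
  g_enc : forall l, {ffun 'I_n -> X2} -> hist (fun k => 'I_(size_I k)) l.+1 ->
            'I_(size_J l) }.

(* The messages (I_k)_(k < l) and (J_k)_(k < l) exchanged in the first l steps. *)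
Fixpoint transcript (c : cdib_code) (x1 : {ffun 'I_n -> X1})
    (x2 : {ffun 'I_n -> X2}) (l : nat) :
    hist (fun k => 'I_(size_I c k)) l * hist (fun k => 'I_(size_J c k)) l :=
  match l with
  | 0%N => (hist_nil _, hist_nil _)
  | l'.+1 =>
      let IJ := transcript c x1 x2 l' in
      let I := hist_snoc IJ.1 (f_enc x1 IJ.2) in
      (I, hist_snoc IJ.2 (g_enc x2 I))
  end.

End Code.

Section Achievable.
Variables (R : realType) (X1 X2 Y : finType) (p : X1 * X2 * Y -> R) (K : nat).

Definition iid (n : nat) (w : {ffun 'I_n -> X1 * X2 * Y}) : R := \prod_i p (w i).

Definition block1 n (w : {ffun 'I_n -> X1 * X2 * Y}) : {ffun 'I_n -> X1} :=
  [ffun i => (w i).1.1].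
Definition block2 n (w : {ffun 'I_n -> X1 * X2 * Y}) : {ffun 'I_n -> X2} :=
  [ffun i => (w i).1.2].
Definition blockY n (w : {ffun 'I_n -> X1 * X2 * Y}) : {ffun 'I_n -> Y} :=
  [ffun i => (w i).2].

Definition achievable (R1 R2 mu : R) : Prop :=
  forall eps : R, 0 < eps -> exists n0 : nat, forall n : nat, (n0 < n)%N ->
  exists c : cdib_code X1 X2 n,
    [/\ n%:R^-1 * \sum_(l < K) log2 (size_I c l)%:R <= R1 + eps,
        n%:R^-1 * \sum_(l < K) log2 (size_J c l)%:R <= R2 + eps &
        mu - eps <= n%:R^-1 *
          minfo (@iid n) (@blockY n)
            (fun w => transcript c (block1 w) (block2 w) K)].

Definition cdib_region : set (R * R * R) :=
  [set r | let '(R1, R2, mu) := r in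
    [/\ 0 <= R1, 0 <= R2 & 0 <= mu] /\ achievable R1 R2 mu].

End Achievable.

Section Inner.
Variables (R : realType) (X1 X2 Y : finType) (p : X1 * X2 * Y -> R) (K : nat).

(* A finite probability space carrying (X1, X2, Y) with joint pmf p, together
   with random variables V1 l, V2 l in the finite alphabets A1 l, A2 l. *)
Record auxiliary := Auxiliary {
  Om : finType;
  prob : Om -> R;
  prob_pmf : is_pmf prob;
  rX1 : Om -> X1;
  rX2 : Om -> X2;
  rY : Om -> Y;
  law_XY : forall t, Pr prob (rv2 (rv2 rX1 rX2) rY) t = p t;
  A1 : nat -> finType;
  A2 : nat -> finType;
  V1 : forall l, Om -> A1 l;
  V2 : forall l, Om -> A2 l }.

Variable a : auxiliary.

Definition W1 (l : nat) (w : Om a) :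
    hist (fun k => (A1 a k * A2 a k)%type : finType) l :=
  finfun (fun k : 'I_l => (V1 k w, V2 k w)).

Definition W2 (l : nat) :
    Om a -> hist (fun k => (A1 a k * A2 a k)%type : finType) l * A1 a l :=
  rv2 (W1 l) (@V1 a l).

Definition card_W1 (l : nat) : nat := (\prod_(i < l) (#|A1 a i| * #|A2 a i|))%N.
Definition card_W2 (l : nat) : nat := (card_W1 l * #|A1 a l|)%N.

Definition markov_chains : Prop :=
  forall l, (l < K)%N ->
    markov (prob (a := a)) (@V1 a l) (rv2 (@rX1 a) (W1 l)) (rv2 (@rX2 a) (@rY a)) /\
    markov (prob (a := a)) (@V2 a l) (rv2 (@rX2 a) (W2 l)) (rv2 (@rX1 a) (@rY a)).

(* W1 K collects all the auxiliary variables of the K steps, and K.-1 is the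
   last step. *)
Definition rate_conditions (R1 R2 mu : R) : Prop :=
  [/\ cminfo (prob (a := a)) (@rX1 a) (W1 K) (@rX2 a) <= R1,
      cminfo (prob (a := a)) (@rX2 a) (@V2 a K.-1) (W2 K.-1) +
        cminfo (prob (a := a)) (@rX2 a) (W2 K.-1) (@rX1 a) <= R2,
      minfo (prob (a := a)) (rv2 (@rX1 a) (@rX2 a)) (W1 K) <= R1 + R2 &
      mu <= minfo (prob (a := a)) (@rY a) (W1 K)].

Definition card_bounds : Prop :=
  [/\ forall l, (l < K.-1)%N -> (#|A1 a l| <= #|X1| * card_W1 l + 4)%N,
      forall l, (l < K.-1)%N -> (#|A2 a l| <= #|X2| * card_W2 l + 4)%N,
      (#|A1 a K.-1| <= #|X1| * card_W1 K.-1 + 3)%N &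
      (#|A2 a K.-1| <= #|X2| * card_W2 K.-1 + 1)%N].

End Inner.

Definition inner_region (R : realType) (X1 X2 Y : finType)
    (p : X1 * X2 * Y -> R) (K : nat) : set (R * R * R) :=
  [set r | let '(R1, R2, mu) := r in
    [/\ 0 <= R1, 0 <= R2 & 0 <= mu] /\
    exists a : auxiliary p, markov_chains K a /\ rate_conditions K a R1 R2 mu].

Definition inner_region_bounded (R : realType) (X1 X2 Y : finType)
    (p : X1 * X2 * Y -> R) (K : nat) : set (R * R * R) :=
  [set r | let '(R1, R2, mu) := r in
    [/\ 0 <= R1, 0 <= R2 & 0 <= mu] /\
    exists a : auxiliary p,
      [/\ markov_chains K a, rate_conditions K a R1 R2 mu & card_bounds K a]].

(* Main.v *)
(* Achievability is by random binning.  Under the ideal law of the n blocks, the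
   word chosen by an encoder at each step is cut by a random hash function into
   three parts.  The first part, of rate just below the entropy of the word given
   what the encoder knows, is almost uniform and independent of that knowledge, so
   that it can be fixed in advance; the word is then a deterministic function of
   the knowledge of the encoder.  The second part is sent, and is just large enough
   for the other encoder to recover the word.  The third part, needed only by the
   decoder, which has no side information, can be sent by either encoder, since by
   then both know the word (except for the very last word), whence the sum rate
   constraint.  All this costs one union bound over decoding errors and the weak
   law of large numbers.

   For the cardinality bounds, multiply the law by r(V), where V is one of the
   auxiliary variables.  Preserving the law of all that precedes V, the Markov chains
   and the rates amounts to linear equations on r, and H(Y | W) is linear in r too:
   minimising it under these equations yields an r whose support is no larger than
   the number of equations. *)
Require Import Defs.
From mathcomp Require Import all_boot all_order all_algebra.
From mathcomp Require Import all_classical reals sequences exp.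
From mathcomp Require Import zify ring lra.
Set Implicit Arguments.
Unset Strict Implicit.
Unset Printing Implicit Defensive.
Import Order.TTheory GRing.Theory Num.Theory.
Local Open Scope classical_set_scope.
Local Open Scope ring_scope.

(** * Entropy of finite random variables *)

(** The law of the words actually produced is never compared with the ideal law. A loss in [0, 1],
    depending on the source and on all the words, is carried through the construction, and making
    one word deterministic raises its mean by at most a deficit. The loss is the indicator that some
    recipient would decode wrongly or that p(y | w) is below a threshold. The latter event alone
    controls the relevance: the cross-entropy with the channel from the decoded words to Y bounds
    H(Y | messages). The rate shared by both encoders is split by a single fraction, common to all
    words but the last one, and the three rate inequalities suffice for such a fraction to exist.
    For the cardinalities, each of the three rate constraints costs one equation besides the law of
    the conditioning variable, hence a surplus of 3, below the stated 4. For the last word the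
    Markov chain ties these constraints to a single quantity, hence the surplus 1. Throughout the
    reduction the sample space is fixed and only its weights change, so supports are counted;
    alphabets are cut down to supports at the very end. *)

Section Entropy.
Variables (R : realType) (O : finType) (P : O -> R).
Hypothesis hP : is_pmf P.

Let P_ge0 w : 0 <= P w. Proof. by case: hP. Qed.

Lemma Pr_ge0 (A : finType) (f : O -> A) a : 0 <= Pr P f a.
Proof. exact: sumr_ge0. Qed.

Lemma sum_Pr (A : finType) (f : O -> A) (g : A -> R) :
  \sum_a Pr P f a * g a = \sum_w P w * g (f w).
Proof.
rewrite [RHS](partition_big f xpredT) //=; apply: eq_bigr => a _.
by rewrite /Pr mulr_suml; apply: eq_bigr => w /eqP ->.
Qed.

Lemma sum_Pr_eq1 (A : finType) (f : O -> A) : \sum_a Pr P f a = 1.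
Proof.
have := sum_Pr f (fun=> 1); under eq_bigr do rewrite mulr1.
by move=> ->; under eq_bigr do rewrite mulr1; case: hP.
Qed.

Lemma Pr_at_ge (A : finType) (f : O -> A) w : P w <= Pr P f (f w).
Proof. by rewrite /Pr (bigD1 w) //= lerDl sumr_ge0. Qed.

Lemma Pr_at_gt0 (A : finType) (f : O -> A) w : 0 < P w -> 0 < Pr P f (f w).
Proof. by move=> h; apply: lt_le_trans h (Pr_at_ge f w). Qed.

Lemma Pr_mono (A B : finType) (f : O -> A) (g : O -> B) a b :
  (forall w, f w = a -> g w = b) -> Pr P f a <= Pr P g b.
Proof.
move=> fg; rewrite /Pr [leRHS](bigID (fun w => f w == a)) /=.
rewrite [X in _ <= X + _](_ : _ = Pr P f a); first by rewrite lerDl sumr_ge0.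
apply: eq_bigl => w; apply/andP/idP => [[]//|/eqP fa].
by split; apply/eqP => //; apply: fg.
Qed.

Lemma Pr_rv2_le_l (A B : finType) (f : O -> A) (g : O -> B) a b :
  Pr P (rv2 f g) (a, b) <= Pr P f a.
Proof. by apply: Pr_mono => w []. Qed.

Lemma Pr_rv2_le_r (A B : finType) (f : O -> A) (g : O -> B) a b :
  Pr P (rv2 f g) (a, b) <= Pr P g b.
Proof. by apply: Pr_mono => w []. Qed.

Lemma sum_Pr_rv2 (A B : finType) (f : O -> A) (g : O -> B) b :
  \sum_a Pr P (rv2 f g) (a, b) = Pr P g b.
Proof.
rewrite /Pr [RHS](partition_big f xpredT) //=; apply: eq_bigr => a _.
by apply: eq_bigl => w; rewrite /rv2 xpair_eqE andbC.
Qed.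

Lemma Pr_eq (A B : finType) (f : O -> A) (g : O -> B) a b :
  (forall w, P w != 0 -> (f w == a) = (g w == b)) -> Pr P f a = Pr P g b.
Proof.
move=> fg; rewrite /Pr [LHS]big_mkcond [RHS]big_mkcond; apply: eq_bigr => w _.
have [->|/fg ->//] := eqVneq (P w) 0; by rewrite !if_same.
Qed.

Lemma cPr_ge0 (A B : finType) (f : O -> A) (g : O -> B) a b : 0 <= cPr P f g a b.
Proof. by rewrite divr_ge0 ?Pr_ge0. Qed.

Lemma sum_cPr_le1 (A B : finType) (f : O -> A) (g : O -> B) b :
  \sum_a cPr P f g a b <= 1.
Proof.
rewrite /cPr -mulr_suml sum_Pr_rv2.
by have [->|h] := eqVneq (Pr P g b) 0; rewrite ?mul0r // divff.
Qed.

Lemma cPr_at_gt0 (A B : finType) (f : O -> A) (g : O -> B) w :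
  0 < P w -> 0 < cPr P f g (f w) (g w).
Proof.
move=> h; rewrite divr_gt0 //; [exact: (Pr_at_gt0 (rv2 f g))|exact: Pr_at_gt0].
Qed.

Lemma Pr_cPr (A B : finType) (f : O -> A) (g : O -> B) a b :
  Pr P (rv2 f g) (a, b) = Pr P g b * cPr P f g a b.
Proof.
rewrite /cPr; have [e|h] := eqVneq (Pr P g b) 0; last by rewrite mulrCA divff ?mulr1.
apply/eqP; rewrite e mul0r eq_le Pr_ge0 andbT -e; exact: Pr_rv2_le_r.
Qed.

(* Entropies are in nats. *)
Definition ent (A : finType) (f : O -> A) : R := - \sum_w P w * ln (Pr P f (f w)).

Definition cent (A B : finType) (f : O -> A) (g : O -> B) : R :=
  ent (rv2 f g) - ent g.

(** Entropy only sees the partition that a variable induces on the support. Every permutation or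
    regrouping of tuples below is justified this way, by comparing equality tests. *)
Lemma ent_eq (A B : finType) (f : O -> A) (g : O -> B) :
  (forall w w', P w != 0 -> P w' != 0 -> (f w == f w') = (g w == g w')) ->
  ent f = ent g.
Proof.
move=> fg; congr (- _); apply: eq_bigr => w _.
have [->|nw] := eqVneq (P w) 0; first by rewrite !mul0r.
by congr (_ * ln _); apply: Pr_eq => w' nw'; exact: fg.
Qed.

Lemma sum_P_eq (F G : O -> R) : (forall w, 0 < P w -> F w = G w) ->
  \sum_w P w * F w = \sum_w P w * G w.
Proof.
move=> FG; apply: eq_bigr => w _.
have := P_ge0 w; rewrite le_eqVlt => /predU1P[<-|/FG -> //]; by rewrite !mul0r.
Qed.

Lemma sum_P_le (F G : O -> R) : (forall w, 0 < P w -> F w <= G w) ->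
  \sum_w P w * F w <= \sum_w P w * G w.
Proof.
move=> FG; apply: ler_sum => w _.
have := P_ge0 w; rewrite le_eqVlt => /predU1P[<-|h]; first by rewrite !mul0r.
by rewrite ler_pM2l // FG.
Qed.

Lemma cent_sum (A B : finType) (f : O -> A) (g : O -> B) :
  cent f g = - \sum_w P w * ln (cPr P f g (f w) (g w)).
Proof.
rewrite /cent /ent opprK addrC -[in LHS]opprB -sumrB; congr (- _).
under eq_bigr do rewrite -mulrBr; apply: sum_P_eq => w h.
by rewrite /cPr ln_div // posrE ?Pr_at_gt0 // (Pr_at_gt0 (rv2 f g)).
Qed.

Lemma ln2_gt0 : 0 < ln (2 : R). Proof. by rewrite ln_gt0 // ltr1n. Qed.

Lemma minfo_ent (A B : finType) (f : O -> A) (g : O -> B) :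
  minfo P f g * ln 2 = ent f + ent g - ent (rv2 f g).
Proof.
rewrite /minfo pair_big /= (eq_bigr (fun ab => Pr P (rv2 f g) ab *
  log2 (Pr P (rv2 f g) ab / (Pr P f ab.1 * Pr P g ab.2)))); last by case.
rewrite sum_Pr /ent opprK -!sumrN -!big_split /= mulr_suml.
rewrite (eq_bigr (fun w => P w * ln (Pr P (rv2 f g) (rv2 f g w) /
   (Pr P f (f w) * Pr P g (g w))))); last first.
  by move=> w _; rewrite /log2 -!mulrA mulVf ?mulr1 // gt_eqF ?ln2_gt0.
transitivity (\sum_w P w * (- ln (Pr P f (f w)) + - ln (Pr P g (g w)) +
   ln (Pr P (rv2 f g) (rv2 f g w)))); last first.
  by apply: eq_bigr => w _; rewrite !mulrDr !mulrN.
apply: sum_P_eq => w h.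
have [h1 h2 h3] := And3 (Pr_at_gt0 f h) (Pr_at_gt0 g h) (Pr_at_gt0 (rv2 f g) h).
by rewrite ln_div ?posrE ?mulr_gt0 // lnM ?posrE //; lra.
Qed.

Lemma cminfo_ent (A B C : finType) (f : O -> A) (g : O -> B) (h : O -> C) :
  cminfo P f g h * ln 2 = ent (rv2 f h) + ent (rv2 g h) - ent (rv2 (rv2 f g) h) - ent h.
Proof.
rewrite /cminfo pair_big pair_big /= (eq_bigr (fun abc => Pr P (rv2 (rv2 f g) h) abc *
  log2 (cPr P (rv2 f g) h abc.1 abc.2 /
    (cPr P f h abc.1.1 abc.2 * cPr P g h abc.1.2 abc.2)))); last by case=> [[]].
rewrite sum_Pr /ent !opprK -!sumrN -!big_split /= mulr_suml.
rewrite (eq_bigr (fun w => P w * ln (cPr P (rv2 f g) h (rv2 f g w) (h w) /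
   (cPr P f h (f w) (h w) * cPr P g h (g w) (h w))))); last first.
  by move=> w _; rewrite /log2 -!mulrA mulVf ?mulr1 // gt_eqF ?ln2_gt0.
rewrite [RHS](eq_bigr (fun w => P w * (- ln (Pr P (rv2 f h) (rv2 f h w)) -
   ln (Pr P (rv2 g h) (rv2 g h w)) +
   ln (Pr P (rv2 (rv2 f g) h) (rv2 (rv2 f g) h w)) + ln (Pr P h (h w))))); last first.
  by move=> w _; rewrite !mulrDr !mulrN.
apply: sum_P_eq => w Pw.
have pr := Pr_at_gt0 _ Pw; have cpr := cPr_at_gt0 _ _ Pw.
have [h1 h2 h3] := And3 (pr _ (rv2 f h)) (pr _ (rv2 g h)) (pr _ (rv2 (rv2 f g) h)).
have [c1 c2 c3 h4] := And4 (cpr _ _ f h) (cpr _ _ g h) (cpr _ _ (rv2 f g) h) (pr _ h).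
have c4 := mulr_gt0 c1 c2.
rewrite ln_div ?posrE // lnM ?posrE // /cPr !ln_div ?posrE //.
by rewrite /rv2; ring.
Qed.

Lemma ln_le_sub1 (x : R) : 0 < x -> ln x <= x - 1.
Proof.
move=> x0; have := @le_ln1Dx R (x - 1).
by rewrite addrCA subrr addr0; apply; lra.
Qed.

(** Gibbs' inequality for a subnormalised kernel [r], from ln x <= x - 1. A kernel that forgets part
    of the condition gives [cent_le]; a smoothed decoder channel gives [minfo_ge]. *)
Lemma cent_le_cross (A B : finType) (f : O -> A) (g : O -> B) (r : B -> A -> R) :
  (forall b a, 0 <= r b a) -> (forall b, \sum_a r b a <= 1) ->
  (forall w, 0 < P w -> 0 < r (g w) (f w)) ->
  cent f g <= - \sum_w P w * ln (r (g w) (f w)).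
Proof.
move=> r0 r1 rp; rewrite cent_sum lerN2 -subr_le0 -sumrB.
under eq_bigr do rewrite -mulrBr.
apply: (@le_trans _ _ (\sum_w P w * (r (g w) (f w) / cPr P f g (f w) (g w) - 1))).
  apply: sum_P_le => w h; rewrite -ln_div ?posrE ?rp ?cPr_at_gt0 //.
  by apply: ln_le_sub1; rewrite divr_gt0 ?rp ?cPr_at_gt0.
under eq_bigr do rewrite mulrBr mulr1; rewrite sumrB.
case: (hP) => _ ->; rewrite subr_le0.
rewrite -(sum_Pr (rv2 f g) (fun ab => r ab.2 ab.1 / cPr P f g ab.1 ab.2)).
rewrite (eq_bigr (fun ab : A * B => Pr P (rv2 f g) (ab.1, ab.2) *
  (r ab.2 ab.1 / cPr P f g ab.1 ab.2))); last by case.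
rewrite -(pair_big xpredT xpredT (fun a b => Pr P (rv2 f g) (a, b) *
  (r b a / cPr P f g a b))) /= exchange_big /=.
apply: (@le_trans _ _ (\sum_b Pr P g b)); last by rewrite sum_Pr_eq1.
apply: ler_sum => b _.
apply: (@le_trans _ _ (\sum_a Pr P g b * r b a)); last first.
  by rewrite -mulr_sumr ler_piMr ?Pr_ge0.
apply: ler_sum => a _; rewrite Pr_cPr -mulrA ler_wpM2l ?Pr_ge0 //.
have [->|n0] := eqVneq (cPr P f g a b) 0; first by rewrite mul0r.
by rewrite mulrCA divff // mulr1.
Qed.

Lemma cent_ge0 (A B : finType) (f : O -> A) (g : O -> B) : 0 <= cent f g.
Proof.
rewrite cent_sum -sumrN sumr_ge0 // => w _; rewrite -mulrN mulr_ge0 //.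
rewrite oppr_ge0 ln_le0 //; apply: le_trans (sum_cPr_le1 f g (g w)).
by rewrite (bigD1 (f w)) //= lerDl sumr_ge0 // => *; apply: cPr_ge0.
Qed.

Lemma cent_le (A B C : finType) (f : O -> A) (g : O -> B) (h : O -> C) :
  cent f (rv2 g h) <= cent f h.
Proof.
rewrite [leRHS]cent_sum; apply: (cent_le_cross (r := fun bc a => cPr P f h a bc.2)).
- by move=> *; apply: cPr_ge0.
- by move=> *; apply: sum_cPr_le1.
- by move=> *; apply: cPr_at_gt0.
Qed.

Lemma cent_markov (A B C : finType) (f : O -> A) (g : O -> B) (h : O -> C) :
  markov P f g h -> cent f (rv2 g h) = cent f g.
Proof.
move=> mk; rewrite !cent_sum; congr (- _); apply: sum_P_eq => w Pw.
by rewrite mk // gt_eqF // (Pr_at_gt0 (rv2 g h)).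
Qed.

Lemma cent_eq (A B A' B' : finType) (f : O -> A) (g : O -> B) (f' : O -> A')
    (g' : O -> B') :
  (forall w w', (g w == g w') = (g' w == g' w')) ->
  (forall w w', (f w == f w') && (g w == g w') = (f' w == f' w') && (g' w == g' w')) ->
  cent f g = cent f' g'.
Proof.
move=> hg hf; rewrite /cent; congr (_ - _); apply: ent_eq => w w' _ _ //.
by rewrite /rv2 !xpair_eqE.
Qed.

End Entropy.

(** * Product laws *)

Section Product.
Variables (R : realType) (I O : finType) (P : O -> R).
Hypothesis hP : is_pmf P.

Let P_ge0 w : 0 <= P w. Proof. by case: hP. Qed.
Let sumP : \sum_w P w = 1. Proof. by case: hP. Qed.

Definition prodP (w : {ffun I -> O}) : R := \prod_i P (w i).

Lemma expect_prod (c : I -> O -> R) :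
  \sum_w prodP w * \prod_i c i (w i) = \prod_i \sum_o P o * c i o.
Proof. by rewrite bigA_distr_bigA; apply: eq_bigr => w _; rewrite big_split. Qed.

Lemma prodP_pmf : is_pmf prodP.
Proof.
split=> [w|]; first by rewrite prodr_ge0.
have := expect_prod (fun _ _ => 1).
rewrite [RHS]big1 => [<-|i _]; last by under eq_bigr do rewrite mulr1.
by apply: eq_bigr => w _; rewrite big1_eq mulr1.
Qed.

Lemma Pr_prodP (A B : finType) (f : {ffun I -> O} -> A) (a : A) (f0 : O -> B)
    (a0 : I -> B) :
  (forall w, (f w == a) = [forall i, f0 (w i) == a0 i]) ->
  Pr prodP f a = \prod_i Pr P f0 (a0 i).
Proof.
move=> fE; rewrite /Pr (bigA_distr_big_dep (fun i o => f0 o == a0 i)).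
by apply: eq_bigl => w; rewrite fE; apply/forallP/familyP => h i; exact: h.
Qed.

Lemma expect_at (a : O -> R) i :
  \sum_w prodP w * a (w i) = \sum_o P o * a o.
Proof.
pose c k o := if k == i then a o else 1.
transitivity (\prod_k \sum_o P o * c k o).
  rewrite -expect_prod; apply: eq_bigr => w _; congr (_ * _).
  rewrite (bigD1 i) //= /c eqxx big1 ?mulr1 // => k /negbTE -> //.
rewrite (bigD1 i) //= [X in _ * X]big1 ?mulr1 => [|k /negbTE ki].
  by rewrite /c eqxx.
by rewrite /c ki; under eq_bigr do rewrite mulr1.
Qed.

Lemma expect_at2 (a b : O -> R) i j : i != j ->
  \sum_w prodP w * (a (w i) * b (w j)) =
  (\sum_o P o * a o) * (\sum_o P o * b o).
Proof.
move=> ij; pose c k o := if k == i then a o else if k == j then b o else 1.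
have ci o : c i o = a o by rewrite /c eqxx.
have cj o : c j o = b o by rewrite /c eq_sym (negbTE ij) eqxx.
have ck k o : k != i -> k != j -> c k o = 1 by rewrite /c => /negbTE -> /negbTE ->.
transitivity (\prod_k \sum_o P o * c k o).
  rewrite -expect_prod; apply: eq_bigr => w _; congr (_ * _).
  rewrite (bigD1 i) //= (bigD1 j) 1?eq_sym //= ci cj big1 ?mulr1 // => k /andP[*].
  exact: ck.
rewrite (bigD1 i) //= (bigD1 j) 1?eq_sym //= [X in _ * (_ * X)]big1 ?mulr1.
  by congr (_ * _); apply: eq_bigr => o _; rewrite ?ci ?cj.
by move=> k /andP[ki kj]; under eq_bigr do rewrite ck // mulr1.
Qed.

(** Independence kills the cross terms. With [c] constant this is the variance behind the weak law;
    with [c] a family of letter probabilities it is the variance of the mass that a random hash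
    sends to one value. *)
Lemma second_moment (c : I -> R) (a : O -> R) : \sum_o P o * a o = 0 ->
  \sum_w prodP w * (\sum_i c i * a (w i)) ^+ 2 =
  (\sum_i c i ^+ 2) * \sum_o P o * a o ^+ 2.
Proof.
move=> a0; pose E i j := \sum_w prodP w * (a (w i) * a (w j)).
transitivity (\sum_i \sum_j c i * c j * E i j).
  rewrite /E; under [RHS]eq_bigr do under eq_bigr do rewrite mulr_sumr.
  under [RHS]eq_bigr do rewrite exchange_big /=.
  rewrite [RHS]exchange_big /=; apply: eq_bigr => w _.
  rewrite expr2 mulr_suml mulr_sumr; apply: eq_bigr => i _.
  by rewrite mulr_sumr mulr_sumr; apply: eq_bigr => j _; ring.
rewrite mulr_suml; apply: eq_bigr => i _; rewrite (bigD1 i) //= big1.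
  by rewrite addr0 /E (expect_at (fun o => a o * a o)) -expr2.
by move=> j ji; rewrite /E expect_at2 1?eq_sym // a0 mul0r mulr0.
Qed.

End Product.

Section LawOfLargeNumbers.
Variables (R : realType) (O : finType) (P : O -> R).
Hypothesis hP : is_pmf P.

Lemma weak_law (g : O -> R) (e d : R) : 0 < e -> 0 < d ->
  exists n0 : nat, forall n, (n0 < n)%N ->
  \sum_(w : {ffun 'I_n -> O} |
      n%:R * e < `|\sum_i g (w i) - n%:R * \sum_o P o * g o|) prodP P w <= d.
Proof.
move=> e0 d0; set m := \sum_o _; pose a o := g o - m.
have a_mean : \sum_o P o * a o = 0.
  rewrite /a; under eq_bigr do rewrite mulrBr.
  by rewrite sumrB -mulr_suml; case: hP => _ ->; rewrite mul1r subrr.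
pose v := \sum_o P o * a o ^+ 2.
have v0 : 0 <= v.
  by apply: sumr_ge0 => o _; rewrite mulr_ge0 ?sqr_ge0 //; case: hP.
(* Chebyshev bounds the exceptional probability by v / (n e^2), which is at most [d] beyond this
   [n]. *)
exists (Num.truncn (v / (d * e ^+ 2))) => n hn.
have n_gt0 : 0 < n%:R :> R by rewrite ltr0n; case: n hn.
have hvn : v / (d * e ^+ 2) <= n%:R.
  apply: le_trans (ltW (truncnS_gt _)) _; rewrite ?divr_ge0 // ?ler_nat //.
have ne0 : 0 < n%:R * e by rewrite mulr_gt0.
have [pge0 _] := @prodP_pmf R 'I_n O P hP.
rewrite -(ler_pM2r (exprn_gt0 2 ne0)) mulr_suml.
apply: (@le_trans _ _ (n%:R * v)); last first.
  rewrite exprMn mulrCA [n%:R ^+ 2]expr2 -!mulrA ler_pM2l //.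
  by rewrite ler_pdivrMr ?mulr_gt0 ?exprn_gt0 // in hvn.
have -> : n%:R * v = \sum_(w : {ffun 'I_n -> O}) prodP P w * (\sum_i 1 * a (w i)) ^+ 2.
  rewrite second_moment //; under eq_bigr do rewrite expr1n.
  by rewrite sumr_const card_ord.
rewrite [leRHS](bigID (fun w : {ffun 'I_n -> O} =>
  n%:R * e < `|\sum_i g (w i) - n%:R * m|)) /=.
rewrite -[leLHS]addr0 lerD //; last first.
  by apply: sumr_ge0 => w _; rewrite mulr_ge0 ?sqr_ge0.
apply: ler_sum => w hw; apply: ler_wpM2l; first exact: pge0.
have -> : \sum_i 1 * a (w i) = \sum_i g (w i) - n%:R * m.
  under eq_bigr do rewrite mul1r.
  by rewrite sumrB sumr_const card_ord mulr_natl.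
by rewrite -[leRHS]real_normK ?num_real // ler_sqr ?nnegrE ?normr_ge0 ?(ltW hw) // ltW.
Qed.

End LawOfLargeNumbers.

(** * Random hashing *)

Section RandomHash.
Variable R : realType.

Definition unif (G : finType) (_ : G) : R := #|G|%:R^-1.

Lemma unif_pmf (G : finType) : (0 < #|G|)%N -> is_pmf (@unif G).
Proof.
move=> G0; split=> [g|]; first by rewrite invr_ge0.
rewrite /unif sumr_const -[_ *+ _]mulr_natr mulVf // pnatr_eq0; lia.
Qed.

(* How far the hash value of a letter drawn from the law [k] is from being uniform. *)
Definition deficit (V F : finType) (h : V -> F) (k : V -> R) : R :=
  \sum_f Num.max 0 (#|F|%:R^-1 - \sum_(x | h x == f) k x).

(** This replaces joint typicality decoding. Since [k] has total mass at most 1, at most 1 / [gam]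
    letters pass the threshold; no uniqueness is tested, and a wrong pick is counted as an error. *)
Definition decode (V F : finType) (k : V -> R) (gam : R) (h : V -> F) (y : F) :
  option V := [pick x | (gam <= k x) && (h x == y)].

(** Covers the case where the entropy of the word given its encoder is too small to fix any part of
    the hash value; the estimate of [expect_deficit] is then too weak. *)
Lemma deficit_card1 (V F : finType) (h : V -> F) (k : V -> R) :
  #|F| = 1%N -> \sum_x k x = 1 -> deficit h k = 0.
Proof.
move=> F1 k1; apply: big1 => f _; rewrite F1 invr1.
rewrite (eq_bigl xpredT) ?k1 ?subrr ?maxxx // => x.
by apply/eqP; apply: (fintype_le1P _); rewrite F1.
Qed.

Variables (V G F : finType) (pi : G -> F).
Hypothesis G0 : (0 < #|G|)%N.
Hypothesis pi_unif : forall f, Pr (@unif G) pi f = #|F|%:R^-1.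

Let hU := unif_pmf G0.

Let Fr_gt0 : 0 < #|F|%:R :> R.
Proof.
by rewrite ltr0n; move/card_gt0P: G0 => [g _]; apply/card_gt0P; exists (pi g).
Qed.

(** A one-sided leftover hash bound. Removing the letters heavier than [th] costs their mass and can
    only lower the hash masses, which is harmless for a deficit; the rest has variance at most [th]
    / |F| at each value. AM-GM with a free parameter [c] replaces the square root of Cauchy-Schwarz.
    The projection [pi] lets one hash function into a product serve for each of its parts. *)
Lemma expect_deficit (k : V -> R) (th c : R) :
  (forall x, 0 <= k x) -> \sum_x k x <= 1 -> 0 <= th -> 0 < c ->
  \sum_(h : {ffun V -> G}) prodP (@unif G) h * deficit (fun x => pi (h x)) k <=
  (1 - \sum_(x | k x <= th) k x) + (#|F|%:R * th / (2 * c) + c / 2).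
Proof.
move=> k0 k1 th0 c0; pose kt x := if k x <= th then k x else 0.
have -> : \sum_(x | k x <= th) k x = \sum_x kt x by rewrite -big_mkcond.
set tau := \sum_x kt x.
have tau1 : tau <= 1.
  by apply: le_trans k1; apply: ler_sum => x _; rewrite /kt; case: ifP.
have kt0 x : 0 <= kt x by rewrite /kt; case: ifP.
pose b f g : R := (pi g == f)%:R - #|F|%:R^-1.
have b_mean f : \sum_g unif g * b f g = 0.
  under eq_bigr do rewrite mulrBr; rewrite sumrB -mulr_suml.
  case: (hU) => _ ->; rewrite mul1r -(pi_unif f) /Pr.
  by under eq_bigr do rewrite mulr_natr mulrb; rewrite -big_mkcond subrr.
have b_var f : \sum_g unif g * b f g ^+ 2 <= #|F|%:R^-1.
  (* A pointwise bound on the square, linear in the indicator up to a multiple of [b], which has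
     mean zero. *)
  apply: (@le_trans _ _ (\sum_g unif g * ((pi g == f)%:R - #|F|%:R^-1 * b f g))).
    apply: ler_sum => g _; apply: ler_wpM2l; first by case: hU.
    rewrite /b; case: eqP => _ /=; last by rewrite le_eqVlt; apply/orP; left; apply/eqP; ring.
    have : 0 <= (#|F|%:R^-1 : R) by rewrite ltW // invr_gt0.
    nra.
  under eq_bigr do rewrite mulrBr mulrCA.
  rewrite sumrB -[X in _ - X]mulr_sumr b_mean mulr0 subr0 -(pi_unif f) /Pr.
  by under eq_bigr do rewrite mulr_natr mulrb; rewrite -big_mkcond.
pose X f (h : {ffun V -> G}) := \sum_x kt x * b f (h x).
have [pge0 psum] := @prodP_pmf R V G _ hU.
have EX f : \sum_h prodP (@unif G) h * X f h ^+ 2 <= th / #|F|%:R.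
  rewrite second_moment //; apply: ler_pM => //.
  - by apply: sumr_ge0 => x _; rewrite sqr_ge0.
  - by apply: sumr_ge0 => g _; rewrite mulr_ge0 ?sqr_ge0 //; case: hU.
  apply: (@le_trans _ _ (\sum_x th * kt x)); last first.
    by rewrite -mulr_sumr ler_piMr.
  apply: ler_sum => x _; rewrite expr2 ler_wpM2r //.
  by rewrite /kt; case: ifP.
have dX (h : {ffun V -> G}) : deficit (fun x => pi (h x)) k <= (1 - tau) +
    \sum_f (#|F|%:R * X f h ^+ 2 / (2 * c) + c / (2 * #|F|%:R)).
  have -> : 1 - tau = \sum_(f : F) (1 - tau) / #|F|%:R.
    by rewrite sumr_const -[_ *+ _]mulr_natr divfK // gt_eqF.
  rewrite -big_split /=; apply: ler_sum => f _.
  have XE : X f h = \sum_(x | pi (h x) == f) kt x - tau / #|F|%:R.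
    rewrite /X /b; under eq_bigr do rewrite mulrBr.
    rewrite sumrB; congr (_ - _); last by rewrite -mulr_suml.
    by rewrite [RHS]big_mkcond; apply: eq_bigr => x _; rewrite mulr_natr mulrb.
  have le1 : \sum_(x | pi (h x) == f) kt x <= \sum_(x | pi (h x) == f) k x.
    by apply: ler_sum => x _; rewrite /kt; case: ifP.
  (* AM-GM, from (n x + c)^2 >= 0 *)
  have amgm : - X f h <= #|F|%:R * X f h ^+ 2 / (2 * c) + c / (2 * #|F|%:R).
    set x := X f h; set n : R := #|F|%:R.
    have n0 : 0 < n by [].
    have -> : n * x ^+ 2 / (2 * c) + c / (2 * n) =
       - x + (n * x + c) ^+ 2 / (2 * c * n) by field; rewrite !gt_eqF.
    by rewrite lerDl divr_ge0 ?sqr_ge0 // !mulr_ge0 // ltW.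
  have am0 : 0 <= #|F|%:R * X f h ^+ 2 / (2 * c) + c / (2 * #|F|%:R).
    have x2 : 0 <= #|F|%:R * X f h ^+ 2 by apply: mulr_ge0; rewrite ?sqr_ge0.
    by rewrite addr_ge0 // divr_ge0 // ?mulr_ge0 // ltW.
  rewrite ge_max; apply/andP; split.
    by rewrite addr_ge0 // divr_ge0 ?subr_ge0.
  apply: le_trans (lerD (lexx _) amgm).
  rewrite XE mulrBl mul1r; lra.
apply: (@le_trans _ _ (\sum_h prodP (@unif G) h * ((1 - tau) +
    \sum_f (#|F|%:R * X f h ^+ 2 / (2 * c) + c / (2 * #|F|%:R))))).
  by apply: ler_sum => h _; apply: ler_wpM2l.
under eq_bigr do rewrite mulrDr.
rewrite big_split /= -mulr_suml psum mul1r lerD2l.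
under eq_bigr do rewrite mulr_sumr.
rewrite exchange_big /=.
apply: (@le_trans _ _ (\sum_(f : F) (th / (2 * c) + c / (2 * #|F|%:R)))); last first.
  rewrite sumr_const -[_ *+ _]mulr_natr le_eqVlt; apply/orP; left; apply/eqP.
  by field; rewrite !gt_eqF.
apply: ler_sum => f _; under eq_bigr do rewrite mulrDr.
rewrite big_split /= -mulr_suml psum mul1r lerD2r.
have -> : \sum_h prodP (@unif G) h * (#|F|%:R * X f h ^+ 2 / (2 * c)) =
    (\sum_h prodP (@unif G) h * X f h ^+ 2) * (#|F|%:R / (2 * c)).
  by rewrite mulr_suml; apply: eq_bigr => h _; ring.
apply: (@le_trans _ _ (th / #|F|%:R * (#|F|%:R / (2 * c)))).
  by rewrite ler_wpM2r // divr_ge0 ?mulr_ge0 // ltW.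
by rewrite le_eqVlt; apply/orP; left; apply/eqP; field; rewrite !gt_eqF.
Qed.

Lemma expect_collision (x y : V) : x != y ->
  \sum_(h : {ffun V -> G}) prodP (@unif G) h * (pi (h x) == pi (h y))%:R =
  #|F|%:R^-1.
Proof.
move=> xy.
have e1 f : \sum_g unif g * (pi g == f)%:R = #|F|%:R^-1.
  rewrite -(pi_unif f) /Pr.
  by under eq_bigr do rewrite mulr_natr mulrb; rewrite -big_mkcond.
transitivity (\sum_(f : F) (#|F|%:R^-1 : R) * #|F|%:R^-1); last first.
  rewrite -mulr_suml sumr_const -[_ *+ _]mulr_natr mulVf ?mul1r // gt_eqF //.
transitivity (\sum_f \sum_(h : {ffun V -> G}) prodP (@unif G) h *
   ((pi (h x) == f)%:R * (pi (h y) == f)%:R)); last first.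
  apply: eq_bigr => f _.
  by rewrite (expect_at2 hU (fun g => (pi g == f)%:R) (fun g => (pi g == f)%:R)) // !e1.
rewrite exchange_big /=; apply: eq_bigr => h _; rewrite -mulr_sumr; congr (_ * _).
rewrite (bigD1 (pi (h y))) //= eqxx mulr1 big1 ?addr0 // => f.
by rewrite eq_sym => /negbTE ->; rewrite mulr0.
Qed.

(** An error needs either the true letter to be below the threshold or another candidate to collide
    with it. Each collision has probability 1 / |F|, and candidates are counted by Markov's
    inequality, 1 <= [k y] / [gam]. *)
Lemma expect_decode (k : V -> R) (gam : R) (x : V) :
  (forall x, 0 <= k x) -> \sum_x k x <= 1 -> 0 < gam ->
  \sum_(h : {ffun V -> G}) prodP (@unif G) h *
    (decode k gam (fun x => pi (h x)) (pi (h x)) != Some x)%:R <=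
  (k x < gam)%R%:R + (gam * #|F|%:R)^-1.
Proof.
move=> k0 k1 gam0.
have [pge0 psum] := @prodP_pmf R V G _ hU.
have gF0 : 0 <= (gam * #|F|%:R)^-1 by rewrite invr_ge0 mulr_ge0 // ltW.
case: (ltrP (k x) gam) => [_|kx].
  apply: (@le_trans _ _ 1); last by rewrite lerDl.
  rewrite -[leRHS]psum; apply: ler_sum => h _.
  by rewrite ler_piMr // lern1 leq_b1.
rewrite add0r.
pose C h y : R := ((y != x) && (gam <= k y)%R)%:R * (pi (h y) == pi (h x))%:R.
apply: (@le_trans _ _ (\sum_(h : {ffun V -> G}) prodP (@unif G) h * \sum_y C h y)).
  apply: ler_sum => h _; apply: ler_wpM2l => //.
  have Cge0 y : 0 <= C h y by rewrite mulr_ge0.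
  case: eqP => [_|]; first by rewrite sumr_ge0.
  rewrite /decode; case: pickP => [y /andP[ky /eqP hy] yx|/(_ x)]; last first.
    by rewrite kx eqxx.
  rewrite (bigD1 y) //= {1}/C ky hy eqxx andbT mulr1.
  have -> : y != x by apply/eqP => e; apply: yx; rewrite e.
  by rewrite lerDl sumr_ge0.
under eq_bigr do rewrite mulr_sumr.
rewrite exchange_big /=.
apply: (@le_trans _ _ (\sum_y k y / gam * #|F|%:R^-1)); last first.
  rewrite -!mulr_suml invfM ler_wpM2r ?invr_ge0 //.
  by rewrite ler_pdivrMr // mulVf // gt_eqF.
apply: ler_sum => y _; rewrite /C.
under eq_bigr do rewrite mulrCA.
rewrite -mulr_sumr; case: (eqVneq y x) => /= [_|yx].
  by rewrite mul0r mulr_ge0 ?invr_ge0 // divr_ge0 // ltW.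
rewrite expect_collision // ler_wpM2r ?invr_ge0 //.
case: (lerP gam (k y)) => [gk|_]; rewrite /=; last by rewrite divr_ge0 // ltW.
by rewrite ler_pdivlMr // mul1r.
Qed.

End RandomHash.

(** * One hash function per word, good for all three purposes *)

Section OneShot.
Variable R : realType.

Lemma exists_le_mean (O : finType) (P f : O -> R) (b : R) : is_pmf P ->
  \sum_w P w * f w <= b -> exists w, f w <= b.
Proof.
move=> [P0 P1] hb; apply: contrapT => /forallNP nf.
have fb w : 0 <= P w * (f w - b).
  by rewrite mulr_ge0 // subr_ge0 ltW // ltNge; apply/negP/nf.
have s0 : \sum_w P w * (f w - b) <= 0.
  under eq_bigr do rewrite mulrBr.
  by rewrite sumrB -mulr_suml P1 mul1r subr_le0.
have : \sum_w P w * (f w - b) == 0 by rewrite eq_le s0 sumr_ge0.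
rewrite psumr_eq0 // => /allP z0.
have Pz w : P w = 0.
  have := z0 w (mem_index_enum w); rewrite /= mulf_eq0 subr_eq0 => /orP[/eqP//|/eqP e].
  by case: (nf w); rewrite e.
by move: P1; rewrite big1 // => /eqP; rewrite eq_sym oner_eq0.
Qed.

Lemma unif_id (G : finType) g : Pr (@unif R G) id g = #|G|%:R^-1.
Proof. by rewrite /Pr big_pred1_eq. Qed.

Lemma unif_fst (G B F : finType) (pi : G -> F) : (0 < #|B|)%N ->
  (forall f, Pr (@unif R G) pi f = #|F|%:R^-1) ->
  forall f, Pr (@unif R (G * B)%type) (fun gb => pi gb.1) f = #|F|%:R^-1.
Proof.
move=> B0 hpi f; rewrite -(hpi f) /Pr big_mkcond [RHS]big_mkcond /=.
rewrite -(pair_bigA _ (fun g b => if pi g == f then unif R (g, b) else 0)) /=.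
apply: eq_bigr => g _; case: eqP => _; last by rewrite big1.
rewrite /unif card_prod sumr_const -[_ *+ _]mulr_natr natrM invfM -mulrA mulVf ?mulr1 //.
by rewrite pnatr_eq0 -lt0n.
Qed.

Variables (Om : finType) (Q : Om -> R).
Hypothesis hQ : is_pmf Q.

(** Resampling the letter from its conditional law given [s] does not change the mean: this turns
    statements about kernels into probabilities of events on [Om]. *)
Lemma expect_cPr (V S : finType) (v : Om -> V) (s : Om -> S) (l : V -> S -> R) :
  \sum_w Q w * \sum_x cPr Q v s x (s w) * l x (s w) = \sum_w Q w * l (v w) (s w).
Proof.
rewrite -(sum_Pr Q s (fun y => \sum_x cPr Q v s x y * l x y)).
rewrite -(sum_Pr Q (rv2 v s) (fun xy => l xy.1 xy.2)).
rewrite (eq_bigr (fun xy : V * S => Pr Q (rv2 v s) (xy.1, xy.2) * l xy.1 xy.2)); last by case.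
rewrite -(pair_bigA _ (fun x y => Pr Q (rv2 v s) (x, y) * l x y)) /= exchange_big /=.
apply: eq_bigr => y _; rewrite mulr_sumr; apply: eq_bigr => x _.
by rewrite (Pr_cPr hQ) mulrA.
Qed.

Lemma sum_cPr_at (V S : finType) (v : Om -> V) (s : Om -> S) w : 0 < Q w ->
  \sum_x cPr Q v s x (s w) = 1.
Proof.
move=> Qw; rewrite /cPr -mulr_suml sum_Pr_rv2 divff // gt_eqF //.
exact: (Pr_at_gt0 hQ).
Qed.

Variables (V S T U : finType) (v : Om -> V) (s : Om -> S) (t : Om -> T) (u : Om -> U).

(** The three costs must be small for the same function, so their means over a random [h] are added
    before one [h] is selected. The [F] part is fixed in advance, [F * M] is what the other encoder
    holds, and [F * M * B] is what the decoder holds. *)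
Lemma hash_exists (F M B : finType) (th c gt gu : R) :
  (0 < #|F|)%N -> (0 < #|M|)%N -> (0 < #|B|)%N ->
  0 <= th -> 0 < c -> 0 < gt -> 0 < gu ->
  exists h : V -> F * M * B,
  \sum_w Q w * (deficit (fun x => (h x).1.1) (fun x => cPr Q v s x (s w)) +
    (decode (fun x => cPr Q v t x (t w)) gt (fun x => (h x).1) (h (v w)).1
       != Some (v w))%:R +
    (decode (fun x => cPr Q v u x (u w)) gu h (h (v w)) != Some (v w))%:R) <=
  (if #|F| == 1%N then 0 else
     \sum_(w | th < cPr Q v s (v w) (s w)) Q w + (#|F|%:R * th / (2 * c) + c / 2)) +
  (\sum_(w | cPr Q v t (v w) (t w) < gt) Q w + (gt * (#|F| * #|M|)%:R)^-1) +
  (\sum_(w | cPr Q v u (v w) (u w) < gu) Q w + (gu * (#|F| * #|M| * #|B|)%:R)^-1).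
Proof.
move=> F0 M0 B0 th0 c0 gt0 gu0.
have Q0 w : 0 <= Q w by case: hQ.
pose G : finType := ((F * M) * B)%type.
have G0 : (0 < #|G|)%N by rewrite !card_prod !muln_gt0 F0 M0 B0.
have pi1 := unif_fst B0 (unif_fst M0 (@unif_id F)).
have pi2 := unif_fst B0 (@unif_id (F * M)%type).
have pi3 := @unif_id G.
have hU : is_pmf (prodP (I := V) (@unif R G)) by exact/prodP_pmf/unif_pmf.
have cge0 (S' : finType) (r : Om -> S') y x : 0 <= cPr Q v r x y by exact: cPr_ge0.
have cle1 (S' : finType) (r : Om -> S') y : \sum_x cPr Q v r x y <= 1.
  exact: sum_cPr_le1.
pose c1 (h : {ffun V -> G}) := \sum_w Q w *
  deficit (fun x => (h x).1.1) (fun x => cPr Q v s x (s w)).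
pose c2 (h : {ffun V -> G}) : R := \sum_w Q w *
  (decode (fun x => cPr Q v t x (t w)) gt (fun x => (h x).1) (h (v w)).1
       != Some (v w))%:R.
pose c3 (h : {ffun V -> G}) : R := \sum_w Q w *
  (decode (fun x => cPr Q v u x (u w)) gu (fun x => h x) (h (v w)) != Some (v w))%:R.
have swap (g : {ffun V -> G} -> Om -> R) (b : Om -> R) :
  (forall w, 0 < Q w -> \sum_h prodP (@unif R G) h * g h w <= b w) ->
  \sum_h prodP (@unif R G) h * \sum_w Q w * g h w <= \sum_w Q w * b w.
  move=> hb; under eq_bigr do rewrite mulr_sumr.
  rewrite exchange_big /=; under eq_bigr do under eq_bigr do rewrite mulrCA.
  by under eq_bigr do rewrite -mulr_sumr; apply: sum_P_le.
have sumQ1 : \sum_w Q w = 1 by case: hQ.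
have indic (p : pred Om) : \sum_w Q w * (p w)%:R = \sum_(w | p w) Q w.
  by rewrite [RHS]big_mkcond; apply: eq_bigr => w _; rewrite mulr_natr mulrb.
have addc (r : R) : r = \sum_w Q w * r by rewrite -mulr_suml sumQ1 mul1r.
have b1 : \sum_h prodP (@unif R G) h * c1 h <= if #|F| == 1%N then 0 else
     \sum_(w | th < cPr Q v s (v w) (s w)) Q w + (#|F|%:R * th / (2 * c) + c / 2).
  case: eqP => [F1|_].
    rewrite big1 // => h _; rewrite /c1 big1 ?mulr0 // => w _.
    have := Q0 w; rewrite le_eqVlt => /predU1P[<-|h0]; first by rewrite mul0r.
    by rewrite deficit_card1 ?mulr0 // sum_cPr_at.
  apply: le_trans (swap _ (fun w => (1 - \sum_(x | cPr Q v s x (s w) <= th) cPr Q v s x (s w))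
      + (#|F|%:R * th / (2 * c) + c / 2)) _) _.
    by move=> w _; apply: (expect_deficit G0 pi1).
  under eq_bigr do rewrite mulrDr.
  rewrite big_split /= -addc lerD2r.
  have -> : \sum_w Q w * (1 - \sum_(x | cPr Q v s x (s w) <= th) cPr Q v s x (s w)) =
    \sum_w Q w * 1 - \sum_w Q w * \sum_x cPr Q v s x (s w) * (cPr Q v s x (s w) <= th)%R%:R.
    rewrite -sumrB; apply: eq_bigr => w _; rewrite -mulrBr [in LHS]big_mkcond /=.
    congr (_ * (_ - _)); apply: eq_bigr => x _; by rewrite mulr_natr mulrb.
  rewrite (expect_cPr v s (fun x y => (cPr Q v s x y <= th)%R%:R)) -sumrB -indic.
  apply: ler_sum => w _; rewrite -mulrBr ler_wpM2l //.
  by rewrite ltNge; case: (cPr Q v s (v w) (s w) <= th)%R; rewrite /= ?subrr ?subr0.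
have b2 : \sum_h prodP (@unif R G) h * c2 h <=
  \sum_(w | cPr Q v t (v w) (t w) < gt) Q w + (gt * (#|F| * #|M|)%:R)^-1.
  apply: le_trans (swap _ (fun w => (cPr Q v t (v w) (t w) < gt)%R%:R +
    (gt * (#|F| * #|M|)%:R)^-1) _) _.
    by move=> w _; rewrite -card_prod; apply: (expect_decode G0 pi2).
  by under eq_bigr do rewrite mulrDr; rewrite big_split /= -addc lerD2r indic.
have b3 : \sum_h prodP (@unif R G) h * c3 h <=
  \sum_(w | cPr Q v u (v w) (u w) < gu) Q w + (gu * (#|F| * #|M| * #|B|)%:R)^-1.
  apply: le_trans (swap _ (fun w => (cPr Q v u (v w) (u w) < gu)%R%:R +
    (gu * (#|F| * #|M| * #|B|)%:R)^-1) _) _.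
    by move=> w _; rewrite -!card_prod; apply: (expect_decode G0 pi3).
  by under eq_bigr do rewrite mulrDr; rewrite big_split /= -addc lerD2r indic.
have e : \sum_h prodP (@unif R G) h * (c1 h + c2 h + c3 h) =
    \sum_h prodP (@unif R G) h * c1 h + \sum_h prodP (@unif R G) h * c2 h +
    \sum_h prodP (@unif R G) h * c3 h.
  by rewrite -!big_split /=; apply: eq_bigr => h _; rewrite !mulrDr.
have key := lerD (lerD b1 b2) b3; rewrite -e in key.
have [h hh] := exists_le_mean hU key.
exists h; apply: le_trans hh.
rewrite le_eqVlt; apply/orP; left; apply/eqP.
by rewrite /c1 /c2 /c3 -!big_split /=; apply: eq_bigr => w _; rewrite !mulrDr.
Qed.

End OneShot.

(** * Replacing a random word by a function of the side information *)

Section Derandomize.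
Variables (R : realType) (Om : finType) (Q : Om -> R).
Hypothesis hQ : is_pmf Q.
Variables (C S V F : finType) (cc : Om -> C) (v : Om -> V) (sd : C -> S) (h : V -> F).
(** The Markov chain in product form: given the whole context, the word depends on it only through
    the side information of its encoder. *)
Hypothesis hk : forall c x,
  Pr Q (rv2 cc v) (c, x) = Pr Q cc c * cPr Q v (fun w => sd (cc w)) x (sd c).

(* Let [m] be the smallest loss, given the side information, over the letters of
   hash value [f], and [k_f] the conditional probability of that hash value.
   Writing m / |F| = k_f m + (1 / |F| - k_f) m, the first part is at most the mean
   loss on [f] and the second one contributes to the deficit: so some [f] is good. *)
Lemma derandomize (l : C -> V -> R) : (0 < #|F|)%N -> (forall c x, 0 <= l c x <= 1) ->
  exists f (phi : S -> V),
  \sum_w Q w * (if h (phi (sd (cc w))) == f then l (cc w) (phi (sd (cc w))) else 1) <=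
  \sum_w Q w * l (cc w) (v w) +
  \sum_w Q w * deficit h (fun x => cPr Q v (fun w => sd (cc w)) x (sd (cc w))).
Proof.
move=> F0 l01; have Q0 w : 0 <= Q w by case: hQ.
(* Only an inhabitant is wanted, to give the [arg min] below a starting letter. *)
have [w0 _] : exists w : Om, Q w <= 1.
  apply: (exists_le_mean hQ); rewrite -[leRHS](proj2 hQ); apply: ler_sum => w _.
  rewrite ler_piMr // -[leRHS](proj2 hQ) (bigD1 w) //= lerDl sumr_ge0 //.
pose s w := sd (cc w); pose k x y := cPr Q v s x y.
have k0 x y : 0 <= k x y by exact: cPr_ge0.
pose lf f c x := if h x == f then l c x else 1.
have lf01 f c x : 0 <= lf f c x <= 1 by rewrite /lf; case: ifP => _ //; rewrite ler01 lexx.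
pose N f y x := \sum_(w | s w == y) Q w * lf f (cc w) x.
have N0 f y x : 0 <= N f y x.
  by apply: sumr_ge0 => w _; rewrite mulr_ge0 //; case/andP: (lf01 f (cc w) x).
have N1 f y x : N f y x <= Pr Q s y.
  by apply: ler_sum => w _; rewrite ler_piMr //; case/andP: (lf01 f (cc w) x).
(* The minimum is over all letters, those outside the bin [f] having loss 1. The chosen letter may
   thus miss the bin, which is why [matched] is later part of the success event. *)
pose phi f y := [arg min_(x < v w0) N f y x]%O.
have phiP f y x : N f y (phi f y) <= N f y x.
  by rewrite /phi; case: arg_minP => // i _; apply.
have split_s (g : Om -> R) : \sum_w g w = \sum_y \sum_(w | s w == y) g w.
  by rewrite (partition_big s xpredT).
have [|f hf] := @exists_le_mean R _ (@unif R F)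
    (fun f => \sum_w Q w * lf f (cc w) (phi f (s w))) (\sum_w Q w * l (cc w) (v w) +
  \sum_w Q w * deficit h (fun x => k x (s w))) (unif_pmf R F0); last first.
  by exists f, (phi f).
have -> : \sum_w Q w * l (cc w) (v w) = \sum_y \sum_f \sum_(x | h x == f) k x y * N f y x.
  rewrite -(sum_Pr Q (rv2 cc v) (fun cx => l cx.1 cx.2)).
  rewrite (eq_bigr (fun cx : C * V => Pr Q (rv2 cc v) (cx.1, cx.2) * l cx.1 cx.2)); last by case.
  rewrite -(pair_bigA _ (fun c x => Pr Q (rv2 cc v) (c, x) * l c x)) /=.
  under eq_bigr do under eq_bigr do rewrite hk -mulrA.
  under eq_bigr do rewrite -mulr_sumr.
  rewrite (sum_Pr Q cc (fun c => \sum_x cPr Q v s x (sd c) * l c x)).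
  rewrite split_s; apply: eq_bigr => y _.
  transitivity (\sum_x k x y * \sum_(w | s w == y) Q w * l (cc w) x).
    under [RHS]eq_bigr do rewrite mulr_sumr.
    rewrite [RHS]exchange_big /=; apply: eq_bigr => w /eqP sw.
    rewrite mulr_sumr; apply: eq_bigr => x _.
    by rewrite -/(s w) sw /k; ring.
  rewrite (partition_big h xpredT) //=; apply: eq_bigr => f _.
  apply: eq_bigr => x /eqP hx; congr (_ * _); apply: eq_bigr => w _.
  by rewrite /lf hx eqxx.
have -> : \sum_w Q w * deficit h (fun x => k x (s w)) = \sum_y \sum_f
    Pr Q s y * Num.max 0 (#|F|%:R^-1 - \sum_(x | h x == f) k x y).
  rewrite -(sum_Pr Q s (fun y => deficit h (fun x => k x y))).
  by apply: eq_bigr => y _; rewrite /deficit mulr_sumr.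
under eq_bigr do rewrite split_s mulr_sumr.
rewrite exchange_big -big_split /=; apply: ler_sum => y _.
rewrite -big_split /=; apply: ler_sum => f _.
have -> : \sum_(w | s w == y) Q w * lf f (cc w) (phi f (s w)) = N f y (phi f y).
  by apply: eq_bigr => w /eqP ->.
set m := N f y (phi f y); set kf := \sum_(x | h x == f) k x y.
have le1 : kf * m <= \sum_(x | h x == f) k x y * N f y x.
  by rewrite /kf mulr_suml; apply: ler_sum => x _; rewrite ler_wpM2l ?k0 ?phiP.
apply: le_trans (lerD le1 (lexx _)).
have -> : unif R f * m = kf * m + m * (#|F|%:R^-1 - kf) by rewrite /unif; ring.
rewrite lerD2l.
apply: (@le_trans _ _ (m * Num.max 0 (#|F|%:R^-1 - kf))).
  by apply: ler_wpM2l; rewrite ?N0 // le_max lexx orbT.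
by apply: ler_wpM2r; rewrite ?N1 // le_max lexx.
Qed.

End Derandomize.

(** * One-shot interactive coding *)

Section Histories.
Variable T : nat -> finType.

Definition hist_of (g : forall k, T k) (l : nat) : hist T l :=
  finfun (fun k : 'I_l => g k).

Lemma hist_ofE (g : forall k, T k) (l : nat) (k : 'I_l) : hist_of g l k = g k.
Proof. by rewrite ffunE. Qed.

Lemma hist_nil_of (g : forall k, T k) : hist_nil T = hist_of g 0.
Proof. by apply/ffunP; case. Qed.

Lemma hist_snoc_of (g : forall k, T k) (l : nat) :
  hist_snoc (hist_of g l) (g l) = hist_of g l.+1.
Proof.
apply/ffunP => k; rewrite !ffunE.
move: (@idP (k < l)%N); move: {2}(k < l)%N => b; case=> [lt|nlt]; first by rewrite ffunE.
move: (ord_last_eq nlt); move: (nat_of_ord k) => m e; by case: m / e.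
Qed.

Definition hist_pre (K : nat) (l : 'I_K) (w : hist T K) : hist T l :=
  finfun (fun k : 'I_l => w (widen_ord (ltnW (ltn_ord l)) k)).

Lemma hist_pre_of (g : forall k, T k) (K : nat) (l : 'I_K) :
  hist_pre l (hist_of g K) = hist_of g l.
Proof. by apply/ffunP => k; rewrite !ffunE. Qed.

(** Messages not yet exchanged are given default values, so that the recursive estimators can take
    total families whatever the step at which they are called. *)
Definition hist_tot (d : forall k, T k) (l : nat) (h : hist T l) (k : nat) : T k :=
  match @idP (k < l)%N with
  | ReflectT lt => h (Ordinal lt)
  | ReflectF _ => d k
  end.

Lemma hist_tot_of (d g : forall k, T k) (l k : nat) : (k < l)%N ->
  hist_tot d (hist_of g l) k = g k.
Proof.
by move=> kl; rewrite /hist_tot; case: {-}_ / idP => [lt|//]; rewrite ffunE.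
Qed.

End Histories.

Definition upd (T : nat -> Type) (f : forall l, T l) (K : nat) (x : T K) (l : nat) : T l :=
  match @eqP _ K l with
  | ReflectT e => eq_rect K T x l e
  | ReflectF _ => f l
  end.

Lemma upd_same (T : nat -> Type) (f : forall l, T l) (K : nat) (x : T K) :
  upd f x K = x.
Proof. by rewrite /upd; case: eqP => // e; rewrite (eq_irrelevance e erefl). Qed.

Lemma upd_other (T : nat -> Type) (f : forall l, T l) (K : nat) (x : T K) l :
  K != l -> upd f x l = f l.
Proof. by rewrite /upd; case: eqP. Qed.

Section Strategies.
Variables (R : realType) (Om : finType) (Q : Om -> R).
Hypothesis hQ : is_pmf Q.
Variables (Z X1 X2 : finType) (zr : Om -> Z) (x1 : Z -> X1) (x2 : Z -> X2).
Variables (A B FA FB : nat -> finType).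
Variables (va : forall l, Om -> A l) (vb : forall l, Om -> B l).
Variables (ha : forall l, A l -> FA l) (hb : forall l, B l -> FB l).
Hypothesis FA0 : forall l, (0 < #|FA l|)%N.
Hypothesis FB0 : forall l, (0 < #|FB l|)%N.

Definition pairs (l : nat) : finType := (A l * B l)%type.

Definition Wr (l : nat) (w : Om) : hist pairs l := hist_of (fun k => (va k w, vb k w)) l.

(** A derandomised step: [rf1] and [rf2] are the hash values fixed in advance, [rp1] and [rp2] the
    rules by which each encoder derives its word from its source and the earlier words. *)
Record round (l : nat) := Round {
  rf1 : FA l;
  rp1 : X1 * hist pairs l -> A l;
  rf2 : FB l;
  rp2 : X2 * (hist pairs l * A l) -> B l }.

Section Run.
Variable st : forall l, round l.

Definition play (z : Z) (l : nat) (w : hist pairs l) : pairs l :=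
  let a := rp1 (st l) (x1 z, w) in (a, rp2 (st l) (x2 z, (w, a))).

Fixpoint wdet (z : Z) (l : nat) : hist pairs l :=
  match l with
  | 0%N => hist_nil pairs
  | l'.+1 => hist_snoc (wdet z l') (play z (wdet z l'))
  end.

Definition gdet (z : Z) (l : nat) : pairs l := play z (wdet z l).

Lemma wdet_of z l : wdet z l = hist_of (gdet z) l.
Proof. by elim: l => [|l IH] /=; [exact: hist_nil_of|rewrite -hist_snoc_of -IH]. Qed.

(** The chosen words really carry the hash values agreed in advance; otherwise the recipients would
    decode from wrong hash values. *)
Definition matched (z : Z) (l : nat) : bool :=
  (ha (gdet z l).1 == rf1 (st l)) && (hb (gdet z l).2 == rf2 (st l)).

End Run.

Lemma wdet_ext (st st' : forall l, round l) z l :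
  (forall k, (k < l)%N -> st k = st' k) -> wdet st z l = wdet st' z l.
Proof.
elim: l => //= l IH h; rewrite IH => [|k kl]; last by rewrite h // ltnW.
by rewrite /play h.
Qed.

Lemma gdet_ext (st st' : forall l, round l) z l :
  (forall k, (k <= l)%N -> st k = st' k) -> gdet st z l = gdet st' z l.
Proof.
move=> h; rewrite /gdet (@wdet_ext _ st') => [|k kl]; last by rewrite h // ltnW.
by rewrite /play h.
Qed.

Lemma matched_ext (st st' : forall l, round l) z l :
  (forall k, (k <= l)%N -> st k = st' k) -> matched st z l = matched st' z l.
Proof. by move=> h; rewrite /matched (gdet_ext _ h) h. Qed.

Definition ctx1 (l : nat) := rv2 zr (Wr l).
Definition ctx2 (l : nat) := rv2 zr (rv2 (Wr l) (va l)).
Definition side1 (l : nat) (c : Z * hist pairs l) := (x1 c.1, c.2).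
Definition side2 (l : nat) (c : Z * (hist pairs l * A l)) := (x2 c.1, c.2).

Definition deficit1 (l : nat) : R := \sum_w Q w * deficit (@ha l)
  (fun x => cPr Q (va l) (fun w => side1 (ctx1 l w)) x (side1 (ctx1 l w))).
Definition deficit2 (l : nat) : R := \sum_w Q w * deficit (@hb l)
  (fun x => cPr Q (vb l) (fun w => side2 (ctx2 l w)) x (side2 (ctx2 l w))).

(* The words are made deterministic from the last one to the first one, so that
   each deficit is computed under the ideal law of the preceding words. *)
Lemma strategy_exists (K : nat) (l : Z -> hist pairs K -> R) :
  (forall k, (k < K)%N -> forall c x, Pr Q (rv2 (ctx1 k) (va k)) (c, x) =
    Pr Q (ctx1 k) c * cPr Q (va k) (fun w => side1 (ctx1 k w)) x (side1 c)) ->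
  (forall k, (k < K)%N -> forall c x, Pr Q (rv2 (ctx2 k) (vb k)) (c, x) =
    Pr Q (ctx2 k) c * cPr Q (vb k) (fun w => side2 (ctx2 k w)) x (side2 c)) ->
  (forall z w, 0 <= l z w <= 1) ->
  exists st, \sum_w Q w * (if [forall k : 'I_K, matched st (zr w) k]
      then l (zr w) (wdet st (zr w) K) else 1) <=
    \sum_w Q w * l (zr w) (Wr K w) + \sum_(k < K) (deficit1 k + deficit2 k).
Proof.
have [w0 _] : exists w, Q w <= 1.
  apply: (exists_le_mean hQ); rewrite -[leRHS](proj2 hQ); apply: ler_sum => w _.
  have Q0 w' : 0 <= Q w' by case: hQ.
  rewrite ler_piMr // -[leRHS](proj2 hQ) (bigD1 w) //= lerDl sumr_ge0 //.
elim: K l => [|K IH] l h1 h2 l01.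
  exists (fun k => Round (ha (va k w0)) (fun=> va k w0) (hb (vb k w0)) (fun=> vb k w0)).
  rewrite big_ord0 addr0 le_eqVlt; apply/orP; left; apply/eqP.
  apply: eq_bigr => w _; case: forallP => [_|[]]; last by case.
  by congr (_ * l _ _); apply/ffunP; case.
(* The second word of the last step is treated first; its choice, with loss 1 off the bin, is
   absorbed in the loss [l2] for the first word, and that choice in the loss [l1] handed to the
   induction hypothesis. In each application the earlier words are still random under [Q]. *)
have [f2 [p2 hp2]] := derandomize hQ (@hb K) (h2 K (ltnSn K))
  (l := fun c x => l c.1 (hist_snoc c.2.1 (c.2.2, x))) (FB0 K) (fun c x => l01 _ _).
pose l2 (c : Z * hist pairs K) (a : A K) : R :=
  let b := p2 (x2 c.1, (c.2, a)) in
  if hb b == f2 then l c.1 (hist_snoc c.2 (a, b)) else 1.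
have l201 c a : 0 <= l2 c a <= 1 by rewrite /l2; case: ifP => // _; rewrite ler01 lexx.
have [f1 [p1 hp1]] := derandomize hQ (@ha K) (h1 K (ltnSn K)) (FA0 K) l201.
pose l1 z w : R := let a := p1 (x1 z, w) in if ha a == f1 then l2 (z, w) a else 1.
have l101 z w : 0 <= l1 z w <= 1 by rewrite /l1; case: ifP => // _; rewrite ler01 lexx.
have [||st hst] := IH l1 _ _ l101.
- by move=> k kK; apply: h1; rewrite ltnW.
- by move=> k kK; apply: h2; rewrite ltnW.
exists (upd st (Round f1 p1 f2 p2)); set st' := upd _ _.
have stlt k : (k < K)%N -> st' k = st k by move=> kK; rewrite /st' upd_other // gtn_eqF.
have wK z : wdet st' z K = wdet st z K by exact: wdet_ext.
rewrite big_ord_recr /=.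
have e1 : \sum_w Q w * (if [forall k : 'I_K.+1, matched st' (zr w) k]
    then l (zr w) (wdet st' (zr w) K.+1) else 1) =
  \sum_w Q w * (if [forall k : 'I_K, matched st (zr w) k]
      then l1 (zr w) (wdet st (zr w) K) else 1).
  apply: eq_bigr => w _; congr (_ * _).
  have -> : [forall k : 'I_K.+1, matched st' (zr w) k] =
      [forall k : 'I_K, matched st (zr w) k] && matched st' (zr w) K.
    apply/forallP/andP => [h|[/forallP h hK] k].
      split; last exact: (h ord_max).
      apply/forallP => k; rewrite -(@matched_ext st').
        exact: (h (widen_ord (leqnSn K) k)).
      by move=> j jk; apply: stlt; exact: leq_ltn_trans jk (ltn_ord k).
    have := ltn_ord k; rewrite ltnS leq_eqVlt => /predU1P[->//|kK].
    rewrite (@matched_ext _ st); first exact: (h (Ordinal kK)).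
    by move=> j jk; apply: stlt; exact: leq_ltn_trans jk kK.
  case: ifP => [/andP[-> hm]|].
    move: hm; rewrite /matched /gdet /play wK /st' upd_same /= => /andP[m1 m2].
    rewrite /l1 /l2 /= m1 m2 -/st'; congr (l _ _).
    by rewrite wK /play /st' upd_same.
  case: forallP => //= _; rewrite /matched /gdet /play wK /st' upd_same /= /l1 /l2 /=.
  by case: ifP => //= _; case: ifP.
rewrite e1; apply: (le_trans hst).
have hW w : hist_snoc (Wr K w) (va K w, vb K w) = Wr K.+1 w.
  exact: (hist_snoc_of (fun k => (va k w, vb k w))).
have e2 : \sum_w Q w * l (zr w) (hist_snoc (Wr K w) (va K w, vb K w)) =
    \sum_w Q w * l (zr w) (Wr K.+1 w) by under eq_bigr do rewrite hW.
rewrite /= e2 in hp2.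
have hp1' : \sum_w Q w * l1 (zr w) (Wr K w) <= \sum_w Q w * l2 (zr w, Wr K w) (va K w) +
  deficit1 K by exact: hp1.
have hp2' : \sum_w Q w * l2 (zr w, Wr K w) (va K w) <=
   \sum_w Q w * l (zr w) (Wr K.+1 w) + deficit2 K by exact: hp2.
lra.
Qed.

End Strategies.

(** * The protocol for given hash functions and strategy *)

Section Protocol.
Variables (n : nat) (S1 S2 : finType).
Local Notation X1 := {ffun 'I_n -> S1}.
Local Notation X2 := {ffun 'I_n -> S2}.
Variables (A B FA MA BA1 BA2 FB MB BB1 BB2 : nat -> finType).
(* The hash value of a word of step l: the first part is fixed in advance, the
   second one is sent to the other encoder (hence also to the decoder), and the
   last two are sent to the decoder by encoders 1 and 2 respectively. *)
Variables (ha : forall l, A l -> FA l * MA l * (BA1 l * BA2 l))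
          (hb : forall l, B l -> FB l * MB l * (BB1 l * BB2 l)).
Arguments ha {l}.
Arguments hb {l}.
Variables (a0 : forall l, A l) (b0 : forall l, B l).
Local Notation pairs := (pairs A B).
Variables (da : forall l, X2 * hist pairs l -> FA l * MA l -> option (A l))
          (db : forall l, X1 * (hist pairs l * A l) -> FB l * MB l -> option (B l))
          (ea : forall l, hist pairs l -> FA l * MA l * (BA1 l * BA2 l) -> option (A l))
          (eb : forall l, hist pairs l * A l -> FB l * MB l * (BB1 l * BB2 l) -> option (B l)).
Arguments da {l}.
Arguments db {l}.
Arguments ea {l}.
Arguments eb {l}.
Variable st : forall l, round X1 X2 A B FA FB l.
Variable K : nat.

(* Encoder 1 learns the second word of a step only after that step, so it sends
   its share of the corresponding hash value one step later. *)
Definition late (l : nat) : finType := if l is l'.+1 then BB1 l' else unit.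

Definition late_hash (l : nat) : hist pairs l -> late l :=
  match l with
  | 0%N => fun=> tt
  | l'.+1 => fun w => (hb (w ord_max).2).2.1
  end.

Definition MI (l : nat) : finType := (MA l * BA1 l * late l)%type.
Definition MJ (l : nat) : finType := (MB l * BB2 l * BA2 l)%type.

Definition msgI (l : nat) (w : hist pairs l) (a : A l) : MI l :=
  ((ha a).1.2, (ha a).2.1, late_hash w).
Definition msgJ (l : nat) (a : A l) (b : B l) : MJ l :=
  ((hb b).1.2, (hb b).2.2, (ha a).2.2).

(** Encoder 1 recomputes its own words by its deterministic rule and decodes those of encoder 2 from
    the fixed and the received hash parts; [est2] is the mirror image. *)
Fixpoint est1 (x1 : X1) (J : forall k, MJ k) (l : nat) : hist pairs l :=
  match l with
  | 0%N => hist_nil pairs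
  | l'.+1 =>
      let w := est1 x1 J l' in
      let a := rp1 (st l') (x1, w) in
      hist_snoc w (a, odflt (b0 l') (db (x1, (w, a)) (rf2 (st l'), (J l').1.1)))
  end.

Definition est2_word (x2 : X2) (I : forall k, MI k) (l : nat) (w : hist pairs l) : A l :=
  odflt (a0 l) (da (x2, w) (rf1 (st l), (I l).1.1)).

Fixpoint est2 (x2 : X2) (I : forall k, MI k) (l : nat) : hist pairs l :=
  match l with
  | 0%N => hist_nil pairs
  | l'.+1 =>
      let w := est2 x2 I l' in
      let a := est2_word x2 I w in
      hist_snoc w (a, rp2 (st l') (x2, (w, a)))
  end.

(** Without a source, the decoder needs the full hash values. The share of encoder 1 in that of the
    second word of a step comes with the message of the following step, hence the index [l'.+1]. *)
Fixpoint est0 (I : forall k, MI k) (J : forall k, MJ k) (l : nat) : hist pairs l :=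
  match l with
  | 0%N => hist_nil pairs
  | l'.+1 =>
      let w := est0 I J l' in
      let a := odflt (a0 l')
        (ea w (rf1 (st l'), (I l').1.1, ((I l').1.2, (J l').2))) in
      hist_snoc w (a, odflt (b0 l')
        (eb (w, a) (rf2 (st l'), (J l').1.1, ((I l'.+1).2, (J l').1.2))))
  end.

Definition w0 (l : nat) : hist pairs l := hist_of (fun k => (a0 k, b0 k)) l.

Definition totI (l : nat) (h : hist (fun k => 'I_#|MI k|) l) (k : nat) : MI k :=
  enum_val (hist_tot (fun k => enum_rank (msgI (w0 k) (a0 k))) h k).
Definition totJ (l : nat) (h : hist (fun k => 'I_#|MJ k|) l) (k : nat) : MJ k :=
  enum_val (hist_tot (fun k => enum_rank (msgJ (a0 k) (b0 k))) h k).

Definition code : cdib_code S1 S2 n :=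
  @CdibCode S1 S2 n (fun k => #|MI k|) (fun k => #|MJ k|)
    (fun l x1 h => let w := est1 x1 (totJ h) l in
       enum_rank (msgI w (rp1 (st l) (x1, w))))
    (fun l x2 h => let w := est2 x2 (totI h) l in
       let a := est2_word x2 (totI h) w in
       enum_rank (msgJ a (rp2 (st l) (x2, (w, a))))).

Definition decoded (t : hist (fun k => 'I_#|MI k|) K * hist (fun k => 'I_#|MJ k|) K) :
  hist pairs K := est0 (totI t.1) (totJ t.2) K.

Definition decodable (x1 : X1) (x2 : X2) (l : nat) (w : hist pairs l) (ab : pairs l) :=
  [&& da (x2, w) (ha ab.1).1 == Some ab.1,
      db (x1, (w, ab.1)) (hb ab.2).1 == Some ab.2,
      ea w (ha ab.1) == Some ab.1 &
      eb (w, ab.1) (hb ab.2) == Some ab.2].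

(** The share of encoder 1 for the second word of the last step would have to travel in a message of
    step [K], which does not exist: it must carry no information. *)
Hypothesis late_trivial : forall c c' : late K, c = c'.

Variables (Z : finType) (x1 : Z -> X1) (x2 : Z -> X2) (z : Z).
Local Notation wd := (wdet x1 x2 st z).
Local Notation gd := (gdet x1 x2 st z).

Hypothesis good : forall l, (l < K)%N ->
  matched x1 x2 (fun l (a : A l) => (ha a).1.1) (fun l (b : B l) => (hb b).1.1) st z l /\
  decodable (x1 z) (x2 z) (wd l) (gd l).

Let Ist k := msgI (wd k) (gd k).1.
Let Jst k := msgJ (gd k).1 (gd k).2.

Lemma wdetS l : wd l.+1 = hist_snoc (wd l) (gd l). Proof. by []. Qed.

Lemma est1_correct (J : forall k, MJ k) l : (l <= K)%N ->
  (forall k, (k < l)%N -> J k = Jst k) -> est1 (x1 z) J l = wd l.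
Proof.
elim: l => //= l IH lK hJ; rewrite IH ?(ltnW lK) // => [|k kl]; last by rewrite hJ // ltnW.
have [/andP[_ /eqP m2] /and4P[_ /eqP d2 _ _]] := good lK.
congr hist_snoc; rewrite /play; congr pair; rewrite hJ // /Jst /msgJ /=.
by rewrite -m2 -surjective_pairing -[X in db X]/(x1 z, (wd l, (gd l).1)) d2.
Qed.

Lemma est2_word_correct (I : forall k, MI k) l : (l < K)%N ->
  I l = Ist l -> est2_word (x2 z) I (wd l) = (gd l).1.
Proof.
move=> lK hI; have [/andP[/eqP m1 _] /and4P[/eqP d1 _ _ _]] := good lK.
by rewrite /est2_word hI /Ist /msgI /= -m1 -surjective_pairing d1.
Qed.

Lemma est2_correct (I : forall k, MI k) l : (l <= K)%N ->
  (forall k, (k < l)%N -> I k = Ist k) -> est2 (x2 z) I l = wd l.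
Proof.
elim: l => //= l IH lK hI; rewrite IH ?(ltnW lK) // => [|k kl]; last by rewrite hI // ltnW.
by rewrite est2_word_correct ?hI.
Qed.

Lemma late_hash_wd l : late_hash (wd l.+1) = (hb (gd l).2).2.1.
Proof. by rewrite /= hist_snoc_max. Qed.

Lemma est0_correct (I : forall k, MI k) (J : forall k, MJ k) l : (l <= K)%N ->
  (forall k, (k < K)%N -> I k = Ist k) -> (forall k, (k < K)%N -> J k = Jst k) ->
  est0 I J l = wd l.
Proof.
move=> + hI hJ; elim: l => // l IH lK; rewrite wdetS /= IH ?(ltnW lK) //.
have [/andP[/eqP m1 /eqP m2] /and4P[_ _ /eqP d1 /eqP d2]] := good lK.
have -> : ea (wd l) (rf1 (st l), (I l).1.1, ((I l).1.2, (J l).2)) = Some (gd l).1.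
  by rewrite hI // hJ // /Ist /Jst /msgI /msgJ /= -m1 -!surjective_pairing d1.
have -> : (I l.+1).2 = (hb (gd l).2).2.1.
  (* At the last step the late part belongs to a message never sent; any value is right there
     because its type has a single element. *)
  rewrite -late_hash_wd; move: lK; rewrite leq_eqVlt => /predU1P[lK|lK].
    by move: late_trivial; rewrite -lK; apply.
  by rewrite hI.
rewrite hJ // /Jst /msgJ [odflt _ (Some _)]/= -m2 -!surjective_pairing d2 /=.
by [].
Qed.

(** As long as decoding succeeds, each encoder's estimate of the past is the deterministic path, so
    its next message is the one computed along that path, and the induction continues. *)
Lemma transcript_correct l : (l <= K)%N -> transcript code (x1 z) (x2 z) l =
  (hist_of (fun k => enum_rank (Ist k) : 'I_(size_I code k)) l,
   hist_of (fun k => enum_rank (Jst k) : 'I_(size_J code k)) l).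
Proof.
elim: l => [_|l IH lK]; first by congr pair; apply/ffunP; case.
have tI m k : (k < m)%N -> totI (hist_of (fun k => enum_rank (Ist k)) m) k = Ist k.
  by move=> km; rewrite /totI (hist_tot_of _ (fun k => enum_rank (Ist k))) ?enum_rankK.
have tJ m k : (k < m)%N -> totJ (hist_of (fun k => enum_rank (Jst k)) m) k = Jst k.
  by move=> km; rewrite /totJ (hist_tot_of _ (fun k => enum_rank (Jst k))) ?enum_rankK.
rewrite [LHS]/= IH ?(ltnW lK) //=.
rewrite est1_correct ?(ltnW lK) //; last by move=> k kl; apply: tJ.
rewrite -[enum_rank (msgI _ _)]/(enum_rank (Ist l)) (hist_snoc_of (fun k => enum_rank (Ist k))).
rewrite est2_correct ?(ltnW lK) //; last by move=> k kl; apply: tI; rewrite ltnS ltnW.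
rewrite est2_word_correct ?tI //.
rewrite -[enum_rank (msgJ _ _)]/(enum_rank (Jst l)) (hist_snoc_of (fun k => enum_rank (Jst k))).
by [].
Qed.

Lemma decoded_correct : decoded (transcript code (x1 z) (x2 z) K) = wd K.
Proof.
rewrite transcript_correct // /decoded; apply: est0_correct => // k kK.
  by rewrite /totI (hist_tot_of _ (fun k => enum_rank (Ist k))) ?enum_rankK.
by rewrite /totJ (hist_tot_of _ (fun k => enum_rank (Jst k))) ?enum_rankK.
Qed.

End Protocol.

Section OneShotCode.
Variables (R : realType) (Om : finType) (Q : Om -> R).
Hypothesis hQ : is_pmf Q.
Variables (n : nat) (S1 S2 Z : finType).
Local Notation X1 := {ffun 'I_n -> S1}.
Local Notation X2 := {ffun 'I_n -> S2}.
Variables (zr : Om -> Z) (x1 : Z -> X1) (x2 : Z -> X2).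
Variables (A B : nat -> finType) (va : forall l, Om -> A l) (vb : forall l, Om -> B l).
Variables FA MA BA1 BA2 FB MB BB1 BB2 : nat -> finType.
Hypothesis FA0 : forall l, (0 < #|FA l|)%N.
Hypothesis MA0 : forall l, (0 < #|MA l|)%N.
Hypothesis BA10 : forall l, (0 < #|BA1 l|)%N.
Hypothesis BA20 : forall l, (0 < #|BA2 l|)%N.
Hypothesis FB0 : forall l, (0 < #|FB l|)%N.
Hypothesis MB0 : forall l, (0 < #|MB l|)%N.
Hypothesis BB10 : forall l, (0 < #|BB1 l|)%N.
Hypothesis BB20 : forall l, (0 < #|BB2 l|)%N.
Variable K : nat.
Hypothesis late_trivial : forall c c' : late BB1 K, c = c'.

Definition hash_bound (V S T U : finType) (v : Om -> V) (s : Om -> S) (t : Om -> T)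
    (u : Om -> U) (F M B : finType) (th c gt gu : R) : R :=
  (if #|F| == 1%N then 0 else
     \sum_(w | th < cPr Q v s (v w) (s w)) Q w + (#|F|%:R * th / (2 * c) + c / 2)) +
  (\sum_(w | cPr Q v t (v w) (t w) < gt) Q w + (gt * (#|F| * #|M|)%:R)^-1) +
  (\sum_(w | cPr Q v u (v w) (u w) < gu) Q w + (gu * (#|F| * #|M| * #|B|)%:R)^-1).

Local Notation W := (Wr va vb).
Let x1r w := x1 (zr w).
Let x2r w := x2 (zr w).

Variables (c : R) (thA gtA guA thB gtB guB : nat -> R).
Hypothesis c0 : 0 < c.
Hypothesis thA0 : forall l, 0 <= thA l.
Hypothesis gtA0 : forall l, 0 < gtA l.
Hypothesis guA0 : forall l, 0 < guA l.
Hypothesis thB0 : forall l, 0 <= thB l.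
Hypothesis gtB0 : forall l, 0 < gtB l.
Hypothesis guB0 : forall l, 0 < guB l.

Definition boundA (l : nat) : R := hash_bound (va l) (rv2 x1r (W l)) (rv2 x2r (W l)) (W l)
  (FA l) (MA l) (BA1 l * BA2 l)%type (thA l) c (gtA l) (guA l).
Definition boundB (l : nat) : R := hash_bound (vb l)
  (rv2 x2r (rv2 (W l) (va l))) (rv2 x1r (rv2 (W l) (va l))) (rv2 (W l) (va l))
  (FB l) (MB l) (BB1 l * BB2 l)%type (thB l) c (gtB l) (guB l).

Hypothesis mk1 : forall k, (k < K)%N -> forall y x,
  Pr Q (rv2 (rv2 zr (W k)) (va k)) (y, x) =
  Pr Q (rv2 zr (W k)) y * cPr Q (va k) (rv2 x1r (W k)) x (x1 y.1, y.2).
Hypothesis mk2 : forall k, (k < K)%N -> forall y x,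
  Pr Q (rv2 (rv2 zr (rv2 (W k) (va k))) (vb k)) (y, x) =
  Pr Q (rv2 zr (rv2 (W k) (va k))) y *
    cPr Q (vb k) (rv2 x2r (rv2 (W k) (va k))) x (x2 y.1, y.2).

(** The strategy is applied to the loss that some word is undecodable or [yg] fails. Under the ideal
    law a union bound separates the decoding errors, which join the deficits in [boundA] and
    [boundB]. The predicate [yg] is left free; it will express that Y is likely given the decoded
    words. *)
Lemma one_shot_code (yg : Z -> hist (pairs A B) K -> bool) :
  exists (cd : cdib_code S1 S2 n)
         (dec : hist (fun k => 'I_(size_I cd k)) K * hist (fun k => 'I_(size_J cd k)) K ->
                hist (pairs A B) K),
  [/\ forall l, size_I cd l = (#|MA l| * #|BA1 l| * #|late BB1 l|)%N,
      forall l, size_J cd l = (#|MB l| * #|BB2 l| * #|BA2 l|)%N &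
      \sum_w Q w * (~~ yg (zr w) (dec (transcript cd (x1r w) (x2r w) K)))%:R <=
      \sum_(w | ~~ yg (zr w) (W K w)) Q w + \sum_(k < K) (boundA k + boundB k)].
Proof.
have Q0 w : 0 <= Q w by case: hQ.
have [om _] : exists w, Q w <= 1.
  apply: (exists_le_mean hQ); rewrite -[leRHS](proj2 hQ); apply: ler_sum => w _.
  by rewrite ler_piMr // -[leRHS](proj2 hQ) (bigD1 w) //= lerDl sumr_ge0.
have BA0 l : (0 < #|{: BA1 l * BA2 l}|)%N by rewrite card_prod muln_gt0 BA10 BA20.
have BB0 l : (0 < #|{: BB1 l * BB2 l}|)%N by rewrite card_prod muln_gt0 BB10 BB20.
pose ha l := sval (cid (hash_exists hQ (va l) (rv2 x1r (W l)) (rv2 x2r (W l)) (W l)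
  (FA0 l) (MA0 l) (BA0 l) (thA0 l) c0 (gtA0 l) (guA0 l))).
pose hb l := sval (cid (hash_exists hQ (vb l) (rv2 x2r (rv2 (W l) (va l)))
  (rv2 x1r (rv2 (W l) (va l))) (rv2 (W l) (va l))
  (FB0 l) (MB0 l) (BB0 l) (thB0 l) c0 (gtB0 l) (guB0 l))).
pose da l y := decode (fun x => cPr Q (va l) (rv2 x2r (W l)) x y) (gtA l) (fun x => (ha l x).1).
pose ea l y := decode (fun x => cPr Q (va l) (W l) x y) (guA l) (ha l).
pose db l y := decode (fun x => cPr Q (vb l) (rv2 x1r (rv2 (W l) (va l))) x y) (gtB l)
  (fun x => (hb l x).1).
pose eb l y := decode (fun x => cPr Q (vb l) (rv2 (W l) (va l)) x y) (guB l) (hb l).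
pose dA := deficit1 Q zr x1 va vb (fun l x => (ha l x).1.1).
pose dB := deficit2 Q zr x2 va vb (fun l x => (hb l x).1.1).
pose failA l w : R := (da l (x2r w, W l w) (ha l (va l w)).1 != Some (va l w))%:R +
  (ea l (W l w) (ha l (va l w)) != Some (va l w))%:R.
pose failB l w : R :=
  (db l (x1r w, (W l w, va l w)) (hb l (vb l w)).1 != Some (vb l w))%:R +
  (eb l (W l w, va l w) (hb l (vb l w)) != Some (vb l w))%:R.
have hA l : dA l + \sum_w Q w * failA l w <= boundA l.
  apply: le_trans (svalP (cid (hash_exists hQ (va l) (rv2 x1r (W l)) (rv2 x2r (W l)) (W l)
    (FA0 l) (MA0 l) (BA0 l) (thA0 l) c0 (gtA0 l) (guA0 l)))).
  by rewrite -big_split /= le_eqVlt; apply/orP; left; apply/eqP; apply: eq_bigr => w _;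
    rewrite -mulrDr addrA.
have hB l : dB l + \sum_w Q w * failB l w <= boundB l.
  apply: le_trans (svalP (cid (hash_exists hQ (vb l) (rv2 x2r (rv2 (W l) (va l)))
    (rv2 x1r (rv2 (W l) (va l))) (rv2 (W l) (va l))
    (FB0 l) (MB0 l) (BB0 l) (thB0 l) c0 (gtB0 l) (guB0 l)))).
  by rewrite -big_split /= le_eqVlt; apply/orP; left; apply/eqP; apply: eq_bigr => w _;
    rewrite -mulrDr addrA.
pose dcd z l := decodable ha hb da db ea eb (x1 z) (x2 z) (l := l).
(* Decodability is phrased for an arbitrary history, so that the same test applies to the ideal
   words and to the deterministic ones. *)
pose ok z (w : hist (pairs A B) K) : bool :=
  [forall l : 'I_K, dcd z l (hist_pre l w) (w l)] && yg z w.
have [|st hst] := strategy_exists (x1 := x1) (x2 := x2) (K := K)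
   hQ (fun l x => (ha l x).1.1) (fun l x => (hb l x).1.1) FA0 FB0
   (l := fun z w => (~~ ok z w)%:R) mk1 mk2.
  by move=> z w; rewrite ler0n lern1 leq_b1.
pose cd := code ha hb (va ^~ om) (vb ^~ om) da db st.
pose dec := decoded ha hb (va ^~ om) (vb ^~ om) ea eb st (K := K).
exists cd, dec; split.
- by move=> l; rewrite /= !card_prod.
- by move=> l; rewrite /= !card_prod.
apply: le_trans (_ : \sum_w Q w * (~~ ok (zr w) (W K w))%:R +
   \sum_(k < K) (dA k + dB k) <= _); last first.
  apply: (@le_trans _ _ (\sum_w Q w * ((~~ yg (zr w) (W K w))%:R +
      \sum_(k < K) (failA k w + failB k w)) + \sum_(k < K) (dA k + dB k))).
    rewrite lerD2r; apply: ler_sum => w _; apply: ler_wpM2l => //.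
    have f0 l : 0 <= failA l w + failB l w by rewrite !addr_ge0.
    have s0 : 0 <= \sum_(k < K) (failA k w + failB k w) by rewrite sumr_ge0.
    case: (boolP (ok _ _)) => [_|]; first by rewrite addr_ge0.
    rewrite negb_and => /orP[|hy]; last by rewrite hy lerDl.
    case/forallPn => l; rewrite hist_pre_of hist_ofE => hl.
    apply: ler_wpDl => //; rewrite (bigD1 l) //=; apply: ler_wpDr; first exact: sumr_ge0.
    move: hl; rewrite /dcd /decodable /= !negb_and /failA /failB.
    rewrite -!natrD (ler_nat R 1).
    rewrite /x1r /x2r; do 4?[case: (_ != Some _)] => //.
  under eq_bigr do rewrite mulrDr mulr_sumr.
  rewrite big_split /= exchange_big /= -addrA; apply: lerD.
    rewrite le_eqVlt; apply/orP; left; apply/eqP; rewrite [RHS]big_mkcond.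
    by apply: eq_bigr => w _; rewrite mulr_natr mulrb.
  rewrite -big_split /=; apply: ler_sum => k _.
  have := lerD (hA k) (hB k); apply: le_trans.
  under eq_bigr do rewrite mulrDr.
  by rewrite big_split /=; lra.
apply: le_trans hst; apply: ler_sum => w _; apply: ler_wpM2l => //.
case: forallP => [hm|_]; last by rewrite lern1 leq_b1.
rewrite ler_nat; case: (boolP (ok _ _)) => [/andP[/forallP hd hy]|_]; last by rewrite leq_b1.
have -> : dec (transcript cd (x1r w) (x2r w) K) = wdet x1 x2 st (zr w) K; last by rewrite hy.
apply: (@decoded_correct _ _ _ _ _ _ _ _ _ _ _ _ _ _ _ _ _ _ _ _ _ _ _ late_trivial
  _ x1 x2 (zr w)) => l lK; split; first exact: (hm (Ordinal lK)).
have := hd (Ordinal lK).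
by rewrite [wdet _ _ _ _ K]wdet_of hist_pre_of hist_ofE -wdet_of.
Qed.
End OneShotCode.

(** * Asymptotics *)

Section Relevance.
Variables (R : realType) (O A B : finType) (P : O -> R).
Hypothesis hP : is_pmf P.

(* Mixing [q] with the uniform law keeps the logarithm bounded below where [q] is
   small. *)
Lemma minfo_ge (f : O -> A) (g : O -> B) (q : B -> A -> R) (lam d : R) :
  (forall b a, 0 <= q b a) -> (forall b, \sum_a q b a <= 1) ->
  0 < lam -> lam <= 1 -> \sum_w P w * (q (g w) (f w) < lam)%R%:R <= d ->
  ent P f + ln lam - ln 2 - d * ln #|A|%:R <= minfo P f g * ln 2.
Proof.
move=> q0 q1 l0 l1 hd.
have P0 w : 0 <= P w by case: hP.
have [w0 _] : exists w, 0 <= P w.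
  by apply: contrapT => /forallNP h; case: hP => _; rewrite big1 ?(@eqP R) // => [/eqP|w _];
    [rewrite eq_sym oner_eq0|case: (h w)].
have A0 : (0 < #|A|)%N by apply/card_gt0P; exists (f w0).
have Ar : 0 < #|A|%:R :> R by rewrite ltr0n.
have two0 : 0 < 2 :> R by [].
have lnA : 0 <= ln (#|A|%:R : R) by rewrite ln_ge0 // ler1n.
pose r b a : R := q b a / 2 + (2 * #|A|%:R)^-1.
have u0 : 0 < (2 * #|A|%:R)^-1 :> R by rewrite invr_gt0 mulr_gt0.
have r0 b a : 0 < r b a by rewrite ltr_wpDl // divr_ge0.
have r1 b : \sum_a r b a <= 1.
  rewrite big_split /= -mulr_suml sumr_const -[_ *+ #|_|]mulr_natr.
  rewrite invfM -mulrA mulVf ?gt_eqF // mulr1.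
  have := q1 b; lra.
have := cent_le_cross hP (fun b a => ltW (r0 b a)) r1 (fun w _ => r0 (g w) (f w)).
rewrite (minfo_ent hP) /cent => hc.
(* Where [q] is at least [lam] its half of the mixture gives [lam] / 2; elsewhere the uniform half
   gives 1 / (2 |A|), and ln [lam] <= 0 leaves room for the uniform formula. *)
have : \sum_w P w * ((ln lam - ln 2) - (q (g w) (f w) < lam)%R%:R * ln #|A|%:R) <=
    \sum_w P w * ln (r (g w) (f w)).
  apply: sum_P_le => // w _.
  case: ltrP => hq; rewrite ?mul1r ?mul0r ?subr0.
    apply: (@le_trans _ _ (ln (2 * #|A|%:R)^-1)).
      rewrite lnV ?posrE ?mulr_gt0 // lnM ?posrE //.
      have := ln_le0 l1; lra.
    by rewrite ler_ln ?posrE // lerDr divr_ge0.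
  rewrite -ln_div ?posrE // ler_ln ?posrE ?divr_gt0 //.
  apply: (@le_trans _ _ (q (g w) (f w) / 2)); first by rewrite ler_pM2r ?invr_gt0.
  by rewrite lerDl ltW.
under eq_bigr do rewrite mulrBr mulrA.
rewrite sumrB -!mulr_suml; case: (hP) => _ ->; rewrite mul1r.
have := ler_wpM2r lnA hd; lra.
Qed.

End Relevance.

(** * Block variables of a memoryless source *)

Section Letters.
Variables (R : realType) (O : finType) (P : O -> R) (n : nat).
Hypothesis hP : is_pmf P.
Local Notation On := {ffun 'I_n -> O}.
Let Q := prodP (I := 'I_n) P.
Let hQ : is_pmf Q := prodP_pmf 'I_n hP.

(** A history of blocks and a block of histories have different types. This relation says that [f]
    is the block version of [f0] up to an encoding read by [dec], so that product formulas apply to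
    either. *)
Definition letterwise (A' A : finType) (f : On -> A') (f0 : O -> A) (dec : A' -> 'I_n -> A) :=
  forall w a, (f w == a) = [forall i, f0 (w i) == dec a i].

Lemma letterwise_at (A' A : finType) (f : On -> A') (f0 : O -> A) dec :
  letterwise f f0 dec -> forall w i, dec (f w) i = f0 (w i).
Proof. by move=> h w i; have := h w (f w); rewrite eqxx => /esym/forallP/(_ i)/eqP. Qed.

Lemma letterwise_rv2 (A' A B' B : finType) (f : On -> A') (f0 : O -> A) dec
    (g : On -> B') (g0 : O -> B) dec' :
  letterwise f f0 dec -> letterwise g g0 dec' ->
  letterwise (rv2 f g) (rv2 f0 g0) (fun ab i => (dec ab.1 i, dec' ab.2 i)).
Proof.
move=> hf hg w [a b]; rewrite /rv2 xpair_eqE hf hg.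
apply/andP/forallP => [[/forallP h1 /forallP h2] i|h].
  by rewrite xpair_eqE h1 h2.
by split; apply/forallP => i; have := h i; rewrite xpair_eqE => /andP[].
Qed.

Lemma letterwise_block (A : finType) (f0 : O -> A) :
  letterwise (fun w : On => [ffun i => f0 (w i)]) f0 (fun a i => a i).
Proof.
move=> w a; apply/eqP/forallP => [<- i|h]; first by rewrite ffunE.
by apply/ffunP => i; rewrite ffunE; apply/eqP.
Qed.

Lemma Pr_letterwise (A' A : finType) (f : On -> A') (f0 : O -> A) dec a :
  letterwise f f0 dec -> Pr Q f a = \prod_i Pr P f0 (dec a i).
Proof. by move=> h; apply: Pr_prodP => w; rewrite h. Qed.

Lemma cPr_letterwise (A' A B' B : finType) (f : On -> A') (f0 : O -> A) dec
    (g : On -> B') (g0 : O -> B) dec' a b :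
  letterwise f f0 dec -> letterwise g g0 dec' ->
  cPr Q f g a b = \prod_i cPr P f0 g0 (dec a i) (dec' b i).
Proof.
move=> hf hg; rewrite /cPr prodf_div -(Pr_letterwise _ hg).
by rewrite (Pr_letterwise _ (letterwise_rv2 hf hg)).
Qed.

Lemma prodP_gt0 w : 0 < Q w -> forall i, 0 < P (w i).
Proof.
move=> Qw i; rewrite lt_neqAle (proj1 hP) andbT eq_sym; apply/eqP => e.
by move: Qw; rewrite /Q /prodP (bigD1 i) //= e mul0r ltxx.
Qed.

Lemma ln_prod (I : finType) (F : I -> R) : (forall i, 0 < F i) ->
  ln (\prod_i F i) = \sum_i ln (F i).
Proof.
move=> F0; suff: 0 < \prod_i F i /\ ln (\prod_i F i) = \sum_i ln (F i) by case.
apply: (big_rec2 (fun x y => 0 < x /\ ln x = y)) => [|i y x _ [x0 hx]].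
  by rewrite ln1.
by rewrite mulr_gt0 // lnM ?posrE // hx.
Qed.

Lemma ln_cPr_letterwise (A' A B' B : finType) (f : On -> A') (f0 : O -> A) dec
    (g : On -> B') (g0 : O -> B) dec' w :
  letterwise f f0 dec -> letterwise g g0 dec' -> 0 < Q w ->
  ln (cPr Q f g (f w) (g w)) = \sum_i ln (cPr P f0 g0 (f0 (w i)) (g0 (w i))).
Proof.
move=> hf hg Qw; rewrite (cPr_letterwise _ _ hf hg) ln_prod => [|i].
  by apply: eq_bigr => i _; rewrite !(letterwise_at hf) !(letterwise_at hg).
rewrite (letterwise_at hf) (letterwise_at hg) (cPr_at_gt0 hP) //; exact: prodP_gt0.
Qed.

Lemma ent_letterwise (A' A : finType) (f : On -> A') (f0 : O -> A) dec :
  letterwise f f0 dec -> ent Q f = n%:R * ent P f0.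
Proof.
move=> hf; rewrite /ent mulrN; congr (- _).
rewrite (sum_P_eq hQ (G := fun w => \sum_i ln (Pr P f0 (f0 (w i))))); last first.
  move=> w Qw; rewrite (Pr_letterwise _ hf) ln_prod => [|i].
    by apply: eq_bigr => i _; rewrite (letterwise_at hf).
  by rewrite (letterwise_at hf) (Pr_at_gt0 hP) //; exact: prodP_gt0.
under eq_bigr do rewrite mulr_sumr.
rewrite exchange_big /=.
under eq_bigr do rewrite (expect_at hP (fun o => ln (Pr P f0 (f0 o)))).
by rewrite sumr_const card_ord mulr_natl.
Qed.

End Letters.

Section AEP.
Variables (R : realType) (O : finType) (P : O -> R).
Hypothesis hP : is_pmf P.

(** The weak law for the conditional log-likelihood, whose mean is minus the conditional entropy.
    The threshold [n0] depends on the single-letter variables only, hence its place before the block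
    encodings. *)
Lemma aep (A B : finType) (f0 : O -> A) (g0 : O -> B) (e d : R) : 0 < e -> 0 < d ->
  exists n0 : nat, forall n, (n0 < n)%N ->
  forall (A' B' : finType) (f : {ffun 'I_n -> O} -> A') (g : {ffun 'I_n -> O} -> B') dec dec',
  letterwise f f0 dec -> letterwise g g0 dec' ->
  let Q := prodP (I := 'I_n) P in
  \sum_(w | expR (- (n%:R * (cent P f0 g0 - e))) < cPr Q f g (f w) (g w)) Q w <= d /\
  \sum_(w | cPr Q f g (f w) (g w) < expR (- (n%:R * (cent P f0 g0 + e)))) Q w <= d.
Proof.
move=> e0 d0.
have [n0 hn0] := weak_law hP (fun o => ln (cPr P f0 g0 (f0 o) (g0 o))) e0 d0.
exists n0 => n hn A' B' f g dec dec' hf hg Q.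
have hQ : is_pmf Q := prodP_pmf 'I_n hP.
have Q0 w : 0 <= Q w by case: hQ.
have mean : \sum_o P o * ln (cPr P f0 g0 (f0 o) (g0 o)) = - cent P f0 g0.
  by rewrite (cent_sum hP) opprK.
have incl (p q : pred {ffun 'I_n -> O}) : (forall w, 0 < Q w -> p w -> q w) ->
    \sum_(w | p w) Q w <= \sum_(w | q w) Q w.
  move=> pq; rewrite [leLHS]big_mkcond [leRHS]big_mkcond; apply: ler_sum => w _.
  have := Q0 w; rewrite le_eqVlt => /predU1P[<-|h]; first by rewrite !if_same.
  by have := pq w h; case: (p w) => [->//|_]; case: (q w).
have := hn0 n hn; rewrite mean => hw.
split; apply: le_trans hw; apply: incl => w Qw; have c0 := cPr_at_gt0 hQ f g Qw;
  rewrite -[cPr _ _ _ _ _]lnK ?posrE // ltr_expR;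
  rewrite (ln_cPr_letterwise hP hf hg Qw); set S := \sum_i _ => hS.
  by rewrite (lt_le_trans _ (ler_norm _)) //; lra.
rewrite -normrN (lt_le_trans _ (ler_norm _)) //; lra.
Qed.

End AEP.

Section Sizes.
Variable R : realType.

Definition size_above (x : R) : nat := (Num.truncn (expR x)).+1.
Definition size_below (x : R) : nat := maxn 1 (Num.truncn (expR x)).

Lemma size_above_ge (x : R) : expR x <= (size_above x)%:R.
Proof. by rewrite ltW // truncnS_gt. Qed.

Lemma ln_size_above (x : R) : 0 <= x -> ln (size_above x)%:R <= x + ln 2.
Proof.
move=> x0; have e1 : 1 <= expR x by rewrite -expR0 ler_expR.
have -> : x + ln 2 = ln (expR x * 2).
  by rewrite lnM ?posrE ?expR_gt0 // expRK.
rewrite ler_ln ?posrE ?ltr0n ?mulr_gt0 ?expR_gt0 //.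
have -> : (size_above x)%:R = (Num.truncn (expR x))%:R + 1 :> R by rewrite natr1.
have : (Num.truncn (expR x))%:R <= expR x by rewrite truncn_le ?expR_ge0.
lra.
Qed.

Lemma size_below_gt0 (x : R) : (0 < size_below x)%N.
Proof. by rewrite /size_below leq_max. Qed.

Lemma size_below_ge (x : R) : expR x / 2 <= (size_below x)%:R.
Proof.
rewrite /size_below; have := truncnS_gt (expR x); rewrite -natr1.
have [h|h] := leqP 1 (Num.truncn (expR x)).
  have : 1 <= (Num.truncn (expR x))%:R :> R by rewrite ler1n.
  lra.
by move: h; case: (Num.truncn (expR x)) => // _; rewrite add0r; lra.
Qed.

(** Rounding to at least 1 may exceed [expR x]. That excluded value is the one for which the deficit
    vanishes. *)
Lemma size_below_le (x : R) : size_below x <> 1%N -> (size_below x)%:R <= expR x.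
Proof.
rewrite /size_below; case: leqP => // _ _.
by rewrite truncn_le ?expR_ge0.
Qed.

End Sizes.

Section HashBound.
Variables (R : realType) (O : finType) (Q : O -> R).
Variables (V S T U : finType) (v : O -> V) (s : O -> S) (t : O -> T) (u : O -> U).

(** The rates [hs - 2e], then [ht - hs + 4e], then [hu - ht] add up to [ht + 2e] and [hu + 2e]: each
    decoder beats its threshold by [e], and the fixed part stays [e] below its own. The atypical
    events cost 3 [c], the AM-GM term [c] / 2, and the exponentially small terms the other [c] /
    2. *)
Lemma hash_bound_le (F M B : finType) (n hs ht hu e c : R) :
  0 < c -> 0 <= n -> 0 <= e ->
  #|F| = size_below (n * (hs - 2 * e)) ->
  expR (n * (ht - hs + 4 * e)) <= #|M|%:R -> expR (n * (hu - ht)) <= #|B|%:R ->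
  \sum_(w | expR (- (n * (hs - e))) < cPr Q v s (v w) (s w)) Q w <= c ->
  \sum_(w | cPr Q v t (v w) (t w) < expR (- (n * (ht + e)))) Q w <= c ->
  \sum_(w | cPr Q v u (v w) (u w) < expR (- (n * (hu + e)))) Q w <= c ->
  expR (- (n * e)) * ((2 * c)^-1 + 4) <= c / 2 ->
  hash_bound Q v s t u F M B (expR (- (n * (hs - e)))) c (expR (- (n * (ht + e))))
    (expR (- (n * (hu + e)))) <= 4 * c.
Proof.
move=> c0 n0 e0 FE hM hB h1 h2 h3 hc; rewrite /hash_bound.
have ex0 := @expR_gt0 R; set E := expR (- (n * e)) in hc *.
have E0 : 0 < E by exact: ex0.
have hF := size_below_ge (n * (hs - 2 * e)); rewrite -FE in hF.
have inv2 (y : R) : 0 < y -> expR (n * e) / 2 <= y -> y^-1 <= 2 * E.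
  move=> y0 hy; rewrite /E expRN -[2]invrK -invfM lef_pV2 ?posrE ?mulr_gt0 ?invr_gt0 //.
  by rewrite mulrC.
have F0 : 0 < #|F|%:R :> R by apply: lt_le_trans hF; rewrite divr_gt0.
have M0 : 0 < #|M|%:R :> R by apply: lt_le_trans hM.
have B0 : 0 < #|B|%:R :> R by apply: lt_le_trans hB.
have FM : expR (n * (ht + 2 * e)) / 2 <= (#|F| * #|M|)%:R.
  have -> : expR (n * (ht + 2 * e)) / 2 =
      (expR (n * (hs - 2 * e)) / 2) * expR (n * (ht - hs + 4 * e)).
    by rewrite mulrAC -expRD; congr (expR _ / 2); ring.
  by rewrite natrM; apply: ler_pM => //; rewrite ?ltW // divr_gt0.
have t1 : (expR (- (n * (ht + e))) * (#|F| * #|M|)%:R)^-1 <= 2 * E.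
  apply: inv2; first by rewrite natrM !mulr_gt0.
  apply: le_trans (ler_wpM2l (ltW (ex0 _)) FM); rewrite mulrA -expRD.
  by rewrite le_eqVlt; apply/orP; left; apply/eqP; congr (expR _ / 2); ring.
have t2 : (expR (- (n * (hu + e))) * (#|F| * #|M| * #|B|)%:R)^-1 <= 2 * E.
  apply: inv2; first by rewrite !natrM !mulr_gt0.
  have hFMB : expR (n * (ht + 2 * e)) / 2 * expR (n * (hu - ht)) <= (#|F| * #|M| * #|B|)%:R.
    by rewrite natrM; apply: ler_pM => //; rewrite ?ltW // divr_gt0.
  apply: le_trans (ler_wpM2l (ltW (ex0 _)) hFMB); rewrite mulrA mulrAC mulrA -!expRD.
  by rewrite le_eqVlt; apply/orP; left; apply/eqP; congr (expR _ / 2); ring.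
have t0 : (if #|F| == 1%N then 0 else
     \sum_(w | expR (- (n * (hs - e))) < cPr Q v s (v w) (s w)) Q w +
     (#|F|%:R * expR (- (n * (hs - e))) / (2 * c) + c / 2)) <=
   c + E * (2 * c)^-1 + c / 2.
  case: eqP => [_|F1].
    by rewrite !addr_ge0 ?mulr_ge0 ?invr_ge0 ?mulr_ge0 // ltW.
  rewrite -addrA lerD // lerD2r ler_wpM2r ?invr_ge0 ?mulr_ge0 ?(ltW c0) //.
  have hF2 : #|F|%:R <= expR (n * (hs - 2 * e)) by rewrite FE size_below_le // -FE.
  apply: le_trans (ler_wpM2r (ltW (ex0 _)) hF2) _; rewrite -expRD.
  by rewrite le_eqVlt; apply/orP; left; apply/eqP; congr expR; ring.
lra.
Qed.

End HashBound.

Lemma eventually_all (K : nat) (p : nat -> nat -> Prop) :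
  (forall l, exists n0, forall n, (n0 < n)%N -> p l n) ->
  exists n0, forall n, (n0 < n)%N -> forall l, (l < K)%N -> p l n.
Proof.
move=> hp; elim: K => [|K [m hm]]; first by exists 0%N.
have [m' hm'] := hp K; exists (maxn m m') => n; rewrite gtn_max => /andP[h1 h2] l.
rewrite ltnS leq_eqVlt => /predU1P[->|]; [exact: hm'|exact: hm].
Qed.

(** The product form also holds at conditions of probability zero, so it can be multiplied over the
    letters of a block. *)
Lemma markov_Pr (R : realType) (O A B C : finType) (P : O -> R) (f : O -> A) (g : O -> B)
    (h : O -> C) a b c : is_pmf P -> markov P f g h ->
  Pr P (rv2 (rv2 g h) f) ((b, c), a) = Pr P (rv2 g h) (b, c) * cPr P f g a b.
Proof.
move=> hP mk; transitivity (Pr P (rv2 f (rv2 g h)) (a, (b, c))).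
  by apply: Pr_eq => w _; rewrite /rv2 !xpair_eqE andbC.
rewrite [LHS](Pr_cPr hP); set q := Pr P (rv2 g h) (b, c).
have [e|/mk -> //] := eqVneq q 0; by rewrite e !mul0r.
Qed.

Lemma minfo_image (R : realType) (O O' A B : finType) (P : O -> R) (P' : O' -> R)
    (z : O -> O') (f : O' -> A) (g : O' -> B) :
  (forall x, Pr P z x = P' x) ->
  minfo P' f g = minfo P (fun w => f (z w)) (fun w => g (z w)).
Proof.
move=> hz; have e (C : finType) (k : O' -> C) c : Pr P' k c = Pr P (fun w => k (z w)) c.
  rewrite /Pr [RHS](partition_big z (fun x => k x == c)) //=.
  apply: eq_bigr => x /eqP kx; rewrite -hz; apply: eq_bigl => w.
  by apply/idP/andP => [/eqP ->|[]//]; rewrite kx !eqxx.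
rewrite /minfo; apply: eq_bigr => x _; apply: eq_bigr => y _.
by rewrite !e.
Qed.

Section Blocks.
Variables (R : realType) (X1 X2 Y : finType) (p : X1 * X2 * Y -> R) (K : nat).
Variable a : auxiliary p.
Hypothesis hm : markov_chains K a.
Variable n : nat.

Local Notation P := (prob (a := a)).
Let hP : is_pmf P := prob_pmf a.
Local Notation On := {ffun 'I_n -> Om a}.
Local Notation Q := (prodP (I := 'I_n) P).

Definition ZZ : Om a -> X1 * X2 * Y :=
  rv2 (rv2 (@rX1 _ _ _ _ _ a) (@rX2 _ _ _ _ _ a)) (@rY _ _ _ _ _ a).
Definition zr (w : On) : {ffun 'I_n -> X1 * X2 * Y} := [ffun i => ZZ (w i)].
Definition bA (l : nat) : finType := {ffun 'I_n -> A1 a l}.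
Definition bB (l : nat) : finType := {ffun 'I_n -> A2 a l}.
Definition va (l : nat) (w : On) : bA l := [ffun i => V1 l (w i)].
Definition vb (l : nat) (w : On) : bB l := [ffun i => V2 l (w i)].
Local Notation WW := (Wr va vb).

Definition decW (l : nat) (w : hist (pairs bA bB) l) (i : 'I_n) :
    hist (fun k => (A1 a k * A2 a k)%type : finType) l :=
  finfun (fun k : 'I_l => ((w k).1 i, (w k).2 i)).

Lemma letterwise_W l : letterwise (WW l) (W1 l) (@decW l).
Proof.
move=> w h; apply/eqP/forallP => [<- i|e].
  by apply/eqP/ffunP => k; rewrite !ffunE.
apply/ffunP => k; rewrite ffunE [RHS]surjective_pairing.
have ek i : (V1 k (w i), V2 k (w i)) = ((h k).1 i, (h k).2 i).
  by have /eqP/ffunP/(_ k) := e i; rewrite !ffunE.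
by congr pair; apply/ffunP => i; rewrite ffunE; case: (ek i).
Qed.

Lemma letterwise_z : letterwise zr ZZ (fun z i => z i).
Proof. exact: letterwise_block. Qed.

Lemma letterwise_1 : letterwise (fun w => block1 (zr w)) (@rX1 _ _ _ _ _ a) (fun z i => z i).
Proof.
move=> w x; rewrite -(letterwise_block (@rX1 _ _ _ _ _ a)); congr (_ == _).
by apply/ffunP => i; rewrite !ffunE.
Qed.

Lemma letterwise_2 : letterwise (fun w => block2 (zr w)) (@rX2 _ _ _ _ _ a) (fun z i => z i).
Proof.
move=> w x; rewrite -(letterwise_block (@rX2 _ _ _ _ _ a)); congr (_ == _).
by apply/ffunP => i; rewrite !ffunE.
Qed.

Lemma letterwise_Y : letterwise (fun w => blockY (zr w)) (@rY _ _ _ _ _ a) (fun z i => z i).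
Proof.
move=> w x; rewrite -(letterwise_block (@rY _ _ _ _ _ a)); congr (_ == _).
by apply/ffunP => i; rewrite !ffunE.
Qed.

Lemma letterwise_va l : letterwise (va l) (@V1 _ _ _ _ _ a l) (fun z i => z i).
Proof. exact: letterwise_block. Qed.

Lemma letterwise_vb l : letterwise (vb l) (@V2 _ _ _ _ _ a l) (fun z i => z i).
Proof. exact: letterwise_block. Qed.

Lemma Pr_zr z : Pr Q zr z = iid p z.
Proof.
rewrite (Pr_letterwise _ _ letterwise_z); apply: eq_bigr => i _; exact: law_XY.
Qed.

Lemma markov_block1 k : (k < K)%N -> forall y x,
  Pr Q (rv2 (rv2 zr (WW k)) (va k)) (y, x) = Pr Q (rv2 zr (WW k)) y *
    cPr Q (va k) (rv2 (fun w => block1 (zr w)) (WW k)) x (block1 y.1, y.2).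
Proof.
move=> /hm[mk _] [z h] x.
have lzW := letterwise_rv2 letterwise_z (@letterwise_W k).
have l1W := letterwise_rv2 letterwise_1 (@letterwise_W k).
rewrite (Pr_letterwise _ _ (letterwise_rv2 lzW (@letterwise_va k))).
rewrite (Pr_letterwise _ _ lzW) (cPr_letterwise _ _ _ (@letterwise_va k) l1W) -big_split /=.
apply: eq_bigr => i _; rewrite ffunE; case: (z i) => [[u1 u2] y] /=.
have := markov_Pr (x i) (u1, decW h i) (u2, y) hP mk.
have e1 (A : finType) (v : Om a -> A) c :
    Pr P (rv2 (rv2 (rv2 (@rX1 _ _ _ _ _ a) (W1 k)) (rv2 (@rX2 _ _ _ _ _ a) (@rY _ _ _ _ _ a))) v)
      (u1, decW h i, (u2, y), c) = Pr P (rv2 (rv2 ZZ (W1 k)) v) (u1, u2, y, decW h i, c).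
  by apply: Pr_eq => w _; rewrite /ZZ /rv2 !xpair_eqE; do ?case: (_ == _).
rewrite e1 => ->; congr (_ * _).
by apply: Pr_eq => w _; rewrite /ZZ /rv2 !xpair_eqE; do ?case: (_ == _).
Qed.

Lemma markov_block2 k : (k < K)%N -> forall y x,
  Pr Q (rv2 (rv2 zr (rv2 (WW k) (va k))) (vb k)) (y, x) =
  Pr Q (rv2 zr (rv2 (WW k) (va k))) y *
    cPr Q (vb k) (rv2 (fun w => block2 (zr w)) (rv2 (WW k) (va k))) x (block2 y.1, y.2).
Proof.
move=> /hm[_ mk] [z h] x.
have lW2 := letterwise_rv2 (@letterwise_W k) (@letterwise_va k).
have lzW := letterwise_rv2 letterwise_z lW2.
have l2W := letterwise_rv2 letterwise_2 lW2.
rewrite (Pr_letterwise _ _ (letterwise_rv2 lzW (@letterwise_vb k))).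
rewrite (Pr_letterwise _ _ lzW) (cPr_letterwise _ _ _ (@letterwise_vb k) l2W) -big_split /=.
apply: eq_bigr => i _; rewrite ffunE; case: (z i) => [[u1 u2] y] /=.
set h' := (decW h.1 i, h.2 i).
have := markov_Pr (x i) (u2, h') (u1, y) hP mk.
have e1 (A : finType) (v : Om a -> A) c :
    Pr P (rv2 (rv2 (rv2 (@rX2 _ _ _ _ _ a) (W2 k)) (rv2 (@rX1 _ _ _ _ _ a) (@rY _ _ _ _ _ a))) v)
      (u2, h', (u1, y), c) = Pr P (rv2 (rv2 ZZ (W2 k)) v) (u1, u2, y, h', c).
  by apply: Pr_eq => w _; rewrite /ZZ /rv2 !xpair_eqE; do ?case: (_ == _).
rewrite e1 => ->; congr (_ * _).
by apply: Pr_eq => w _; rewrite /ZZ /rv2 !xpair_eqE; do ?case: (_ == _).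
Qed.

End Blocks.

Lemma lt_add4 (a b c d n : nat) : (a + b + c + d < n)%N ->
  [/\ (a < n)%N, (b < n)%N, (c < n)%N & (d < n)%N].
Proof. by move=> h; split; lia. Qed.

Section Achieve.
Variables (R : realType) (X1 X2 Y : finType) (p : X1 * X2 * Y -> R) (K' : nat).
Local Notation K := K'.+1.
Variable a : auxiliary p.
Hypothesis hm : markov_chains K a.

Local Notation P := (prob (a := a)).
Let hP : is_pmf P := prob_pmf a.
Local Notation x1 := (@rX1 _ _ _ _ _ a).
Local Notation x2 := (@rX2 _ _ _ _ _ a).
Local Notation y := (@rY _ _ _ _ _ a).

(* Conditional entropies of the words of step [l] given what is known to their
   encoder, to the other encoder and to the decoder. *)
Definition hsA l := cent P (@V1 _ _ _ _ _ a l) (rv2 x1 (W1 l)).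
Definition htA l := cent P (@V1 _ _ _ _ _ a l) (rv2 x2 (W1 l)).
Definition huA l := cent P (@V1 _ _ _ _ _ a l) (W1 l).
Definition hsB l := cent P (@V2 _ _ _ _ _ a l) (rv2 x2 (W2 l)).
Definition htB l := cent P (@V2 _ _ _ _ _ a l) (rv2 x1 (W2 l)).
Definition huB l := cent P (@V2 _ _ _ _ _ a l) (W2 l).

Section Typical.
Variables (n : nat) (e c : R).
Local Notation Q := (prodP (I := 'I_n) P).
Local Notation va := (va (a := a) (n := n)).
Local Notation vb := (vb (a := a) (n := n)).
Local Notation WW := (Wr va vb).
Local Notation b1 := (fun w => block1 (zr (a := a) (n := n) w)).
Local Notation b2 := (fun w => block2 (zr (a := a) (n := n) w)).

Definition conc_le (A B : finType) (f : _ -> A) (g : _ -> B) (h : R) : Prop :=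
  \sum_(w | expR (- (n%:R * (h - e))) < cPr Q f g (f w) (g w)) Q w <= c.
Definition conc_ge (A B : finType) (f : _ -> A) (g : _ -> B) (h : R) : Prop :=
  \sum_(w | cPr Q f g (f w) (g w) < expR (- (n%:R * (h + e)))) Q w <= c.

Definition typical (l : nat) : Prop :=
  [/\ conc_le (va l) (rv2 b1 (WW l)) (hsA l), conc_ge (va l) (rv2 b2 (WW l)) (htA l) &
      conc_ge (va l) (WW l) (huA l)] /\
  [/\ conc_le (vb l) (rv2 b2 (rv2 (WW l) (va l))) (hsB l),
      conc_ge (vb l) (rv2 b1 (rv2 (WW l) (va l))) (htB l) &
      conc_ge (vb l) (rv2 (WW l) (va l)) (huB l)].

End Typical.

Lemma typical_eventually (e c : R) l : 0 < e -> 0 < c ->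
  exists n0, forall n, (n0 < n)%N -> typical n e c l.
Proof.
move=> e0 c0.
have [n1 h1] := aep hP (@V1 _ _ _ _ _ a l) (rv2 x1 (W1 l)) e0 c0.
have [n2 h2] := aep hP (@V1 _ _ _ _ _ a l) (rv2 x2 (W1 l)) e0 c0.
have [n3 h3] := aep hP (@V1 _ _ _ _ _ a l) (W1 l) e0 c0.
have [n4 h4] := aep hP (@V2 _ _ _ _ _ a l) (rv2 x2 (W2 l)) e0 c0.
have [n5 h5] := aep hP (@V2 _ _ _ _ _ a l) (rv2 x1 (W2 l)) e0 c0.
have [n6 h6] := aep hP (@V2 _ _ _ _ _ a l) (W2 l) e0 c0.
exists (n1 + n2 + n3 + n4 + n5 + n6)%N => n hn.
have lW := @letterwise_W _ _ _ _ _ a n l.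
have lA := @letterwise_va _ _ _ _ _ a n l.
have lB := @letterwise_vb _ _ _ _ _ a n l.
have l1 := @letterwise_1 _ _ _ _ _ a n.
have l2 := @letterwise_2 _ _ _ _ _ a n.
have lW2 := letterwise_rv2 lW lA.
split; split.
- by apply: (proj1 (h1 n _ _ _ _ _ _ _ lA (letterwise_rv2 l1 lW))); lia.
- by apply: (proj2 (h2 n _ _ _ _ _ _ _ lA (letterwise_rv2 l2 lW))); lia.
- by apply: (proj2 (h3 n _ _ _ _ _ _ _ lA lW)); lia.
- by apply: (proj1 (h4 n _ _ _ _ _ _ _ lB (letterwise_rv2 l2 lW2))); lia.
- by apply: (proj2 (h5 n _ _ _ _ _ _ _ lB (letterwise_rv2 l1 lW2))); lia.
- by apply: (proj2 (h6 n _ _ _ _ _ _ _ lB lW2)); lia.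
Qed.

(** The part of each hash value meant for the decoder alone is shared between the encoders: [r1] and
    [r2] are the rates sent by encoders 1 and 2 for the first word of a step, [s1] and [s2] those
    for the second word. *)
Variables (r1 r2 s1 s2 : nat -> R).
Hypothesis hr : forall l, (l < K)%N ->
  [/\ hsA l <= htA l, 0 <= r1 l, 0 <= r2 l & r1 l + r2 l = huA l - htA l].
Hypothesis hs : forall l, (l < K)%N ->
  [/\ hsB l <= htB l, 0 <= s1 l, 0 <= s2 l & s1 l + s2 l = huB l - htB l].
Hypothesis s1_last : s1 K' = 0.

Section Sized.
Variables (n : nat) (e : R).

Definition sFA l : finType := 'I_(size_below (n%:R * (hsA l - 2 * e))).
Definition sMA l : finType := 'I_(size_above (n%:R * (htA l - hsA l + 4 * e))).
Definition sBA1 l : finType := 'I_(size_above (n%:R * r1 l)).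
Definition sBA2 l : finType := 'I_(size_above (n%:R * r2 l)).
Definition sFB l : finType := 'I_(size_below (n%:R * (hsB l - 2 * e))).
Definition sMB l : finType := 'I_(size_above (n%:R * (htB l - hsB l + 4 * e))).
Definition sBB1 l : finType := 'I_(if l == K' then 1 else size_above (n%:R * s1 l)).
Definition sBB2 l : finType := 'I_(size_above (n%:R * s2 l)).

Lemma block_code (c : R) (yg : {ffun 'I_n -> X1 * X2 * Y} ->
    hist (pairs (bA a n) (bB a n)) K -> bool) :
  0 < c -> 0 <= e -> expR (- (n%:R * e)) * ((2 * c)^-1 + 4) <= c / 2 ->
  (forall l, (l < K)%N -> typical n e c l) ->
  exists (cd : cdib_code X1 X2 n)
         (dec : hist (fun k => 'I_(size_I cd k)) K * hist (fun k => 'I_(size_J cd k)) K ->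
                hist (pairs (bA a n) (bB a n)) K),
  let Q := prodP (I := 'I_n) P in
  [/\ forall l, size_I cd l = (#|sMA l| * #|sBA1 l| * #|late sBB1 l|)%N,
      forall l, size_J cd l = (#|sMB l| * #|sBB2 l| * #|sBA2 l|)%N &
      \sum_w Q w * (~~ yg (zr w) (dec (transcript cd (block1 (zr w)) (block2 (zr w)) K)))%:R <=
      \sum_(w | ~~ yg (zr w) (Wr (@va _ _ _ _ _ a n) (@vb _ _ _ _ _ a n) K w)) Q w
        + K%:R * (8 * c)].
Proof.
move=> c0 e0 hc ht.
have n0 : 0 <= n%:R :> R by [].
have FA0 l : (0 < #|sFA l|)%N by rewrite card_ord size_below_gt0.
have MA0 l : (0 < #|sMA l|)%N by rewrite card_ord.
have BA10 l : (0 < #|sBA1 l|)%N by rewrite card_ord.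
have BA20 l : (0 < #|sBA2 l|)%N by rewrite card_ord.
have FB0 l : (0 < #|sFB l|)%N by rewrite card_ord size_below_gt0.
have MB0 l : (0 < #|sMB l|)%N by rewrite card_ord.
have BB10 l : (0 < #|sBB1 l|)%N by rewrite card_ord; case: ifP.
have BB20 l : (0 < #|sBB2 l|)%N by rewrite card_ord.
have lt (x x' : late sBB1 K) : x = x'.
  by apply: (fintype_le1P _); rewrite card_ord eqxx.
have gt0 (h : nat -> R) l : 0 < expR (- (n%:R * h l)) by exact: expR_gt0.
have ge0 (h : nat -> R) l : 0 <= expR (- (n%:R * h l)) by exact: expR_ge0.
have hQ : is_pmf (prodP (I := 'I_n) P) := prodP_pmf 'I_n hP.
have [cd [dec [h1 h2 h3]]] := one_shot_code hQ FA0 MA0 BA10 BA20 FB0 MB0 BB10 BB20 lt c0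
  (ge0 (fun l => hsA l - e)) (gt0 (fun l => htA l + e)) (gt0 (fun l => huA l + e))
  (ge0 (fun l => hsB l - e)) (gt0 (fun l => htB l + e)) (gt0 (fun l => huB l + e))
  (markov_block1 hm (n := n)) (markov_block2 hm (n := n)) yg.
exists cd, dec; split => //; apply: le_trans h3 _; rewrite lerD2l.
apply: (@le_trans _ _ (\sum_(k < K) 8 * c)); last first.
  by rewrite sumr_const -[_ *+ #|_|]mulr_natl card_ord.
apply: ler_sum => k _; have [[a1 a2 a3] [a4 a5 a6]] := ht k (ltn_ord k).
have prod_ge (x x' z z' : R) : 0 <= z -> z <= x -> 0 <= z' -> z' <= x' -> z * z' <= x * x'.
  by move=> *; apply: ler_pM.
have [hA rr1 rr2 hrr] := hr (ltn_ord k); have [hB ss1 ss2 hss] := hs (ltn_ord k).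
have : boundA (prodP (I := 'I_n) P) (zr (a := a) (n := n)) (@block1 X1 X2 Y n) (@block2 X1 X2 Y n)
   (@va _ _ _ _ _ a n) (@vb _ _ _ _ _ a n)
   sFA sMA sBA1 sBA2 c (fun l => expR (- (n%:R * (hsA l - e))))
   (fun l => expR (- (n%:R * (htA l + e)))) (fun l => expR (- (n%:R * (huA l + e)))) k <= 4 * c.
  apply: hash_bound_le => //; rewrite ?card_prod ?card_ord ?size_above_ge //.
  rewrite natrM -hrr mulrDr expRD; apply: prod_ge; rewrite ?expR_ge0 ?size_above_ge //.
have : boundB (prodP (I := 'I_n) P) (zr (a := a) (n := n)) (@block1 X1 X2 Y n) (@block2 X1 X2 Y n)
   (@va _ _ _ _ _ a n) (@vb _ _ _ _ _ a n)
   sFB sMB sBB1 sBB2 c (fun l => expR (- (n%:R * (hsB l - e))))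
   (fun l => expR (- (n%:R * (htB l + e)))) (fun l => expR (- (n%:R * (huB l + e)))) k <= 4 * c.
  apply: hash_bound_le => //; rewrite ?card_prod ?card_ord ?size_above_ge //.
  rewrite natrM -hss mulrDr expRD; apply: prod_ge; rewrite ?expR_ge0 ?size_above_ge //.
  case: eqP => [->|_]; last exact: size_above_ge.
  by rewrite s1_last mulr0 expR0.
lra.
Qed.

End Sized.

Variables (R1 R2 mu : R).
Hypothesis hR1 : \sum_(l < K) (htA l - hsA l + r1 l + s1 l) <= R1 * ln 2.
Hypothesis hR2 : \sum_(l < K) (htB l - hsB l + s2 l + r2 l) <= R2 * ln 2.
Hypothesis hmu : mu * ln 2 <= ent P y - cent P y (W1 K).

Let L : R := ln 2.
Let L0 : 0 < L. Proof. exact: ln2_gt0. Qed.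

(** The slack per step is 4 [n] [e] from the margins in the rates, and ln 2 for the rounding of each
    of the three parts of a message. *)
Lemma rate_bound (n : nat) (size : nat -> nat) (F : nat -> R) (rate e eps : R) :
  (0 < n)%N -> \sum_(l < K) ln (size l)%:R <= \sum_(l < K) (n%:R * F l + (4 * n%:R * e + 3 * L)) ->
  \sum_(l < K) F l <= rate * L -> K%:R * (4 * n%:R * e + 3 * L) <= n%:R * (eps * L) ->
  n%:R^-1 * \sum_(l < K) log2 (size l)%:R <= rate + eps.
Proof.
move=> n0 h1 h2 h3; have nr : 0 < n%:R :> R by rewrite ltr0n.
rewrite mulrC ler_pdivrMr // -(ler_pM2r L0).
have -> : (\sum_(l < K) log2 (size l)%:R) * L = \sum_(l < K) ln (size l)%:R.
  rewrite mulr_suml; apply: eq_bigr => l _.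
  by rewrite /log2 -/L divfK // gt_eqF.
apply: le_trans h1 _; rewrite big_split /= -mulr_sumr sumr_const -[_ *+ #|_|]mulr_natl card_ord.
have := ler_wpM2l (ltW nr) h2.
rewrite -/L (_ : (rate + eps) * n%:R * L = n%:R * (rate * L) + n%:R * (eps * L)); last by ring.
by move=> h4; apply: lerD.
Qed.

Lemma rate_I n e : (0 < n)%N -> 0 <= e ->
  \sum_(l < K) ln (#|sMA n e l| * #|sBA1 n l| * #|late (sBB1 n) l|)%:R <=
  \sum_(l < K) (n%:R * (htA l - hsA l + r1 l + s1 l) + (4 * n%:R * e + 3 * L)).
Proof.
move=> n0 e0; have nr : 0 <= n%:R :> R by [].
have hB l : (0 < #|sBB1 n l|)%N by rewrite card_ord; case: ifP.
have hl l : (0 < #|late (sBB1 n) l|)%N by case: l => [|l] //=; rewrite card_unit.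
(* The late parts are shifted by one step: step 0 carries none and the share of step [K'] is zero,
   so both sums run over the same terms. *)
have hlate : \sum_(l < K) ln #|late (sBB1 n) l|%:R <= \sum_(l < K) (n%:R * s1 l + L).
  rewrite big_ord_recl big_ord_recr /= card_unit ln1 add0r s1_last mulr0 add0r.
  apply: ler_wpDr; first exact: ltW.
  apply: ler_sum => l _; rewrite card_ord.
  have [_ s10 _ _] := hs (ltnW (ltn_ord l) : (l < K)%N).
  rewrite ltn_eqF ?ltn_ord //; apply: ln_size_above; exact: mulr_ge0.
apply: (@le_trans _ _ (\sum_(l < K) (n%:R * (htA l - hsA l + r1 l) + (4 * n%:R * e + 2 * L)) +
  \sum_(l < K) (n%:R * s1 l + L))); last first.
  rewrite -big_split /=; apply: ler_sum => l _; rewrite le_eqVlt; apply/orP; left.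
  by apply/eqP; ring.
apply: le_trans (lerD (lexx _) hlate); rewrite -big_split /=.
apply: ler_sum => l _; have [hA r10 _ _] := hr (ltn_ord l).
rewrite !natrM !lnM ?posrE ?mulr_gt0 ?ltr0n ?card_ord ?hl // lerD2r.
have -> : n%:R * (htA l - hsA l + r1 l) + (4 * n%:R * e + 2 * L) =
  (n%:R * (htA l - hsA l + 4 * e) + L) + (n%:R * r1 l + L) by ring.
apply: lerD; apply: ln_size_above; rewrite mulr_ge0 //; lra.
Qed.

Lemma rate_J n e : (0 < n)%N -> 0 <= e ->
  \sum_(l < K) ln (#|sMB n e l| * #|sBB2 n l| * #|sBA2 n l|)%:R <=
  \sum_(l < K) (n%:R * (htB l - hsB l + s2 l + r2 l) + (4 * n%:R * e + 3 * L)).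
Proof.
move=> n0 e0; have nr : 0 <= n%:R :> R by [].
apply: ler_sum => l _; have [_ _ r20 _] := hr (ltn_ord l).
have [hB _ s20 _] := hs (ltn_ord l).
rewrite !natrM !lnM ?posrE ?mulr_gt0 ?ltr0n ?card_ord //.
have -> : n%:R * (htB l - hsB l + s2 l + r2 l) + (4 * n%:R * e + 3 * L) =
  ((n%:R * (htB l - hsB l + 4 * e) + L) + (n%:R * s2 l + L)) + (n%:R * r2 l + L) by ring.
apply: lerD; last by apply: ln_size_above; rewrite mulr_ge0.
apply: lerD; apply: ln_size_above; rewrite mulr_ge0 //; lra.
Qed.

Lemma achievable_of_rates : achievable p K R1 R2 mu.
Proof.
move=> eps eps0; set KR : R := K%:R.
have KR1 : 1 <= KR by rewrite ler1n.
have epsL : 0 < eps * L by rewrite mulr_gt0.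
(* The margins 4 [e] of the [K] steps then use half of the allowed excess rate; the roundings use
   the other half once [n] exceeds [B2]. *)
pose e := eps * L / (8 * KR).
have e0 : 0 < e by rewrite divr_gt0 // mulr_gt0 //; lra.
have eE : 8 * KR * e = eps * L by rewrite /e mulrC divfK // gt_eqF // mulr_gt0 //; lra.
(* The total error probability is at most (8 K + 1) [c], and it costs ln |Y| nats per letter of
   relevance: this choice keeps the loss under a quarter of [eps]. *)
pose c := eps * L / (4 * (8 * KR + 1) * (ln #|Y|%:R + 1)).
have Y0 : (0 < #|Y|)%N.
  rewrite lt0n; apply/eqP => Y0; have := proj2 hP; rewrite big1.
    by move/eqP; rewrite eq_sym oner_eq0.
  by move=> w _; have := card0_eq Y0 (y w).
have lY : 0 <= ln (#|Y|%:R : R) by rewrite ln_ge0 // ler1n.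
have den0 : 0 < 4 * (8 * KR + 1) * (ln #|Y|%:R + 1).
  by rewrite !mulr_gt0 //; lra.
have c0 : 0 < c by rewrite divr_gt0.
have cE : c * (4 * (8 * KR + 1) * (ln #|Y|%:R + 1)) = eps * L by rewrite /c divfK // gt_eqF.
have [nY hY] := aep hP y (W1 K) e0 c0.
have [nT hT] := eventually_all K (fun l => typical_eventually l e0 c0).
(* Chosen so that exp(- x) <= 1 / x at x = [n] [e] gives the smallness condition of
   [hash_bound_le]. *)
pose B1 := ((2 * c)^-1 + 4) * (2 / c) / e.
pose B2 := 6 * KR / eps.
have B10 : 0 <= B1.
  have i0 : 0 <= (2 * c)^-1 by rewrite invr_ge0 mulr_ge0 // ltW.
  by rewrite divr_ge0 ?(ltW e0) // mulr_ge0 ?addr_ge0 // divr_ge0 // ltW.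
have B20 : 0 <= B2 by rewrite divr_ge0 ?mulr_ge0 //; lra.
exists (nY + nT + Num.truncn B1 + Num.truncn B2)%N => n /lt_add4[hnY hnT hnB1 hnB2].
have n_gt0 : (0 < n)%N by exact: leq_ltn_trans hnY.
have nr : 0 < n%:R :> R by rewrite ltr0n.
have nB1 : B1 <= n%:R.
  by apply: le_trans (ltW (truncnS_gt _)) _; rewrite ler_nat.
have nB2 : B2 <= n%:R.
  by apply: le_trans (ltW (truncnS_gt _)) _; rewrite ler_nat.
have hc : expR (- (n%:R * e)) * ((2 * c)^-1 + 4) <= c / 2.
  have ne : 0 < n%:R * e by rewrite mulr_gt0.
  have i0 : 0 < (2 * c)^-1 + 4 by rewrite addr_gt0 // invr_gt0 mulr_gt0.
  have h1 : expR (- (n%:R * e)) <= (n%:R * e)^-1.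
    rewrite expRN lef_pV2 ?posrE ?expR_gt0 //.
    by have := expR_ge1Dx (n%:R * e); lra.
  apply: le_trans (ler_wpM2r (ltW i0) h1) _.
  rewrite mulrC ler_pdivrMr //.
  have : B1 * e <= n%:R * e by rewrite ler_pM2r.
  rewrite /B1 divfK ?gt_eqF // => h2.
  have : (((2 * c)^-1 + 4) * (2 / c)) * (c / 2) <= n%:R * e * (c / 2).
    by rewrite ler_pM2r // divr_gt0.
  have -> : (((2 * c)^-1 + 4) * (2 / c)) * (c / 2) = (2 * c)^-1 + 4.
    by rewrite -mulrA mulf_div (mulrC c) divff ?mulr1 // gt_eqF // mulr_gt0.
  lra.
have hnk : K%:R * (4 * n%:R * e + 3 * L) <= n%:R * (eps * L).
  have : B2 * (eps * L) <= n%:R * (eps * L) by rewrite ler_pM2r.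
  have -> : B2 * (eps * L) = 6 * KR * L by rewrite /B2 mulrA divfK // gt_eqF.
  have -> : K%:R * (4 * n%:R * e + 3 * L) = n%:R * (8 * KR * e) / 2 + 3 * KR * L.
    by rewrite -/KR; field.
  rewrite eE; lra.
pose Yb (w : {ffun 'I_n -> Om a}) := blockY (zr w).
pose WW := Wr (@va _ _ _ _ _ a n) (@vb _ _ _ _ _ a n).
pose Q := prodP (I := 'I_n) P.
have hQ : is_pmf Q := prodP_pmf 'I_n hP.
pose lam := expR (- (n%:R * (cent P y (W1 K) + e))).
pose yg (z : {ffun 'I_n -> X1 * X2 * Y}) (w : hist (pairs (bA a n) (bB a n)) K) : bool :=
  lam <= cPr Q Yb (WW K) (blockY z) w.
have [cd [dec [hI hJ hD]]] := block_code yg c0 (ltW e0) hc (fun l lK => hT n hnT l lK).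
exists cd; split.
- apply: (rate_bound (F := fun l => htA l - hsA l + r1 l + s1 l) n_gt0 _ hR1 hnk).
  under eq_bigr do rewrite hI; exact: (rate_I n_gt0 (ltW e0)).
- apply: (rate_bound (F := fun l => htB l - hsB l + s2 l + r2 l) n_gt0 _ hR2 hnk).
  under eq_bigr do rewrite hJ; exact: (rate_J n_gt0 (ltW e0)).
rewrite (minfo_image _ _ (@Pr_zr _ _ _ _ _ a n)).
pose g (w : {ffun 'I_n -> Om a}) := transcript cd (block1 (zr w)) (block2 (zr w)) K.
have hbad : \sum_w Q w * (cPr Q Yb (WW K) (Yb w) (dec (g w)) < lam)%R%:R <= c + KR * (8 * c).
  apply: le_trans (_ : _ <= \sum_w Q w * (~~ yg (zr w) (dec (g w)))%:R) _.
    by apply: ler_sum => w _; rewrite /yg -ltNge.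
  apply: (le_trans hD); rewrite lerD2r.
  have [_] := hY n hnY _ _ _ _ _ _ (@letterwise_Y _ _ _ _ _ a n)
    (@letterwise_W _ _ _ _ _ a n K).
  by apply: le_trans; under eq_bigl do rewrite /yg -ltNge.
have lam0 : 0 < lam by exact: expR_gt0.
have cy0 : 0 <= cent P y (W1 K) by exact: cent_ge0.
have lam1 : lam <= 1.
  by rewrite -[leRHS]expR0 ler_expR oppr_le0 (mulr_ge0 (ltW nr) (addr_ge0 cy0 (ltW e0))).
(* The reference channel is the ideal law of Y given the words, evaluated at the decoded words. It
   need not be the true law of Y given the transcript. *)
have := minfo_ge hQ (f := Yb) (g := g) (q := fun t z => cPr Q Yb (WW K) z (dec t))
  (fun _ _ => cPr_ge0 hQ _ _ _ _) (fun t => sum_cPr_le1 Q _ _ _) lam0 lam1 hbad.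
rewrite (ent_letterwise hP (@letterwise_Y _ _ _ _ _ a n)) /lam expRK.
rewrite card_ffun card_ord natrX lnXn ?ltr0n // -[ln _ *+ n]mulr_natl -/L => hmi.
rewrite -/Q -/Yb -/g mulrC ler_pdivlMr // -(ler_pM2r L0).
apply: le_trans hmi.
have hd : (c + KR * (8 * c)) * ln #|Y|%:R <= eps * L / 4.
  have : c * (4 * (8 * KR + 1) * (ln #|Y|%:R + 1)) =
    4 * ((c + KR * (8 * c)) * ln #|Y|%:R) + 4 * (c + KR * (8 * c)) by ring.
  have : 0 <= c + KR * (8 * c).
    by apply: addr_ge0; [|apply: mulr_ge0 => //; apply: mulr_ge0 => //]; exact: ltW.
  rewrite cE; lra.
have h4 : e <= eps * L / 8.
  have : e <= KR * e by rewrite ler_peMl // ltW.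
  move: eE; rewrite -mulrA; lra.
have h5 : L <= n%:R * (eps * L) / 6.
  have : B2 * (eps * L) <= n%:R * (eps * L) by rewrite ler_pM2r.
  have -> : B2 * (eps * L) = 6 * KR * L by rewrite /B2 mulrA divfK // gt_eqF.
  have : L <= KR * L by rewrite ler_peMl // ltW.
  by rewrite -mulrA; lra.
have h6 : n%:R * ((c + KR * (8 * c)) * ln #|Y|%:R) <= n%:R * (eps * L / 4).
  by rewrite ler_pM2l.
have h7 : n%:R * e <= n%:R * (eps * L / 8) by rewrite ler_pM2l.
have h8 : n%:R * (mu * L) <= n%:R * (ent P y - cent P y (W1 K)).
  by rewrite ler_pM2l //; exact: hmu.
have h9 : 0 < n%:R * (eps * L) by rewrite mulr_gt0.
have fin (N M EP H C E LL X lY' : R) : N * (M * LL) <= N * (H - C) ->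
    N * E <= N * (EP * LL / 8) -> LL <= N * (EP * LL) / 6 ->
    N * (X * lY') <= N * (EP * LL / 4) -> 0 < N * (EP * LL) ->
    (M - EP) * N * LL <= N * H - N * (C + E) - LL - X * (N * lY') by lra.
exact: fin h8 h7 h5 h6 h9.
Qed.

End Achieve.

(** * The rates of the inner region as sums over the steps *)

Section MarkovEntropy.
Variables (R : realType) (O : finType) (P : O -> R).
Hypothesis hP : is_pmf P.

(** Adding [g2], then [g3], to the condition can only lower the entropy, and the Markov chain says
    that the end value equals the first one; so the intermediate value does too. Dropping [g1] gives
    the inequality. *)
Lemma markov_cent (V G1 G2 G3 C : finType) (v : O -> V) (g1 : O -> G1)
    (g2 : O -> G2) (g3 : O -> G3) (c : O -> C) :
  markov P v (rv2 g1 c) (rv2 g2 g3) ->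
  cent P v (rv2 g1 c) = cent P v (rv2 (rv2 g1 g2) c) /\
  cent P v (rv2 g1 c) <= cent P v (rv2 g2 c).
Proof.
move=> /(cent_markov hP) mk.
have e1 : cent P v (rv2 g2 (rv2 g1 c)) = cent P v (rv2 (rv2 g1 g2) c).
  by apply: cent_eq => w w'; rewrite /rv2 !xpair_eqE; do ?case: (_ == _).
have e2 : cent P v (rv2 (rv2 g1 c) (rv2 g2 g3)) = cent P v (rv2 g3 (rv2 (rv2 g1 g2) c)).
  by apply: cent_eq => w w'; rewrite /rv2 !xpair_eqE; do ?case: (_ == _).
have e3 : cent P v (rv2 (rv2 g1 g2) c) = cent P v (rv2 g1 (rv2 g2 c)).
  by apply: cent_eq => w w'; rewrite /rv2 !xpair_eqE; do ?case: (_ == _).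
have l1 := cent_le hP v g2 (rv2 g1 c).
have l2 := cent_le hP v g3 (rv2 (rv2 g1 g2) c).
have l3 := cent_le hP v g1 (rv2 g2 c).
rewrite e1 in l1; rewrite -e2 mk in l2; rewrite -e3 in l3.
have e : cent P v (rv2 g1 c) = cent P v (rv2 (rv2 g1 g2) c).
  by apply/eqP; rewrite eq_le l1 l2.
by split=> //; rewrite e.
Qed.

End MarkovEntropy.

Section InnerEntropies.
Variables (R : realType) (X1 X2 Y : finType) (p : X1 * X2 * Y -> R).
Variable a : auxiliary p.
Local Notation P := (prob (a := a)).
Let hP : is_pmf P := prob_pmf a.
Local Notation x1 := (@rX1 _ _ _ _ _ a).
Local Notation x2 := (@rX2 _ _ _ _ _ a).
Local Notation y := (@rY _ _ _ _ _ a).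
Local Notation v1 := (@V1 _ _ _ _ _ a).
Local Notation v2 := (@V2 _ _ _ _ _ a).
Local Notation w1 := (@W1 _ _ _ _ _ a).
Local Notation w2 := (@W2 _ _ _ _ _ a).

Lemma W1S l w : w1 l.+1 w = hist_snoc (w1 l w) (v1 l w, v2 l w).
Proof. exact/esym/(hist_snoc_of (fun k => (v1 k w, v2 k w))). Qed.

Lemma W1S_eq l w w' : (w1 l.+1 w == w1 l.+1 w') =
  [&& w1 l w == w1 l w', v1 l w == v1 l w' & v2 l w == v2 l w'].
Proof.
apply/eqP/and3P => [/ffunP e|[/eqP e1 /eqP e2 /eqP e3]]; last by rewrite !W1S e1 e2 e3.
have em := e ord_max; rewrite !ffunE in em; case: em => -> ->; split=> //.
by apply/eqP/ffunP => k; have := e (widen_ord (leqnSn l) k); rewrite !ffunE.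
Qed.

Lemma W10_eq w w' : (w1 0 w == w1 0 w').
Proof. by apply/eqP/ffunP; case. Qed.

Lemma ent_W10 (G : finType) (g : Om a -> G) : ent P (rv2 g (w1 0)) = ent P g.
Proof. by apply: ent_eq => w w' _ _; rewrite /rv2 xpair_eqE W10_eq andbT. Qed.

Lemma ent_W1S (G : finType) (g : Om a -> G) l :
  ent P (rv2 g (w1 l.+1)) = ent P (rv2 g (w1 l)) +
    cent P (v1 l) (rv2 g (w1 l)) + cent P (v2 l) (rv2 g (w2 l)).
Proof.
have e1 : ent P (rv2 (v1 l) (rv2 g (w1 l))) = ent P (rv2 g (w2 l)).
  by apply: ent_eq => w w' _ _; rewrite /W2 /rv2 !xpair_eqE; do ?case: (_ == _).
have e2 : ent P (rv2 (v2 l) (rv2 g (w2 l))) = ent P (rv2 g (w1 l.+1)).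
  apply: ent_eq => w w' _ _; rewrite /W2 /rv2 !xpair_eqE W1S_eq.
  by do ?case: (_ == _).
by rewrite /cent e1 e2; ring.
Qed.

Lemma sum_cent (G : finType) (g : Om a -> G) K :
  ent P (rv2 g (w1 K)) = ent P g +
    (\sum_(l < K) cent P (v1 l) (rv2 g (w1 l)) +
     \sum_(l < K) cent P (v2 l) (rv2 g (w2 l))).
Proof.
elim: K => [|K IH]; first by rewrite ent_W10 !big_ord0 !addr0.
by rewrite ent_W1S !big_ord_recr /= IH; ring.
Qed.

End InnerEntropies.

Section InnerAchievable.
Variables (R : realType) (X1 X2 Y : finType) (p : X1 * X2 * Y -> R) (K' : nat).
Local Notation K := K'.+1.
Variable a : auxiliary p.
Hypothesis hm : markov_chains K a.
Local Notation P := (prob (a := a)).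
Let hP : is_pmf P := prob_pmf a.
Local Notation x1 := (@rX1 _ _ _ _ _ a).
Local Notation x2 := (@rX2 _ _ _ _ _ a).
Local Notation y := (@rY _ _ _ _ _ a).
Local Notation v1 := (@V1 _ _ _ _ _ a).
Local Notation v2 := (@V2 _ _ _ _ _ a).
Local Notation w1 := (@W1 _ _ _ _ _ a).
Local Notation w2 := (@W2 _ _ _ _ _ a).
Let x12 := rv2 x1 x2.

Lemma hsA_eq l : (l < K)%N -> hsA a l = cent P (v1 l) (rv2 x12 (w1 l)).
Proof. by move=> /hm[/(markov_cent hP)[]]. Qed.
Lemma hsA_le l : (l < K)%N -> hsA a l <= htA a l.
Proof. by move=> /hm[/(markov_cent hP)[]]. Qed.
Lemma hsB_eq l : (l < K)%N -> hsB a l = cent P (v2 l) (rv2 x12 (w2 l)).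
Proof.
move=> /hm[_ /(markov_cent hP)[h _]]; rewrite /hsB h.
by apply: cent_eq => w w'; rewrite /rv2 !xpair_eqE; do ?case: (_ == _).
Qed.
Lemma hsB_le l : (l < K)%N -> hsB a l <= htB a l.
Proof. by move=> /hm[_ /(markov_cent hP)[]]. Qed.

Lemma htA_le l : htA a l <= huA a l. Proof. exact: cent_le. Qed.
Lemma htB_le l : htB a l <= huB a l. Proof. exact: cent_le. Qed.

Lemma sum_hsA k : (k <= K)%N ->
  \sum_(l < k) cent P (v1 l) (rv2 x12 (w1 l)) = \sum_(l < k) hsA a l.
Proof.
by move=> kK; apply: eq_bigr => l _; rewrite hsA_eq // (leq_trans (ltn_ord l)).
Qed.

Lemma sum_hsB k : (k <= K)%N ->
  \sum_(l < k) cent P (v2 l) (rv2 x12 (w2 l)) = \sum_(l < k) hsB a l.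
Proof.
by move=> kK; apply: eq_bigr => l _; rewrite hsB_eq // (leq_trans (ltn_ord l)).
Qed.

(** By the chain rule both H(X2, W) and H(X1, X2, W) split over the words; the second words
    contribute equally to both, by their Markov chains, and cancel. *)
Lemma rate1_sum : cminfo P x1 (w1 K) x2 * ln 2 = \sum_(l < K) (htA a l - hsA a l).
Proof.
rewrite (cminfo_ent hP).
have -> : ent P (rv2 (w1 K) x2) = ent P (rv2 x2 (w1 K)).
  by apply: ent_eq => w w' _ _; rewrite /rv2 !xpair_eqE andbC.
have -> : ent P (rv2 (rv2 x1 (w1 K)) x2) = ent P (rv2 x12 (w1 K)).
  by apply: ent_eq => w w' _ _; rewrite /rv2 !xpair_eqE andbAC.
rewrite !sum_cent sum_hsA // sum_hsB // [RHS]sumrB -/x12 /htA [in LHS]/hsB; ring.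
Qed.

(** The first term is the cost of describing the last word to a decoder without a source. In the
    second one the first words cancel, including that of the last step, which [w2 K'] contains. *)
Lemma rate2_sum :
  (cminfo P x2 (v2 K') (w2 K') + cminfo P x2 (w2 K') x1) * ln 2 =
  huB a K' - hsB a K' + \sum_(l < K') (htB a l - hsB a l).
Proof.
rewrite mulrDl !(cminfo_ent hP).
have -> : ent P (rv2 x2 (w2 K')) + ent P (rv2 (v2 K') (w2 K')) -
  ent P (rv2 (rv2 x2 (v2 K')) (w2 K')) - ent P (w2 K') = huB a K' - hsB a K'.
  have -> : ent P (rv2 (rv2 x2 (v2 K')) (w2 K')) = ent P (rv2 (v2 K') (rv2 x2 (w2 K'))).
    by apply: ent_eq => w w' _ _; rewrite /rv2 !xpair_eqE; do ?case: (_ == _).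
  by rewrite /huB /hsB /cent; ring.
congr (_ + _).
have -> : ent P (rv2 x2 x1) = ent P x12.
  by apply: ent_eq => w w' _ _; rewrite /x12 /rv2 !xpair_eqE andbC.
have -> : ent P (rv2 (w2 K') x1) = ent P (rv2 x1 (w1 K')) + hsA a K'.
  rewrite /hsA /cent addrCA subrr addr0.
  by apply: ent_eq => w w' _ _; rewrite /W2 /rv2 !xpair_eqE; do ?case: (_ == _).
have -> : ent P (rv2 (rv2 x2 (w2 K')) x1) = ent P (rv2 x12 (w1 K')) + hsA a K'.
  rewrite hsA_eq // /cent addrCA subrr addr0.
  by apply: ent_eq => w w' _ _; rewrite /x12 /W2 /rv2 !xpair_eqE; do ?case: (_ == _).
rewrite !sum_cent sum_hsA // sum_hsB // [RHS]sumrB -/x12 /htB [in LHS]/hsA; ring.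
Qed.

Lemma rate_total : minfo P x12 (w1 K) * ln 2 =
  \sum_(l < K) (huA a l - hsA a l) + \sum_(l < K) (huB a l - hsB a l).
Proof.
rewrite (minfo_ent hP).
(* Conditioning on a constant brings plain entropies under [sum_cent]. *)
pose t (w : Om a) := tt.
have -> : ent P (w1 K) = ent P (rv2 t (w1 K)).
  by apply: ent_eq => w w' _ _; rewrite /rv2 !xpair_eqE.
have t0 : ent P t = 0.
  rewrite /ent; have e w : Pr P t (t w) = 1.
    by rewrite /Pr (eq_bigl xpredT) //; case: hP.
  by rewrite big1 ?oppr0 // => w _; rewrite e ln1 mulr0.
have eA l : cent P (v1 l) (rv2 t (w1 l)) = huA a l.
  by apply: cent_eq => w w'; rewrite /rv2 !xpair_eqE.
have eB l : cent P (v2 l) (rv2 t (w2 l)) = huB a l.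
  by apply: cent_eq => w w'; rewrite /rv2 !xpair_eqE.
rewrite !sum_cent t0 sum_hsA // sum_hsB // [X in _ = X + _]sumrB [X in _ = _ + X]sumrB.
under [X in _ + (_ + (X + _)) - _]eq_bigr do rewrite eA.
under [X in _ + (_ + (_ + X)) - _]eq_bigr do rewrite eB.
ring.
Qed.

Lemma inner_achievable R1 R2 mu : rate_conditions K a R1 R2 mu -> achievable p K R1 R2 mu.
Proof.
case; rewrite /= => c1 c2 c3 c4; have L0 := ln2_gt0 R.
rewrite -(ler_pM2r L0) rate1_sum in c1; rewrite -(ler_pM2r L0) rate2_sum in c2.
rewrite -(ler_pM2r L0) rate_total in c3; rewrite -(ler_pM2r L0) (minfo_ent hP) in c4.
set SA := \sum_(l < K) (htA a l - hsA a l) in c1.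
set SB := \sum_(l < K') (htB a l - hsB a l) in c2.
pose UA := \sum_(l < K) (huA a l - htA a l).
pose UB := \sum_(l < K') (huB a l - htB a l).
have UA0 : 0 <= UA by apply: sumr_ge0 => l _; rewrite subr_ge0 htA_le.
have UB0 : 0 <= UB by apply: sumr_ge0 => l _; rewrite subr_ge0 htB_le.
have eA : \sum_(l < K) (huA a l - hsA a l) = SA + UA.
  by rewrite -big_split /=; apply: eq_bigr => l _; ring.
have eB : \sum_(l < K) (huB a l - hsB a l) = SB + UB + (huB a K' - hsB a K').
  by rewrite big_ord_recr /= -big_split /=; congr (_ + _); apply: eq_bigr => l _; ring.
rewrite eA eB in c3.
(* [al] is the fraction of the shareable rate [UA + UB] entrusted to encoder 1. The last second word
   is left out of [UB], being entirely the charge of encoder 2. *)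
have [al [al0 al1 hal1 hal2]] : exists al, [/\ 0 <= al, al <= 1,
    SA + al * (UA + UB) <= R1 * ln 2 &
    huB a K' - hsB a K' + SB + (1 - al) * (UA + UB) <= R2 * ln 2].
  have [U0|U0] := eqVneq (UA + UB) 0.
    by exists 0; split; rewrite ?U0 ?mulr0 ?addr0 // mul0r addr0.
  have Up : 0 < UA + UB by rewrite lt_neqAle eq_sym U0 addr_ge0.
  have [h|h] := lerP (UA + UB) (R1 * ln 2 - SA).
    by exists 1; split; rewrite // ?mul1r ?subrr ?mul0r ?addr0 //; lra.
  (* Encoder 1 uses up its rate exactly; the sum rate constraint then bounds what is left to encoder
     2. *)
  exists ((R1 * ln 2 - SA) / (UA + UB)); split.
  - by apply: divr_ge0; [rewrite subr_ge0|exact: ltW].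
  - by rewrite ler_pdivrMr // mul1r ltW.
  - by rewrite divfK //; lra.
  - by rewrite mulrBl mul1r divfK //; lra.
apply: (@achievable_of_rates _ _ _ _ _ _ _ hm (fun l => al * (huA a l - htA a l))
  (fun l => (1 - al) * (huA a l - htA a l))
  (fun l => if l == K' then 0 else al * (huB a l - htB a l))
  (fun l => if l == K' then huB a l - htB a l else (1 - al) * (huB a l - htB a l))).
- by move=> l lK; have := htA_le l; split; rewrite ?hsA_le ?mulr_ge0 ?subr_ge0 //; ring.
- move=> l lK; have := htB_le l; split; rewrite ?hsB_le //; case: eqP => _;
    rewrite ?mulr_ge0 ?subr_ge0 //; ring.
- by rewrite eqxx.
- apply: le_trans hal1; rewrite le_eqVlt; apply/orP; left; apply/eqP.
  rewrite big_split big_split /= -/SA -mulr_sumr -/UA big_ord_recr /= eqxx addr0.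
  rewrite -addrA mulrDr; congr (_ + (_ + _)).
  by rewrite mulr_sumr; apply: eq_bigr => l _; rewrite ltn_eqF.
- apply: le_trans hal2; rewrite le_eqVlt; apply/orP; left; apply/eqP.
  rewrite big_split big_split /= -mulr_sumr -/UA !big_ord_recr /= eqxx -/SB.
  have -> : \sum_(l < K') (if l == K' :> nat then huB a l - htB a l
      else (1 - al) * (huB a l - htB a l)) = (1 - al) * UB.
    by rewrite mulr_sumr; apply: eq_bigr => l _; rewrite ltn_eqF.
  ring.
- by rewrite /cent; lra.
Qed.

End InnerAchievable.

(** * Cardinality bounds *)

Section Sparse.
Variables (R : realType) (A I : finType) (G : I -> A -> R) (o : A -> R) (c : I -> R).

(** A row relation of the constraint matrix restricted to the support, extended by zero: it exists
    since there are more rows than columns. *)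
Lemma dependency (r0 : A -> R) :
  (#|I| < #|[pred v | r0 v != 0%R]|)%N ->
  exists d : A -> R, [/\ exists v, d v != 0, forall v, r0 v = 0 -> d v = 0 &
    forall k, \sum_v d v * G k v = 0].
Proof.
set S := [pred v | r0 v != 0] => hS.
pose M : 'M[R]_(#|S|, #|I|) := \matrix_(i, k) G (enum_val k) (enum_val i).
have : kermx M != 0.
  rewrite kermx_eq0 /row_free; apply/eqP => h.
  by have := rank_leq_col M; rewrite h leqNgt hS.
case/rowV0Pn => la /sub_kermxP laM la0.
have [j laj] : exists j, la 0 j != 0.
  apply: contrapT => /forallNP h; move/eqP: la0; apply; apply/rowP => j.
  by rewrite mxE; apply/eqP/negPn/negP/h.
exists (fun v => \sum_i la 0 i * (enum_val i == v)%:R); split.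
- exists (enum_val j); rewrite (bigD1 j) //= eqxx mulr1 big1 ?addr0 // => i ij.
  by rewrite (inj_eq enum_val_inj) (negbTE ij) mulr0.
- move=> v rv; apply: big1 => i _; case: eqP => [e|_]; last by rewrite mulr0.
  by have := enum_valP i; rewrite inE e rv eqxx.
move=> k; under eq_bigr do rewrite mulr_suml.
rewrite exchange_big /=.
transitivity ((la *m M) 0 (enum_rank k)); last by rewrite laM mxE.
rewrite mxE; apply: eq_bigr => i _; rewrite mxE enum_rankK.
rewrite (bigD1 (enum_val i)) //= eqxx mulr1 big1 ?addr0 // => v /negbTE vi.
by rewrite eq_sym vi mulr0 mul0r.
Qed.

(* While there are more weights than constraints, move along a linear dependency
   in a direction that does not increase the objective, until a weight vanishes. *)
Lemma sparse_weights (r0 : A -> R) :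
  (forall v, 0 <= r0 v) -> (forall v, r0 v != 0 -> 0 < \sum_k c k * G k v) ->
  exists r : A -> R, [/\ forall v, 0 <= r v, forall v, r0 v = 0 -> r v = 0,
    (#|[pred v | r v != 0%R]| <= #|I|)%N,
    forall k, \sum_v r v * G k v = \sum_v r0 v * G k v &
    \sum_v r v * o v <= \sum_v r0 v * o v].
Proof.
have [n] := ubnP #|[pred v | r0 v != 0%R]|; elim: n r0 => // n IH r0 hn r00 hc.
have [hS|hS] := leqP #|[pred v | r0 v != 0%R]| #|I|; first by exists r0.
have [d [dn0 ds dG d_o]] : exists d : A -> R, [/\ exists v, d v != 0,
    forall v, r0 v = 0 -> d v = 0, forall k, \sum_v d v * G k v = 0 & \sum_v d v * o v <= 0].
  have [d [[v dv] ds dG]] := dependency hS.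
  have [h|h] := lerP (\sum_v d v * o v) 0; first by exists d; split=> //; exists v.
  exists (fun v => - d v); split.
  - by exists v; rewrite oppr_eq0.
  - by move=> u /ds ->; rewrite oppr0.
  - by move=> k; under eq_bigr do rewrite mulNr; rewrite sumrN dG oppr0.
  - by under eq_bigr do rewrite mulNr; rewrite sumrN oppr_le0 ltW.
(* The combination of the constraints with coefficients [c] is positive on the support and is
   annihilated by [d]; so a nonzero [d] cannot be everywhere nonnegative. *)
have [v0 dv0] : exists v, d v < 0.
  apply: contrapT => /forallNP nd.
  have d0 v : 0 <= d v by rewrite leNgt; apply/negP/nd.
  pose g v := \sum_k c k * G k v.
  have dg0 v : 0 <= d v * g v.
    have [/ds ->|/hc h] := eqVneq (r0 v) 0; first by rewrite mul0r.
    by rewrite mulr_ge0 // ltW.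
  have : \sum_v d v * g v == 0.
    rewrite /g; under eq_bigr do rewrite mulr_sumr.
    rewrite exchange_big big1 //= => k _.
    under eq_bigr do rewrite mulrCA; by rewrite -mulr_sumr dG mulr0.
  rewrite psumr_eq0 // => /allP h; case: dn0 => v dv.
  have := h v (mem_index_enum v); rewrite /= mulf_eq0 (negbTE dv) /= => /eqP gv.
  have := hc v; rewrite -/(g v) gv ltxx => h'.
  by have := ds v; have [e|/h' //] := eqVneq (r0 v) 0 => /(_ e) e'; rewrite e' eqxx in dv.
(* The first weight to vanish when moving along [d]. *)
pose u := [arg min_(v < v0 | d v < 0) (r0 v / - d v)]%O.
have [du umin] : d u < 0 /\ forall v, d v < 0 -> r0 u / - d u <= r0 v / - d v.
  by rewrite /u; case: arg_minP.
pose t := r0 u / - d u.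
have t0 : 0 <= t by rewrite divr_ge0 // oppr_ge0 ltW.
pose r v := r0 v + t * d v.
have r_ge0 v : 0 <= r v.
  rewrite /r; have [dv|dv] := ltrP (d v) 0; last by rewrite addr_ge0 // mulr_ge0.
  have := umin v dv; rewrite -/t ler_pdivlMr ?oppr_gt0 // mulrN; lra.
have rs v : r0 v = 0 -> r v = 0 by rewrite /r => e; rewrite e (ds _ e) mulr0 addr0.
have ru : r u = 0.
  by rewrite /r /t invrN mulrN mulNr divfK ?subrr // lt_eqF.
have r0u : r0 u != 0 by apply/eqP => /ds e; rewrite e ltxx in du.
have lt : (#|[pred v | r v != 0%R]| < #|[pred v | r0 v != 0%R]|)%N.
  apply: proper_card; apply/properP; split.
    by apply/fintype.subsetP => v; rewrite !inE; apply: contraNneq => /rs ->.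
  by exists u; rewrite !inE ?ru ?eqxx.
have [||| r' [h1 h2 h3 h4 h5]] := IH r.
- exact: leq_trans lt hn.
- exact: r_ge0.
- by move=> v rv; apply: hc; apply: contraNneq rv => /rs ->.
exists r'; split=> //.
- by move=> v /rs /h2.
- move=> k; rewrite h4 /r; under eq_bigr do rewrite mulrDl -mulrA.
  by rewrite big_split /= -mulr_sumr dG mulr0 addr0.
- apply: le_trans h5 _; rewrite /r; under eq_bigr do rewrite mulrDl -mulrA.
  by rewrite big_split /= -mulr_sumr gerDl mulr_ge0_le0.
Qed.

End Sparse.

Definition supp (R : realType) (O A : finType) (P : O -> R) (f : O -> A) : pred A :=
  [pred x | Pr P f x != 0].

Section Support.
Variables (R : realType) (O : finType) (P : O -> R).
Hypothesis hP : is_pmf P.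

Lemma suppP (A : finType) (f : O -> A) x :
  reflect (exists2 w, 0 < P w & f w = x) (x \in supp P f).
Proof.
apply: (iffP idP) => [|[w Pw <-]]; last by rewrite inE gt_eqF // (Pr_at_gt0 hP).
rewrite inE /Pr => n0; apply: contrapT => /forall2NP h.
case/eqP: n0; apply: big1 => w /eqP fw; have [Pw|//] := h w.
by apply/eqP; rewrite eq_le (proj1 hP) andbT leNgt; apply/negP.
Qed.

Lemma card_supp_comp (A B : finType) (f : O -> A) (phi : A -> B) :
  (#|supp P (fun w => phi (f w))| <= #|supp P f|)%N.
Proof.
apply: leq_trans (leq_imset_card phi _); apply: subset_leq_card.
apply/fintype.subsetP => b /suppP[w Pw <-]; apply/imsetP; exists (f w) => //.
by apply/suppP; exists w.
Qed.

Lemma card_supp_rv2 (A B : finType) (f : O -> A) (g : O -> B) :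
  (#|supp P (rv2 f g)| <= #|supp P f| * #|supp P g|)%N.
Proof.
rewrite -cardX; apply: subset_leq_card.
apply/fintype.subsetP => -[x y] /suppP[w Pw [<- <-]].
by apply/andP; split; apply/suppP; exists w.
Qed.

End Support.

Section Reweight.
Variables (R : realType) (O : finType) (P : O -> R).
Hypothesis hP : is_pmf P.
Variables (A S T : finType) (V : O -> A) (C : O -> S) (D : O -> T).
Hypothesis mk : markov P V C D.

Let P0 w : 0 <= P w. Proof. by case: hP. Qed.

(* Preserving the law of [C] is enough to preserve that of [(C, D)], because of the
   Markov chain. *)
Lemma reweight (I : finType) (g : I -> O -> R) (o : O -> R) :
  exists r : A -> R, let P' w := P w * r (V w) in
  [/\ is_pmf P' /\ (forall v, 0 <= r v),
      forall s t, Pr P' (rv2 C D) (s, t) = Pr P (rv2 C D) (s, t),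
      (#|supp P' V| <= #|supp P C| + #|I|)%N,
      forall k, \sum_w P' w * g k w = \sum_w P w * g k w &
      \sum_w P' w * o w <= \sum_w P w * o w].
Proof.
(* One equation per value of [C] of positive probability, and one per functional: their number is
   the bound on the support. *)
pose J : finType := ({s in supp P C} + I)%type.
pose F (h : O -> R) v := \sum_(w | V w == v) P w * h w.
pose G (j : J) (v : A) : R :=
  match j with inl s => Pr P (rv2 C V) (sval s, v) | inr k => F (g k) v end.
(* The equations for [C] add up to the law of [V], positive on its support: this is the positive
   combination that [sparse_weights] asks for. *)
pose c (j : J) : R := if j is inl _ then 1 else 0.
pose r0 v : R := (Pr P V v != 0)%:R.
have r00 v : 0 <= r0 v by [].
have sumF (r : A -> R) h : \sum_v r v * F h v = \sum_w P w * r (V w) * h w.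
  rewrite [RHS](partition_big V xpredT) //=; apply: eq_bigr => v _.
  by rewrite /F mulr_sumr; apply: eq_bigr => w /eqP ->; ring.
have r0V w : P w * r0 (V w) = P w.
  rewrite /r0; case: eqP => [e|_]; last by rewrite mulr1.
  suff -> : P w = 0 by rewrite mul0r.
  by apply/eqP; rewrite eq_le P0 andbT -e (Pr_at_ge hP).
have sumr0F h : \sum_v r0 v * F h v = \sum_w P w * h w.
  by rewrite sumF; under eq_bigr do rewrite r0V.
have sumG v : \sum_j c j * G j v = Pr P V v.
  rewrite big_sumType /= [X in _ + X]big1 ?addr0 => [|k _]; last by rewrite mul0r.
  under eq_bigr do rewrite mul1r.
  rewrite -(sum_Pr_rv2 P C V v) [RHS](bigID (fun s => s \in supp P C)) /=.
  rewrite [X in _ = _ + X]big1 ?addr0 => [|s].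
    by rewrite (big_sub (supp P C) (fun s => Pr P (rv2 C V) (s, v))).
  rewrite inE => /negPn/eqP e.
  by apply/eqP; rewrite eq_le Pr_ge0 // andbT -e Pr_rv2_le_l.
have hc v : r0 v != 0 -> 0 < \sum_j c j * G j v.
  rewrite sumG /r0 => h; rewrite lt_neqAle eq_sym Pr_ge0 // andbT.
  by apply: contraNneq h => ->; rewrite eqxx.
have [r [h1 h2 h3 h4 h5]] := sparse_weights (F o) r00 hc.
have sw s v : Pr P (rv2 V C) (v, s) = Pr P (rv2 C V) (s, v).
  by apply: Pr_eq => w _; rewrite /rv2 !xpair_eqE andbC.
have hC s : \sum_v r v * Pr P (rv2 C V) (s, v) = Pr P C s.
  have e0 : \sum_v r0 v * Pr P (rv2 C V) (s, v) = Pr P C s.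
    rewrite -(sum_Pr_rv2 P V C s); apply: eq_bigr => v _.
    rewrite /r0 sw; case: eqP => [e|_]; last by rewrite mul1r.
    by rewrite mul0r -sw; apply/esym/eqP; rewrite eq_le Pr_ge0 // andbT -e Pr_rv2_le_l.
  have [e|ns] := eqVneq (Pr P C s) 0; last first.
    by rewrite -e0; exact: (h4 (inl (exist _ s ns))).
  rewrite e big1 // => v _; suff -> : Pr P (rv2 C V) (s, v) = 0 by rewrite mulr0.
  by apply/eqP; rewrite eq_le Pr_ge0 // andbT -e Pr_rv2_le_l.
have hCD s t : Pr (fun w => P w * r (V w)) (rv2 C D) (s, t) = Pr P (rv2 C D) (s, t).
  transitivity (\sum_v r v * Pr P (rv2 (rv2 C D) V) ((s, t), v)).
    rewrite {1}/Pr (partition_big V xpredT) //=; apply: eq_bigr => v _.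
    rewrite /Pr mulr_sumr; under [RHS]eq_bigl do rewrite /rv2 xpair_eqE.
    by apply: eq_bigr => w /andP[_ /eqP ->]; rewrite mulrC.
  (* Given [C], the variables [V] and [D] are independent, so [r] enters only through its mean given
     [C], which the equations for [C] fix to 1. *)
  under eq_bigr do rewrite (markov_Pr _ _ _ hP mk) mulrCA.
  rewrite -mulr_sumr; have [e|n0] := eqVneq (Pr P C s) 0.
    suff -> : Pr P (rv2 C D) (s, t) = 0 by rewrite mul0r.
    by apply/eqP; rewrite eq_le Pr_ge0 // andbT -e Pr_rv2_le_l.
  rewrite -[RHS]mulr1; congr (_ * _).
  rewrite /cPr; under eq_bigr do rewrite mulrA.
  rewrite -mulr_suml; under eq_bigr do rewrite sw.
  by rewrite hC divff.
exists r; split=> //.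
- split=> //; split=> [w|]; first by rewrite mulr_ge0.
  transitivity (\sum_st Pr (fun w => P w * r (V w)) (rv2 C D) st).
    have := sum_Pr (fun w => P w * r (V w)) (rv2 C D) (fun=> 1).
    by under eq_bigr do rewrite mulr1; under [X in _ = X]eq_bigr do rewrite mulr1.
  by rewrite -(sum_Pr_eq1 hP (rv2 C D)); apply: eq_bigr => -[].
- apply: leq_trans (_ : #|[pred v | r v != 0%R]| <= _)%N.
    apply: subset_leq_card; apply/fintype.subsetP => v; rewrite !inE; apply: contraNneq => rv.
    by apply/eqP/big1 => w /eqP ->; rewrite rv mulr0.
  by apply: leq_trans h3 _; rewrite card_sum card_sig.
- by move=> k; rewrite -sumF -sumr0F; exact: (h4 (inr k)).
- by rewrite -sumF -sumr0F.
Qed.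

Variable r : A -> R.
Hypothesis r_ge0 : forall v, 0 <= r v.
Local Notation P' := (fun w => P w * r (V w)).
Hypothesis hP' : is_pmf P'.
Hypothesis hCD : forall s t, Pr P' (rv2 C D) (s, t) = Pr P (rv2 C D) (s, t).

Definition determined (B B' : Type) (f : O -> B) (g : O -> B') : Prop :=
  forall w w', g w = g w' -> f w = f w'.

Lemma Pr_determined (B : finType) (f : O -> B) b : determined f (rv2 C D) ->
  Pr P' f b = Pr P f b.
Proof.
move=> df; rewrite /Pr [LHS](partition_big (rv2 C D) xpredT) //.
rewrite [RHS](partition_big (rv2 C D) xpredT) //=; apply: eq_bigr => -[s t] _.
have [[w0 e0 f0]|h] := pselect (exists2 w, rv2 C D w = (s, t) & f w = b).
  have e w : (f w == b) && (rv2 C D w == (s, t)) = (rv2 C D w == (s, t)).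
    case: (rv2 C D w =P (s, t)) => [ew|]; last by rewrite andbF.
    by rewrite andbT -f0; apply/eqP/df; rewrite ew.
  by rewrite !(eq_bigl _ _ e); exact: hCD.
by rewrite !big1 // => w /andP[/eqP fw /eqP ew]; case: h; exists w.
Qed.

Lemma ent_values (Q : O -> R) (B : finType) (f : O -> B) :
  ent Q f = - \sum_b Pr Q f b * ln (Pr Q f b).
Proof. by rewrite sum_Pr. Qed.

Lemma ent_determined (B : finType) (f : O -> B) : determined f (rv2 C D) ->
  ent P' f = ent P f.
Proof.
by move=> df; rewrite !ent_values; congr (- _); apply: eq_bigr => b _; rewrite Pr_determined.
Qed.

Lemma cent_determined (B B' : finType) (f : O -> B) (g : O -> B') :
  determined f (rv2 C D) -> determined g (rv2 C D) -> cent P' f g = cent P f g.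
Proof.
move=> df dg; rewrite /cent !ent_determined // => w w' e.
by rewrite /rv2 (df _ _ e) (dg _ _ e).
Qed.

Lemma Pr_scaled (B : finType) (f : O -> B) b v : (forall w, f w = b -> V w = v) ->
  Pr P' f b = r v * Pr P f b.
Proof.
by move=> h; rewrite /Pr mulr_sumr; apply: eq_bigr => w /eqP/h ->; rewrite mulrC.
Qed.

(** When the condition determines [V], the factor [r (V w)] appears in both numerator and
    denominator. *)
Lemma cPr_scaled (B B' : finType) (f : O -> B) (g : O -> B') x w :
  determined V g -> 0 < P' w -> cPr P' f g x (g w) = cPr P f g x (g w).
Proof.
move=> dg Pw; rewrite /cPr (@Pr_scaled _ g _ (V w)); last by move=> w' e; exact: dg.
rewrite (@Pr_scaled _ (rv2 f g) _ (V w)); last by move=> w' [_ e]; exact: dg.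
rewrite -mulf_div divff ?mul1r //.
by apply: contraTneq Pw => ->; rewrite mulr0 ltxx.
Qed.

(** This is the linearity in [r]: the logarithms are those of the original law, and only the outer
    weights change. *)
Lemma cent_scaled (B B' : finType) (f : O -> B) (g : O -> B') : determined V g ->
  cent P' f g = \sum_w P' w * - ln (cPr P f g (f w) (g w)).
Proof.
move=> dg; rewrite (cent_sum hP') -sumrN; apply: eq_bigr => w _; rewrite mulrN.
have : 0 <= P' w by case: hP'.
rewrite le_eqVlt => /predU1P[<-|h]; first by rewrite !mul0r.
by rewrite cPr_scaled.
Qed.

Lemma markov_determined (B1 B2 B3 : finType) (f : O -> B1) (g : O -> B2) (h : O -> B3) :
  determined f (rv2 C D) -> determined g (rv2 C D) -> determined h (rv2 C D) ->
  markov P f g h -> markov P' f g h.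
Proof.
move=> df dg dh m a b c; rewrite /cPr.
have d2 (E E' : finType) (u : O -> E) (u' : O -> E') :
  determined u (rv2 C D) -> determined u' (rv2 C D) -> determined (rv2 u u') (rv2 C D).
  by move=> du du' w w' e; rewrite /rv2 (du _ _ e) (du' _ _ e).
have dgh := d2 _ _ _ _ dg dh.
rewrite (Pr_determined _ (d2 _ _ _ _ df dgh)) (Pr_determined _ dgh).
by rewrite (Pr_determined _ (d2 _ _ _ _ df dg)) (Pr_determined _ dg); apply: m.
Qed.

Lemma markov_scaled (B1 B2 B3 : finType) (f : O -> B1) (g : O -> B2) (h : O -> B3) :
  determined V g -> markov P f g h -> markov P' f g h.
Proof.
move=> dg m a b c n0.
have /(suppP hP')[w Pw [<- <-]] : (b, c) \in supp P' (rv2 g h) by rewrite inE.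
have dgh : determined V (rv2 g h) by move=> w1 w2 [e _]; exact: dg.
rewrite -[(g w, h w)]/(rv2 g h w) (cPr_scaled _ _ dgh Pw) (cPr_scaled _ _ dg Pw) m //.
rewrite gt_eqF // (Pr_at_gt0 hP (rv2 g h)) // lt_neqAle P0 andbT eq_sym.
by apply: contraTneq Pw => ->; rewrite mul0r ltxx.
Qed.

(** The chain of [V] itself survives because the factor [r v] comes out of both sides and the laws
    of [C] and of [(C, D)] are unchanged. *)
Lemma markov_reweighted : markov P' V C D.
Proof.
move=> v s t n0; rewrite /cPr.
have dC : determined C (rv2 C D) by move=> w w' [].
rewrite (@Pr_scaled _ (rv2 V (rv2 C D)) _ v); last by move=> w [].
rewrite (@Pr_scaled _ (rv2 V C) _ v); last by move=> w [].
rewrite hCD in n0; rewrite hCD (Pr_determined _ dC) -!mulrA; congr (_ * _).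
exact: mk n0.
Qed.

End Reweight.

(** * Reducing the support of one auxiliary variable at a time *)

Section Reduction.
Variables (R : realType) (X1 X2 Y : finType) (p : X1 * X2 * Y -> R) (K' : nat).
Local Notation K := K'.+1.
Variable a : auxiliary p.
Local Notation x1 := (@rX1 _ _ _ _ _ a).
Local Notation x2 := (@rX2 _ _ _ _ _ a).
Local Notation y := (@rY _ _ _ _ _ a).
Local Notation v1 := (@V1 _ _ _ _ _ a).
Local Notation v2 := (@V2 _ _ _ _ _ a).
Local Notation w1 := (@W1 _ _ _ _ _ a).
Local Notation w2 := (@W2 _ _ _ _ _ a).
Local Notation x12 := (rv2 x1 x2).

Lemma w1_eq l w w' : (forall k, (k < l)%N -> v1 k w = v1 k w' /\ v2 k w = v2 k w') ->
  w1 l w = w1 l w'.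
Proof. by move=> h; apply/ffunP => k; rewrite !ffunE; have [-> ->] := h k (ltn_ord k). Qed.

Lemma w1_inj l w w' : w1 l w = w1 l w' ->
  forall k, (k < l)%N -> v1 k w = v1 k w' /\ v2 k w = v2 k w'.
Proof. by move=> /ffunP e k kl; have := e (Ordinal kl); rewrite !ffunE => -[]. Qed.

Lemma w1_mono k l w w' : (k <= l)%N -> w1 l w = w1 l w' -> w1 k w = w1 k w'.
Proof.
move=> kl /w1_inj h; apply: w1_eq => j jk; exact: h (leq_trans jk kl).
Qed.

Section Conditions.
Variable P : Om a -> R.

Definition chains : Prop := forall k, (k < K)%N ->
  markov P (v1 k) (rv2 x1 (w1 k)) (rv2 x2 y) /\ markov P (v2 k) (rv2 x2 (w2 k)) (rv2 x1 y).

Definition rates (R1 R2 mu : R) : Prop :=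
  [/\ cminfo P x1 (w1 K) x2 <= R1,
      cminfo P x2 (v2 K') (w2 K') + cminfo P x2 (w2 K') x1 <= R2,
      minfo P x12 (w1 K) <= R1 + R2 & mu <= minfo P y (w1 K)].

(** Each rate is an entropy of the source, fixed by [p], corrected by one of these residuals; so the
    rates are controlled as soon as [resid1], [resid12] and [resid2] are kept and [residY] does not
    grow. *)
Definition resid1 : R := cent P x1 (rv2 (w1 K) x2).
Definition resid12 : R := cent P x12 (w1 K).
Definition resid2 : R := cent P x2 (w2 K') - cent P x2 (rv2 (v2 K') (w2 K')) -
  cent P x2 (rv2 (w2 K') x1).
Definition residY : R := cent P y (w1 K).

Lemma ratesE (hP : is_pmf P) R1 R2 mu : rates R1 R2 mu <->
  [/\ cent P x1 x2 - resid1 <= R1 * ln 2, resid2 + cent P x2 x1 <= R2 * ln 2,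
      ent P x12 - resid12 <= (R1 + R2) * ln 2 & mu * ln 2 <= ent P y - residY].
Proof.
have L0 := ln2_gt0 R.
have e1 : cminfo P x1 (w1 K) x2 * ln 2 = cent P x1 x2 - resid1.
  rewrite (cminfo_ent hP) /resid1 /cent.
  have -> : ent P (rv2 x1 (rv2 (w1 K) x2)) = ent P (rv2 (rv2 x1 (w1 K)) x2).
    by apply: ent_eq => w w' _ _; rewrite /rv2 !xpair_eqE andbA.
  ring.
have e2 : (cminfo P x2 (v2 K') (w2 K') + cminfo P x2 (w2 K') x1) * ln 2 = resid2 + cent P x2 x1.
  rewrite mulrDl !(cminfo_ent hP) /resid2 /cent.
  have -> : ent P (rv2 x2 (rv2 (v2 K') (w2 K'))) = ent P (rv2 (rv2 x2 (v2 K')) (w2 K')).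
    by apply: ent_eq => w w' _ _; rewrite /rv2 !xpair_eqE andbA.
  have -> : ent P (rv2 x2 (rv2 (w2 K') x1)) = ent P (rv2 (rv2 x2 (w2 K')) x1).
    by apply: ent_eq => w w' _ _; rewrite /rv2 !xpair_eqE andbA.
  ring.
have e3 : minfo P x12 (w1 K) * ln 2 = ent P x12 - resid12.
  by rewrite (minfo_ent hP) /resid12 /cent; ring.
have e4 : minfo P y (w1 K) * ln 2 = ent P y - residY.
  by rewrite (minfo_ent hP) /residY /cent; ring.
by rewrite /rates -e1 -e2 -e3 -e4; split => -[]; rewrite !ler_pM2r.
Qed.

Definition nsupp1 k := #|supp P (v1 k)|.
Definition nsupp2 k := #|supp P (v2 k)|.
Definition nsuppW l : nat := (\prod_(i < l) (nsupp1 i * nsupp2 i))%N.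
(** Bounds on supports, with the surpluses that the construction provides; they imply the stated
    bounds with 4, 4, 3 and 1. *)
Definition bound1 k : Prop := (nsupp1 k <= #|X1| * nsuppW k + 3)%N.
Definition bound2 k : Prop :=
  (nsupp2 k <= #|X2| * (nsuppW k * nsupp1 k) + (if k == K' then 1 else 3))%N.

Lemma card_supp_w1 (hP : is_pmf P) l : (#|supp P (w1 l)| <= nsuppW l)%N.
Proof.
elim: l => [|l IH].
  rewrite /nsuppW big_ord0; apply: leq_trans (max_card _) _.
  by rewrite card_dep_ffun /image_mem /= enum_ord0.
rewrite /nsuppW big_ord_recr /=.
pose g := rv2 (w1 l) (rv2 (v1 l) (v2 l)).
have -> : #|supp P (w1 l.+1)| = #|supp P (fun w => hist_snoc (g w).1 (g w).2)|.
  by apply: eq_card => h; rewrite !inE; congr (_ != 0); apply: Pr_eq => w _; rewrite W1S.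
apply: leq_trans (card_supp_comp hP g (fun t => hist_snoc t.1 t.2)) _.
apply: leq_trans (card_supp_rv2 hP _ _) _; rewrite leq_mul //.
exact: card_supp_rv2.
Qed.

Lemma card_supp_side1 (hP : is_pmf P) l : (#|supp P (rv2 x1 (w1 l))| <= #|X1| * nsuppW l)%N.
Proof.
apply: leq_trans (card_supp_rv2 hP _ _) _; apply: leq_mul; first exact: max_card.
exact: card_supp_w1.
Qed.

Lemma card_supp_side2 (hP : is_pmf P) l :
  (#|supp P (rv2 x2 (w2 l))| <= #|X2| * (nsuppW l * nsupp1 l))%N.
Proof.
apply: leq_trans (card_supp_rv2 hP _ _) _; apply: leq_mul; first exact: max_card.
apply: leq_trans (card_supp_rv2 hP _ _) _; rewrite leq_mul //.
exact: card_supp_w1.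
Qed.

End Conditions.

Variables R1 R2 mu : R.

Definition valid (P : Om a -> R) : Prop :=
  [/\ is_pmf P, forall t, Pr P (rv2 x12 y) t = p t, chains P & rates P R1 R2 mu].

Section Step.
Variables (P : Om a -> R) (A S T : finType) (V : Om a -> A) (C : Om a -> S) (D : Om a -> T).
Variable r : A -> R.
Local Notation P' := (fun w => P w * r (V w)).
Hypothesis hP : is_pmf P.
Hypothesis hP' : is_pmf P'.
Hypothesis r_ge0 : forall v, 0 <= r v.
Hypothesis hCD : forall s t, Pr P' (rv2 C D) (s, t) = Pr P (rv2 C D) (s, t).
Hypothesis dx : determined (rv2 x12 y) (rv2 C D).

Let dx1 : determined x1 (rv2 C D). Proof. by move=> w w' /dx[]. Qed.
Let dx2 : determined x2 (rv2 C D). Proof. by move=> w w' /dx[]. Qed.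
Let dy : determined y (rv2 C D). Proof. by move=> w w' /dx[]. Qed.
Let dx12 : determined x12 (rv2 C D). Proof. by move=> w w' /dx[e1 e2 _]; rewrite /rv2 e1 e2. Qed.

Lemma rates_reweighted : resid1 P' = resid1 P -> resid12 P' = resid12 P ->
  resid2 P' = resid2 P -> residY P' <= residY P ->
  rates P R1 R2 mu -> rates P' R1 R2 mu.
Proof.
move=> e1 e2 e3 e4 /(ratesE hP)[h1 h2 h3 h4]; apply/(ratesE hP').
rewrite !(cent_determined hCD) // !(ent_determined hCD) // e1 e2 e3; split=> //.
by apply: le_trans h4 _; rewrite lerD2l lerN2.
Qed.

Lemma law_reweighted : (forall t, Pr P (rv2 x12 y) t = p t) ->
  forall t, Pr P' (rv2 x12 y) t = p t.
Proof. by move=> h t; rewrite (Pr_determined hCD) // h. Qed.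

Lemma bounds_reweighted l : determined (w1 l) (rv2 C D) ->
  [/\ nsuppW P' l = nsuppW P l,
      forall k, (k < l)%N -> bound1 P k -> bound1 P' k &
      forall k, (k < l)%N -> bound2 P k -> bound2 P' k].
Proof.
move=> dw.
have e1 k : (k < l)%N -> nsupp1 P' k = nsupp1 P k.
  move=> kl; apply: eq_card => v; rewrite !inE (Pr_determined hCD) // => w w' /dw e.
  by have [] := w1_inj e kl.
have e2 k : (k < l)%N -> nsupp2 P' k = nsupp2 P k.
  move=> kl; apply: eq_card => v; rewrite !inE (Pr_determined hCD) // => w w' /dw e.
  by have [] := w1_inj e kl.
have ew k : (k <= l)%N -> nsuppW P' k = nsuppW P k.
  by move=> kl; apply: eq_bigr => i _; rewrite e1 ?e2 // (leq_trans (ltn_ord i)).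
split; first exact: ew.
  by move=> k kl; rewrite /bound1 e1 // ew // ltnW.
by move=> k kl; rewrite /bound2 e1 // e2 // ew // ltnW.
Qed.

End Step.

Definition ci (P : Om a -> R) (B B' : finType) (f : Om a -> B) (g : Om a -> B') w : R :=
  - ln (cPr P f g (f w) (g w)).

Lemma cent_ci (P : Om a -> R) (hP : is_pmf P) (B B' : finType) (f : Om a -> B)
    (g : Om a -> B') : cent P f g = \sum_w P w * ci P f g w.
Proof. by rewrite (cent_sum hP) -sumrN; apply: eq_bigr => w _; rewrite mulrN. Qed.

(** Pointwise versions of [resid1], [resid12] and [resid2]: the three linear equations imposed
    besides the law of the conditioning variable. The relevance is the objective and costs no
    equation. *)
Definition functional (P : Om a -> R) (k : 'I_3) (w : Om a) : R :=
  match val k with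
  | 0%N => ci P x1 (rv2 (w1 K) x2) w
  | 1%N => ci P x12 (w1 K) w
  | _ => ci P x2 (w2 K') w - ci P x2 (rv2 (v2 K') (w2 K')) w - ci P x2 (rv2 (w2 K') x1) w
  end.

(** Every conditioning variable must determine [V], so that the residuals are linear in [r]. The
    condition on [w2 K'] excludes the very last word, which needs the separate argument of
    [resid_last]. *)
Lemma rates_functional (P : Om a -> R) (A : finType) (V : Om a -> A) (r : A -> R) :
  let P' := fun w => P w * r (V w) in
  is_pmf P -> is_pmf P' -> determined V (w1 K) -> determined V (w2 K') ->
  (forall k, \sum_w P' w * functional P k w = \sum_w P w * functional P k w) ->
  \sum_w P' w * ci P y (w1 K) w <= \sum_w P w * ci P y (w1 K) w ->
  [/\ resid1 P' = resid1 P, resid12 P' = resid12 P, resid2 P' = resid2 P & residY P' <= residY P].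
Proof.
move=> P' hP hP' dV dV2 hf ho.
have s (B B' : finType) (f : Om a -> B) (g : Om a -> B') : determined V g ->
  cent P' f g = \sum_w P' w * ci P f g w by exact: cent_scaled.
have d1 : determined V (rv2 (w1 K) x2) by move=> w w' [/dV].
have d2 : determined V (rv2 (v2 K') (w2 K')).
  by move=> w w' [_ e1 e2]; apply: dV2; rewrite /W2 /rv2 e1 e2.
have d3 : determined V (rv2 (w2 K') x1).
  by move=> w w' [e1 e2 _]; apply: dV2; rewrite /W2 /rv2 e1 e2.
have m3 (Q : Om a -> R) : \sum_w Q w * functional P (inord 2) w =
  \sum_w Q w * ci P x2 (w2 K') w - \sum_w Q w * ci P x2 (rv2 (v2 K') (w2 K')) w -
  \sum_w Q w * ci P x2 (rv2 (w2 K') x1) w.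
  by rewrite -!sumrB; apply: eq_bigr => w _; rewrite /functional /= inordK // !mulrBr.
split.
- by rewrite /resid1 s // cent_ci //; exact: (hf ord0).
- rewrite /resid12 s // cent_ci //; have := hf (inord 1).
  by rewrite /functional /= inordK.
- by rewrite /resid2 !s // !cent_ci // -!m3.
- by rewrite /residY s // cent_ci.
Qed.

End Reduction.

Section ReductionSteps.
Variables (R : realType) (X1 X2 Y : finType) (p : X1 * X2 * Y -> R) (K' : nat).
Local Notation K := K'.+1.
Variable a : auxiliary p.
Local Notation x1 := (@rX1 _ _ _ _ _ a).
Local Notation x2 := (@rX2 _ _ _ _ _ a).
Local Notation y := (@rY _ _ _ _ _ a).
Local Notation v1 := (@V1 _ _ _ _ _ a).
Local Notation v2 := (@V2 _ _ _ _ _ a).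
Local Notation w1 := (@W1 _ _ _ _ _ a).
Local Notation w2 := (@W2 _ _ _ _ _ a).
Local Notation x12 := (rv2 x1 x2).
Variables R1 R2 mu : R.
Local Notation valid := (@valid _ _ _ _ _ K' a R1 R2 mu).

Lemma det_v1 k l : (k < l)%N -> determined (v1 k) (w1 l).
Proof. by move=> kl w w' /w1_inj/(_ k kl)[]. Qed.

Lemma det_v2 k l : (k < l)%N -> determined (v2 k) (w1 l).
Proof. by move=> kl w w' /w1_inj/(_ k kl)[]. Qed.

Lemma det_w1 k l : (k <= l)%N -> determined (w1 k) (w1 l).
Proof. by move=> kl w w' /(w1_mono kl). Qed.

Lemma det_rv2 (O : finType) (B B' B'' : Type) (f : O -> B) (g : O -> B') (h : O -> B'') :
  determined f h -> determined g h -> determined (rv2 f g) h.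
Proof. by move=> df dg w w' e; rewrite /rv2 (df _ _ e) (dg _ _ e). Qed.

(** Variables are treated in order of time. The law of the past and of the source is preserved,
    hence also the supports already reduced; later supports may change, but they are bounded
    afterwards. *)
Lemma reduce1 P l : (l < K)%N -> valid P ->
  (forall k, (k < l)%N -> bound1 P k /\ bound2 K' P k) ->
  exists2 P', valid P' & (forall k, (k < l)%N -> bound1 P' k /\ bound2 K' P' k) /\ bound1 P' l.
Proof.
move=> lK [hP hlaw hch hr] hb.
have [r /= [[hP' r0] hCD hs hg ho]] := reweight hP (proj1 (hch l lK))
  (functional K' P) (ci P y (w1 K)).
set P' := fun w => _ in hP' hCD hs hg ho *.
have dC : determined (rv2 x12 y) (rv2 (rv2 x1 (w1 l)) (rv2 x2 y)).
  by move=> w w' [e1 _ e2 e3]; rewrite /rv2 e1 e2 e3.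
have dw : determined (w1 l) (rv2 (rv2 x1 (w1 l)) (rv2 x2 y)) by move=> w w' [].
have dV : determined (v1 l) (w1 K) by exact: det_v1.
have dV2 : determined (v1 l) (w2 K').
  move=> w w' [e1 e2]; move: lK; rewrite ltnS leq_eqVlt => /predU1P[->//|lK'].
  exact: det_v1 lK' _ _ e1.
have [e1 e2 e3 e4] := rates_functional hP hP' dV dV2 hg ho.
have [ew b1 b2] := bounds_reweighted K' hCD dw.
have ch : chains K' P'.
  move=> k kK; have [m1 m2] := hch k kK.
  (* Earlier chains involve only variables whose joint law is preserved; later ones have the
     reweighted variable in their condition. At the same step the first chain is the reweighted one
     and the second has [v1 l] in its condition. *)
  have [kl|lk|kl] := ltngtP k l.
  - have d1 : determined (v1 k) (rv2 (rv2 x1 (w1 l)) (rv2 x2 y)).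
      by move=> w w' /dw; exact: det_v1.
    have d2 : determined (v2 k) (rv2 (rv2 x1 (w1 l)) (rv2 x2 y)).
      by move=> w w' /dw; exact: det_v2.
    have d3 : determined (w1 k) (rv2 (rv2 x1 (w1 l)) (rv2 x2 y)).
      by move=> w w' /dw; exact: det_w1 (ltnW kl) _ _.
    split; apply: (markov_determined hCD) => // w w' e; have [ex1 ex2 ey] := dC _ _ e;
      by rewrite /W2 /rv2 ?ex1 ?ex2 ?ey ?(d3 _ _ e) ?(d1 _ _ e).
  - split; apply: (markov_scaled hP hP') => //.
      by move=> w w' [_ e]; exact: det_v1 lk _ _ e.
    by move=> w w' [_ e _]; exact: det_v1 lk _ _ e.
  - rewrite kl; rewrite kl in m1 m2; split.
      exact: (markov_reweighted m1 hCD).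
    by apply: (markov_scaled hP hP') => // w w' [_ _ e].
exists P'.
  split=> //; first exact: (law_reweighted hCD).
  exact: (rates_reweighted hP hP' hCD).
split.
  by move=> k kl; have [h1 h2] := hb k kl; split; [exact: b1|exact: b2].
rewrite /bound1 ew; apply: leq_trans hs _; rewrite card_ord leq_add2r.
exact: card_supp_side1.
Qed.

Lemma resid_last P : is_pmf P -> markov P (v2 K') (rv2 x2 (w2 K')) (rv2 x1 y) ->
  resid1 K' P = cent P x1 (rv2 (w2 K') x2) /\
  resid12 K' P = cent P x2 (rv2 (v2 K') (w2 K')) + resid1 K' P.
Proof.
move=> hP /(markov_cent hP)[mk _]; split; rewrite /resid1 /resid12 /cent; last first.
  have -> : ent P (rv2 x12 (w1 K)) = ent P (rv2 x1 (rv2 (w1 K) x2)).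
    by apply: ent_eq => w w' _ _; rewrite /rv2 !xpair_eqE; do ?case: (_ == _).
  have -> : ent P (rv2 x2 (rv2 (v2 K') (w2 K'))) = ent P (rv2 (w1 K) x2).
    by apply: ent_eq => w w' _ _; rewrite /W2 /rv2 !xpair_eqE W1S_eq; do ?case: (_ == _).
  have -> : ent P (rv2 (v2 K') (w2 K')) = ent P (w1 K).
    by apply: ent_eq => w w' _ _; rewrite /W2 /rv2 !xpair_eqE W1S_eq; do ?case: (_ == _).
  ring.
have -> : ent P (rv2 x1 (rv2 (w1 K) x2)) =
    cent P (v2 K') (rv2 (rv2 x2 x1) (w2 K')) + ent P (rv2 x1 (rv2 (w2 K') x2)).
  have -> : ent P (rv2 x1 (rv2 (w2 K') x2)) = ent P (rv2 (rv2 x2 x1) (w2 K')).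
    by apply: ent_eq => w w' _ _; rewrite /rv2 !xpair_eqE; do ?case: (_ == _).
  rewrite /cent subrK.
  by apply: ent_eq => w w' _ _; rewrite /W2 /rv2 !xpair_eqE W1S_eq; do ?case: (_ == _).
have -> : ent P (rv2 (w1 K) x2) = cent P (v2 K') (rv2 x2 (w2 K')) + ent P (rv2 (w2 K') x2).
  have -> : ent P (rv2 (w2 K') x2) = ent P (rv2 x2 (w2 K')).
    by apply: ent_eq => w w' _ _; rewrite /rv2 !xpair_eqE andbC.
  rewrite /cent subrK.
  by apply: ent_eq => w w' _ _; rewrite /W2 /rv2 !xpair_eqE W1S_eq; do ?case: (_ == _).
by rewrite mk; ring.
Qed.

Lemma reduce2 P l : (l < K)%N -> valid P ->
  (forall k, (k < l)%N -> bound1 P k /\ bound2 K' P k) -> bound1 P l ->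
  exists2 P', valid P' & forall k, (k < l.+1)%N -> bound1 P' k /\ bound2 K' P' k.
Proof.
move=> lK [hP hlaw hch hr] hb hb1.
(* At the last step H(X1 | X2, W) is fixed by the Markov chain, so that only
   H(X2 | W) has to be preserved. *)
pose last1 (k : 'I_1) := ci P x2 (rv2 (v2 K') (w2 K')).
(* The last step and the others differ only in how the residuals are preserved; this common
   conclusion lets the rest be argued once. *)
have [r [hP' r0 hCD hs hq]] : exists r, let P' := fun w => P w * r (v2 l w) in
  [/\ is_pmf P', forall v, 0 <= r v,
   forall s t, Pr P' (rv2 (rv2 x2 (w2 l)) (rv2 x1 y)) (s, t) =
               Pr P (rv2 (rv2 x2 (w2 l)) (rv2 x1 y)) (s, t),
   (#|supp P' (v2 l)| <= #|supp P (rv2 x2 (w2 l))| + (if l == K' then 1 else 3))%N &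
   [/\ resid1 K' P' = resid1 K' P, resid12 K' P' = resid12 K' P, resid2 K' P' = resid2 K' P &
       residY K' P' <= residY K' P]].
  have dV : determined (v2 l) (w1 K) by exact: det_v2.
  have [lK'|lK'] := eqVneq l K'.
    move: lK dV; rewrite {l hb hb1}lK' => lK dV.
    have mk := proj2 (hch K' lK).
    have [r /= [[hP' r0] hCD hs hg ho]] := reweight hP mk last1 (ci P y (w1 K)).
    exists r; split=> //; first by rewrite card_ord in hs.
    have mk' := markov_reweighted mk hCD.
    set P' := fun w => _ in hP' hCD hs hg ho mk' *.
    have [qa qb] := resid_last hP mk; have [qa' qb'] := resid_last hP' mk'.
    have cd := cent_determined hCD.
    have [d1 d2 dw] : [/\ determined x1 (rv2 (rv2 x2 (w2 K')) (rv2 x1 y)),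
        determined x2 (rv2 (rv2 x2 (w2 K')) (rv2 x1 y)) &
        determined (w2 K') (rv2 (rv2 x2 (w2 K')) (rv2 x1 y))].
      by split=> w w' e; move: e => [? ? ? ? ?] //; apply: (f_equal2 pair).
    have e1 : resid1 K' P' = resid1 K' P by rewrite qa qa' (cd _ _ _ _ d1 (det_rv2 dw d2)).
    have e2 : cent P' x2 (rv2 (v2 K') (w2 K')) = cent P x2 (rv2 (v2 K') (w2 K')).
      rewrite (cent_scaled hP') => [|w w' []//]; rewrite cent_ci //; exact: (hg ord0).
    split=> //; first by rewrite qb qb' e1 e2.
      rewrite /resid2 e2; congr (_ - _ - _).
        exact: cd d2 dw.
      exact: cd d2 (det_rv2 dw d1).
    by rewrite /residY (cent_scaled hP') // cent_ci.
  have [r /= [[hP' r0] hCD hs hg ho]] := reweight hP (proj2 (hch l lK))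
    (functional K' P) (ci P y (w1 K)).
  exists r; split=> //; first by rewrite card_ord in hs.
  apply: rates_functional => // w w' [e1 e2].
  by apply: det_v2 e1; rewrite ltn_neqAle lK' -ltnS.
set P' := fun w => _ in hP' hCD hs hq.
have dC : determined (rv2 x12 y) (rv2 (rv2 x2 (w2 l)) (rv2 x1 y)).
  by move=> w w'; rewrite /rv2 /W2; move=> [e1 e2 e3 e4 e5]; rewrite ?e1 ?e4 ?e5.
have dw : determined (w1 l) (rv2 (rv2 x2 (w2 l)) (rv2 x1 y)) by move=> w w' [].
have dv : determined (v1 l) (rv2 (rv2 x2 (w2 l)) (rv2 x1 y)) by move=> w w' [].
have [ew b1 b2] := bounds_reweighted K' hCD dw.
have en : nsupp1 P' l = nsupp1 P l.
  by apply: eq_card => v; rewrite !inE (Pr_determined hCD).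
have ch : chains K' P'.
  move=> k kK; have [m1 m2] := hch k kK.
  have [kl|lk|kl] := ltngtP k l.
  - have d1 : determined (v1 k) (rv2 (rv2 x2 (w2 l)) (rv2 x1 y)).
      by move=> w w' /dw; exact: det_v1.
    have d2 : determined (v2 k) (rv2 (rv2 x2 (w2 l)) (rv2 x1 y)).
      by move=> w w' /dw; exact: det_v2.
    have d3 : determined (w1 k) (rv2 (rv2 x2 (w2 l)) (rv2 x1 y)).
      by move=> w w' /dw; exact: det_w1 (ltnW kl) _ _.
    split; apply: (markov_determined hCD) => // w w' e; have [ex1 ex2 ey] := dC _ _ e;
      by rewrite /W2 /rv2 ?ex1 ?ex2 ?ey ?(d3 _ _ e) ?(d1 _ _ e).
  - split; apply: (markov_scaled hP hP') => //.
      by move=> w w' [_ e]; exact: det_v2 lk _ _ e.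
    by move=> w w' [_ e _]; exact: det_v2 lk _ _ e.
  - rewrite kl; rewrite kl in m1 m2; split; last exact: (markov_reweighted m2 hCD).
    apply: (markov_determined hCD) => // w w' e; have [ex1 ex2 ey] := dC _ _ e;
      by rewrite /rv2 ?ex1 ?ex2 ?ey ?(dw _ _ e).
have [e1 e2 e3 e4] := hq.
exists P'.
  split=> //; first exact: (law_reweighted hCD).
  exact: (rates_reweighted hP hP' hCD).
move=> k; rewrite ltnS leq_eqVlt => /predU1P[->|kl]; last first.
  by have [h1 h2] := hb k kl; split; [exact: b1|exact: b2].
split; first by rewrite /bound1 ew en.
rewrite /bound2 ew en; apply: leq_trans hs _; rewrite leq_add2r.
exact: card_supp_side2.
Qed.

Lemma reduce_all P : valid P -> exists2 P', valid P' &
  forall k, (k < K)%N -> bound1 P' k /\ bound2 K' P' k.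
Proof.
move=> hv; suff h l : (l <= K)%N -> exists2 P', valid P' &
  forall k, (k < l)%N -> bound1 P' k /\ bound2 K' P' k by exact: h.
elim: l => [_|l IH lK]; first by exists P.
have [Q hQ hb] := IH (ltnW lK).
have [Q1 hQ1 [hb1 hl]] := reduce1 lK hQ hb.
exact: reduce2 lK hQ1 hb1 hl.
Qed.

End ReductionSteps.

(** * Cutting alphabets down to supports *)

Section Relabel.
Variables (R : realType) (O : finType) (P : O -> R).
Hypothesis hP : is_pmf P.

Definition same_on (A B : finType) (f : O -> A) (g : O -> B) : Prop :=
  forall w w', P w != 0 -> P w' != 0 -> (f w == f w') = (g w == g w').

Lemma same_on_rv2 (A B A' B' : finType) (f : O -> A) (g : O -> B) (f' : O -> A')
    (g' : O -> B') : same_on f f' -> same_on g g' -> same_on (rv2 f g) (rv2 f' g').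
Proof. by move=> hf hg w w' n0 n0'; rewrite /rv2 !xpair_eqE hf // hg. Qed.

Lemma minfo_same (A B A' B' : finType) (f : O -> A) (g : O -> B) (f' : O -> A')
    (g' : O -> B') : same_on f f' -> same_on g g' -> minfo P f g = minfo P f' g'.
Proof.
move=> hf hg; apply: (mulIf (lt0r_neq0 (ln2_gt0 R))); rewrite !(minfo_ent hP).
by rewrite (ent_eq hf) (ent_eq hg) (ent_eq (same_on_rv2 hf hg)).
Qed.

Lemma cminfo_same (A B C A' B' C' : finType) (f : O -> A) (g : O -> B) (h : O -> C)
    (f' : O -> A') (g' : O -> B') (h' : O -> C') :
  same_on f f' -> same_on g g' -> same_on h h' -> cminfo P f g h = cminfo P f' g' h'.
Proof.
move=> hf hg hh; apply: (mulIf (lt0r_neq0 (ln2_gt0 R))); rewrite !(cminfo_ent hP).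
rewrite (ent_eq (same_on_rv2 hf hh)) (ent_eq (same_on_rv2 hg hh)) (ent_eq hh).
by rewrite (ent_eq (same_on_rv2 (same_on_rv2 hf hg) hh)).
Qed.

Lemma markov_relabel (A B C A' B' : finType) (f : O -> A) (g : O -> B) (h : O -> C)
    (f' : O -> A') (g' : O -> B') (phi : A' -> A) :
  (forall w u, P w != 0 -> (f' w == u) = (f w == phi u)) -> same_on g' g ->
  markov P f g h -> markov P f' g' h.
Proof.
move=> hf hg mk u b c n0.
have /(suppP hP)[w Pw [<- <-]] : (b, c) \in supp P (rv2 g' h) by rewrite inE.
have Pw0 : P w != 0 by rewrite gt_eqF.
have eg : Pr P g' (g' w) = Pr P g (g w) by apply: Pr_eq => w' n'; exact: hg.
have efg : Pr P (rv2 f' g') (u, g' w) = Pr P (rv2 f g) (phi u, g w).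
  by apply: Pr_eq => w' n'; rewrite /rv2 !xpair_eqE hf // hg.
have egh : Pr P (rv2 g' h) (g' w, h w) = Pr P (rv2 g h) (g w, h w).
  by apply: Pr_eq => w' n'; rewrite /rv2 !xpair_eqE hg.
have efgh : Pr P (rv2 f' (rv2 g' h)) (u, (g' w, h w)) =
    Pr P (rv2 f (rv2 g h)) (phi u, (g w, h w)).
  by apply: Pr_eq => w' n'; rewrite /rv2 !xpair_eqE hf // hg.
rewrite /cPr efgh egh efg eg; apply: mk.
by rewrite gt_eqF // (Pr_at_gt0 hP (rv2 g h)).
Qed.

End Relabel.

Section Bounded.
Variables (R : realType) (X1 X2 Y : finType) (p : X1 * X2 * Y -> R) (K' : nat).
Local Notation K := K'.+1.
Variable a : auxiliary p.
Local Notation x1 := (@rX1 _ _ _ _ _ a).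
Local Notation x2 := (@rX2 _ _ _ _ _ a).
Local Notation y := (@rY _ _ _ _ _ a).
Local Notation v1 := (@V1 _ _ _ _ _ a).
Local Notation v2 := (@V2 _ _ _ _ _ a).
Local Notation w1 := (@W1 _ _ _ _ _ a).
Local Notation w2 := (@W2 _ _ _ _ _ a).
Variables (R1 R2 mu : R) (P : Om a -> R).
Hypothesis hv : valid K' R1 R2 mu P.
Hypothesis hb : forall k, (k < K)%N -> bound1 P k /\ bound2 K' P k.

Lemma bounded_exists : exists b : auxiliary p,
  [/\ markov_chains K b, rate_conditions K b R1 R2 mu & card_bounds K b].
Proof.
have [hP hlaw hch [c1 c2 c3 c4]] := hv.
have [om om0] : exists om, 0 < P om.
  apply: contrapT => /forallNP h; have := proj2 hP; rewrite big1 => [/eqP|w _].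
    by rewrite eq_sym oner_eq0.
  by apply/eqP; rewrite eq_le (proj1 hP) andbT leNgt; apply/negP/h.
have in1 k w : 0 < P w -> v1 k w \in supp P (v1 k) by move=> h; apply/(suppP hP); exists w.
have in2 k w : 0 < P w -> v2 k w \in supp P (v2 k) by move=> h; apply/(suppP hP); exists w.
pose B1 k : finType := {v in supp P (v1 k)}.
pose B2 k : finType := {v in supp P (v2 k)}.
(* Off the support the value is that at [om], an arbitrary point of positive probability; this
   alters the variable on a null set only. *)
pose u1 k w : B1 k := insubd (exist _ (v1 k om) (in1 k om om0) : B1 k) (v1 k w).
pose u2 k w : B2 k := insubd (exist _ (v2 k om) (in2 k om om0) : B2 k) (v2 k w).
have pos w : P w != 0 -> 0 < P w by move=> n; rewrite lt_neqAle eq_sym n (proj1 hP).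
have e1 k w u : P w != 0 -> (u1 k w == u) = (v1 k w == val u).
  by move=> /pos h; rewrite -val_eqE insubdK // in1.
have e2 k w u : P w != 0 -> (u2 k w == u) = (v2 k w == val u).
  by move=> /pos h; rewrite -val_eqE insubdK // in2.
have s1 k : same_on P (u1 k) (v1 k).
  by move=> w w' n n'; rewrite e1 // insubdK // in1 // pos.
have s2 k : same_on P (u2 k) (v2 k).
  by move=> w w' n n'; rewrite e2 // insubdK // in2 // pos.
pose b := @Auxiliary R X1 X2 Y p (Om a) P hP x1 x2 y hlaw B1 B2 u1 u2.
have sw1 l : same_on P (@W1 _ _ _ _ _ b l) (w1 l).
  move=> w w' n n'; elim: l => [|l IH]; first by rewrite !W10_eq.
  by rewrite !W1S_eq IH /= s1 // s2.
have sw2 l : same_on P (@W2 _ _ _ _ _ b l) (w2 l) by exact: same_on_rv2.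
have sid (B : finType) (f : Om a -> B) : same_on P f f by [].
have n1E k : #|B1 k| = nsupp1 P k by rewrite card_sig; apply: eq_card.
have n2E k : #|B2 k| = nsupp2 P k by rewrite card_sig; apply: eq_card.
have nwE l : card_W1 b l = nsuppW P l by apply: eq_bigr => i _; rewrite /= n1E n2E.
exists b; split.
- move=> l lK; have [m1 m2] := hch l lK; split.
    by apply: (markov_relabel hP (phi := val) _ _ m1) => [w u|]; [exact: e1|exact: same_on_rv2].
  by apply: (markov_relabel hP (phi := val) _ _ m2) => [w u|]; [exact: e2|exact: same_on_rv2].
- split=> /=.
  + by rewrite (cminfo_same hP (sid _ x1) (sw1 K) (sid _ x2)).
  + by rewrite (cminfo_same hP (sid _ x2) (s2 K') (sw2 K'))
      (cminfo_same hP (sid _ x2) (sw2 K') (sid _ x1)).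
  + by rewrite (minfo_same hP (sid _ (rv2 x1 x2)) (sw1 K)).
  + by rewrite (minfo_same hP (sid _ y) (sw1 K)).
- split=> [l lK|l lK||] /=; rewrite /card_W2 ?n1E ?n2E nwE ?n1E.
  + have [h _] := hb (ltnW lK : (l < K)%N).
    (* The surplus 3 obtained before the last step is relaxed to the stated 4. *)
    by apply: leq_trans h _; rewrite leq_add2l.
  + have [_ h] := hb (ltnW lK : (l < K)%N).
    by apply: leq_trans h _; rewrite leq_add2l; case: ifP.
  + by have [] := hb (ltnSn K').
  + by have [_] := hb (ltnSn K'); rewrite /bound2 eqxx.
Qed.

End Bounded.


Theorem theorem2 (R : realType) (X1 X2 Y : finType) (p : X1 * X2 * Y -> R)
    (K : nat) (hp : is_pmf p) (hK : (1 <= K)%N) :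
  inner_region p K `<=` cdib_region p K /\
  inner_region_bounded p K = inner_region p K.
Proof.
case: K hK => // K' _; split=> [[[R1 R2] mu] [h0 [a [hm hr]]]|].
  by split=> //; exact: inner_achievable hm _ _ _ hr.
apply/seteqP; split=> -[[R1 R2] mu] [h0 [a]].
  by case=> hm hr _; split=> //; exists a.
case=> hm hr; split=> //.
have hv : valid K' R1 R2 mu (prob (a := a)).
  by split=> //; [exact: prob_pmf|exact: law_XY].
have [P hP hb] := reduce_all hv.
exact: bounded_exists hP hb.
Qed.
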